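(* Under the Markovian switching setup in the context, assume additionally that all roots of $s^{n-1}+b_{n-1}s^{n-2}+\dots+b_2s+b_1=0$ lie strictly inside the unit circle. Then: (i) if $\beta>\frac{1}{2f_M\pi_{\min}}\big(\frac{\gamma\lambda_G^2}{\lambda_2^3}+\gamma\alpha\big)$, then $\lim_{t\to\infty}E[\|x_i(t)-\bar x(t)\|^2]=0$ for all $i=1,\dots,N$; (ii) if $\gamma>\frac1{\lambda_2}$ and $\beta>\frac{1}{2f_M\pi_{\min}}\big(\frac{\gamma^2\lambda_G^2}{\lambda_2^2(\gamma\lambda_2-1)}+\gamma\alpha+1\big)$, then $E[\|x_i(t)-\bar x(t)\|^2]=O(1/t)$ for all $i=1,\dots,N$.
   Context: Fix integers $n\ge 2$ and $N\ge 2$. Let $a_1,\dots,a_n\in\mathbb{R}$, let $A\in\mathbb{R}^{n\times n}$ be the matrix with $A_{k,k+1}=1$ for $k=1,\dots,n-1$, last row $(a_1,a_2,\dots,a_n)$, and all other entries $0$, and let $B=(0,\dots,0,1)^T\in\mathbb{R}^n$. There are $N$ agents with dynamics $x_i(t+1)=Ax_i(t)+Bu_i(t)$, $i=1,\dots,N$, where $x_i(t)\in\mathbb{R}^n$ and $u_i(t)\in\mathbb{R}$; write $\bar x(t)=\frac1N\sum_{i=1}^N x_i(t)$. Gains: real numbers $b_1,\dots,b_{n-1}$, $K_2=[b_1,\dots,b_{n-1},1]$, $K_1=[-a_1+b_1,\,-a_2+b_2-b_1,\,\dots,\,-a_{n-1}+b_{n-1}-b_{n-2},\,-a_n-b_{n-1}+1]$.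 Switching topologies: $G_1,\dots,G_h$ are undirected graphs on $\{1,\dots,N\}$ with edge sets $E_1,\dots,E_h$ and Laplacians $L_1,\dots,L_h$; their union $G'$ (edge set $E_1\cup\dots\cup E_h$) is connected. $N_i'$ is the neighbor set of $i$ in $G'$, $d_i'=|N_i'|$, $d'_{\max}=\max_i d_i'$; $N_i^{(u)}$ is the neighbor set of $i$ in $G_u$. $\{m(t)\}$ is a homogeneous Markov chain on $\{1,\dots,h\}$ with irreducible aperiodic transition matrix, stationary distribution $\pi=(\pi_1,\dots,\pi_h)$, $\pi_{\min}=\min_u\pi_u$, independent of the noises. $\check L=\sum_u\pi_uL_u$ has eigenvalues $0=\lambda_1<\lambda_2\le\dots\le\lambda_N$. Communication: for every ordered pair $(i,j)$ with $j\in N_i'$ and every $t$, $s_{ij}(t)=1$ if $K_2x_j(t)+d_{ij}(t)\le c_{ij}$ and $0$ otherwise, with fixed thresholds $c_{ij}\in\mathbb R$ and noises $d_{ij}(t)$ i.i.d. $N(0,\sigma^2)$, $\sigma>0$; $F,f$ are the distribution function and density of $N(0,\sigma^2)$. Algorithm: fix $\beta>0$, $\gamma>0$, an integer $t_0>\gamma d'_{\max}-1$, deterministic $x_i(t_0+1)=x_i^0$, $\hat z_{ij}(t_0)=\hat z^0_{ij}$ ($j\in N_i'$), and $M>0$ with $|K_2x_i^0|\le M$, $|\hat z^0_{ij}|\le M$. $\Pi_M(\zeta)=\max\{-M,\min\{M,\zeta\}\}$. For $t\ge t_0+1$, all $i$ and $j\in N_i'$: $\hat z_{ij}(t)=\Pi_M\big(\hat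 z_{ij}(t-1)+\tfrac{\beta}{t}\mathbb 1\{j\in N_i^{(m(t))}\}(F(c_{ij}-\hat z_{ij}(t-1))-s_{ij}(t))\big)$, $u_i(t)=K_1x_i(t)+\frac{\gamma}{t+1}\sum_{j\in N_i^{(m(t))}}(\hat z_{ij}(t)-K_2x_i(t))$. Constants: enumerate the $d'=\sum_id_i'$ ordered pairs $(i,j)$, $j\in N_i'$, as $p=1,\dots,d'$. $Q\in\mathbb R^{d'\times N}$ with $Q_{p,k}=1$ if pair $p$ has second component $k$, else $0$; $W_u\in\mathbb R^{N\times d'}$ with $(W_u)_{k,p}=1$ if pair $p=(k,j)$ has first component $k$ and $\{k,j\}\in E_u$, else $0$; $J_N=I_N-\frac1N\mathbf 1\mathbf 1^T$. With spectral norm $\|\cdot\|$ (Euclidean norm for vectors): $\lambda_G=\max_u\|J_NW_u\|^2$, $\lambda_{QW}=\max_u\|QW_u\|^2$, $\lambda_{QL}=\max_u\|QL_u\|^2$, $\alpha=2\sqrt{\lambda_{QW}}+\lambda_{QL}\lambda_2/\lambda_G$, $f_M=\min_{(i,j):\,j\in N_i'}f(|c_{ij}|+M)$. $O(1/t)$ means bounded by $C/t$ for a constant $C$ and all $t\ge t_0+1$. *)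

(* Defs.v *)
From HB Require Import structures.
From mathcomp Require Import all_boot all_order all_algebra.
From mathcomp Require Import all_classical all_reals all_analysis.
From mathcomp Require Import complex.

Set Implicit Arguments.
Unset Strict Implicit.
Unset Printing Implicit Defensive.

Import Order.TTheory GRing.Theory Num.Theory.
Local Open Scope classical_set_scope.
Local Open Scope ring_scope.

Section Defs.
Variable R : realType.

Definition sqnorm (p : nat) (v : 'cV[R]_p) : R := \sum_(k < p) (v k 0) ^+ 2.
Definition vnorm (p : nat) (v : 'cV[R]_p) : R := Num.sqrt (sqnorm v).
Definition opnorm (p q : nat) (M : 'M[R]_(p, q)) : R :=
  sup [set r | exists v : 'cV[R]_q, vnorm v <= 1 /\ r = vnorm (M *m v)].

Definition rdot (p : nat) (K : 'rV[R]_p) (v : 'cV[R]_p) : R :=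
  \sum_(k < p) K 0 k * v k 0.

(* ---------- agent dynamics and gains (paper's 1-based a_k, b_k) ---------- *)

Definition Amat (n : nat) (a : nat -> R) : 'M[R]_n :=
  \matrix_(k < n, l < n)
    (if k.+1 == n then a l.+1 else if l == k.+1 :> nat then 1 else 0).
Definition Bvec (n : nat) : 'cV[R]_n := \col_(k < n) (if k.+1 == n then 1 else 0).
Definition bext (n : nat) (b : nat -> R) (k : nat) : R :=
  if k == 0%N then 0 else if k == n then 1 else b k.
Definition K2 (n : nat) (b : nat -> R) : 'rV[R]_n := \row_(l < n) bext n b l.+1.
(* K1 = [-a_1+b_1, -a_2+b_2-b_1, ..., -a_{n-1}+b_{n-1}-b_{n-2}, -a_n-b_{n-1}+1] *)
Definition K1 (n : nat) (a b : nat -> R) : 'rV[R]_n :=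
  \row_(l < n) (- a l.+1 + bext n b l.+1 - bext n b l).

Definition bpoly (n : nat) (b : nat -> R) : {poly R[i]} :=
  'X^(n.-1) + \sum_(1 <= k < n) ((b k)%:C)%C *: 'X^(k.-1).

Definition adjU (N h : nat) (E : 'I_h -> rel 'I_N) : rel 'I_N :=
  fun i j => [exists u, E u i j].
Definition nbrU (N h : nat) (E : 'I_h -> rel 'I_N) (i : 'I_N) : {set 'I_N} :=
  [set j | adjU E i j].
Definition dmaxU (N h : nat) (E : 'I_h -> rel 'I_N) : nat :=
  \max_(i : 'I_N) #|nbrU E i|.
Definition laplacian (N : nat) (e : rel 'I_N) : 'M[R]_N :=
  \matrix_(i, j) (if i == j then (#|[set k | e i k]|)%:R else - (e i j)%:R).

Definition npairs (N h : nat) (E : 'I_h -> rel 'I_N) : nat :=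
  #|[pred p : 'I_N * 'I_N | adjU E p.1 p.2]|.
Definition pairOf (N h : nat) (E : 'I_h -> rel 'I_N) (p : 'I_(npairs E)) :
  'I_N * 'I_N := enum_val p.
Definition Qmat (N h : nat) (E : 'I_h -> rel 'I_N) : 'M[R]_(npairs E, N) :=
  \matrix_(p, k) ((pairOf p).2 == k)%:R.
Definition Wmat (N h : nat) (E : 'I_h -> rel 'I_N) (u : 'I_h) : 'M[R]_(N, npairs E) :=
  \matrix_(k, p) (((pairOf p).1 == k) && E u (pairOf p).1 (pairOf p).2)%:R.
Definition Jmat (N : nat) : 'M[R]_N := 1%:M - (N%:R)^-1 *: const_mx 1.

Definition lambdaG (N h : nat) (E : 'I_h -> rel 'I_N) : R :=
  \big[Num.max/0]_(u : 'I_h) (opnorm (Jmat N *m Wmat E u)) ^+ 2.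
Definition lambdaQW (N h : nat) (E : 'I_h -> rel 'I_N) : R :=
  \big[Num.max/0]_(u : 'I_h) (opnorm (Qmat E *m Wmat E u)) ^+ 2.
Definition lambdaQL (N h : nat) (E : 'I_h -> rel 'I_N) : R :=
  \big[Num.max/0]_(u : 'I_h) (opnorm (Qmat E *m laplacian (E u))) ^+ 2.
Definition alphaC (N h : nat) (E : 'I_h -> rel 'I_N) (lambda2 : R) : R :=
  2 * Num.sqrt (lambdaQW E) + lambdaQL E * lambda2 / lambdaG E.

Definition Fn (sigma x : R) : R := fine (normal_prob 0 sigma `]-oo, x]).
Definition fn (sigma x : R) : R := normal_pdf 0 sigma x.

(* f_M = min over ordered pairs (i,j), j in N_i', of f(|c_ij| + M).
   All these values are <= f(0), so f(0) is a neutral element; the set of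
   pairs is nonempty since G' is connected and N >= 2. *)
Definition fM (N h : nat) (E : 'I_h -> rel 'I_N) (c : 'I_N -> 'I_N -> R)
  (sigma M : R) : R :=
  \big[Num.min/fn sigma 0]_(p : 'I_N * 'I_N | adjU E p.1 p.2)
     fn sigma (`|c p.1 p.2| + M).

(* pi_min; all pi_u <= 1 so 1 is neutral *)
Definition pimin (h : nat) (pi : 'I_h -> R) : R := \big[Num.min/1]_(u : 'I_h) pi u.

Definition stochastic (h : nat) (Pm : 'M[R]_h) : Prop :=
  (forall u v, 0 <= Pm u v) /\ (forall u, \sum_v Pm u v = 1).
Definition irreducible (h : nat) (Pm : 'M[R]_h) : Prop :=
  forall u v, exists k : nat, (0 < k)%N /\ 0 < (Pm ^+ k) u v.
Definition aperiodic (h : nat) (Pm : 'M[R]_h) : Prop :=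
  forall (u : 'I_h) (d : nat), (1 < d)%N ->
    exists k : nat, [/\ (0 < k)%N, 0 < (Pm ^+ k) u u & ~~ (d %| k)%N].
Definition stationary (h : nat) (Pm : 'M[R]_h) (pi : 'I_h -> R) : Prop :=
  [/\ forall u, 0 <= pi u, \sum_u pi u = 1 &
      forall v, \sum_u pi u * Pm u v = pi v].

Definition projM (M z : R) : R := Num.max (- M) (Num.min M z).

(* state at step k: (x(t), zhat(t-1)) with t = t0 + 1 + k.
   mt : nat -> 'I_h is the switching path m(t), dt t i j the noise d_ij(t). *)
Fixpoint traj (n N h : nat) (a b : nat -> R) (E : 'I_h -> rel 'I_N)
  (c : 'I_N -> 'I_N -> R) (sigma beta gamma M : R) (t0 : nat)
  (x0 : 'I_N -> 'cV[R]_n) (z0 : 'I_N -> 'I_N -> R)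
  (mt : nat -> 'I_h) (dt : nat -> 'I_N -> 'I_N -> R) (k : nat)
  : ('I_N -> 'cV[R]_n) * ('I_N -> 'I_N -> R) :=
  match k with
  | 0%N => (x0, z0)
  | k'.+1 =>
    let st := traj a b E c sigma beta gamma M t0 x0 z0 mt dt k' in
    let x := st.1 in let zp := st.2 in
    let t := (t0 + 1 + k')%N in
    let s i j : R := (((rdot (K2 n b) (x j) + dt t i j <= c i j)%R : bool) : nat)%:R in
    let z i j : R :=
      if adjU E i j then
        projM M (zp i j + beta / t%:R * (E (mt t) i j)%:R
                           * (Fn sigma (c i j - zp i j) - s i j))
      else zp i j in
    let ui i : R := rdot (K1 n a b) (x i)
        + gamma / (t.+1)%:R * \sum_(j | E (mt t) i j) (z i j - rdot (K2 n b) (x i)) in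
    ((fun i => Amat n a *m x i + ui i *: Bvec n), z)
  end.

(* x_i(t) for t >= t0 + 1 *)
Definition xstate (n N h : nat) (a b : nat -> R) (E : 'I_h -> rel 'I_N)
  (c : 'I_N -> 'I_N -> R) (sigma beta gamma M : R) (t0 : nat)
  (x0 : 'I_N -> 'cV[R]_n) (z0 : 'I_N -> 'I_N -> R)
  (mt : nat -> 'I_h) (dt : nat -> 'I_N -> 'I_N -> R) (t : nat) : 'I_N -> 'cV[R]_n :=
  (traj a b E c sigma beta gamma M t0 x0 z0 mt dt (t - t0 - 1)%N).1.

Definition xbar (n N : nat) (x : 'I_N -> 'cV[R]_n) : 'cV[R]_n :=
  (N%:R)^-1 *: \sum_(i < N) x i.

End Defs.

Definition chain_ev {d} {T : measurableType d} (h : nat)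
  (m : nat -> T -> 'I_h) (k : nat) (u : nat -> 'I_h) : set T :=
  [set w | forall s, (s <= k)%N -> m s w = u s].

(* Main.v *)
Require Import Defs.
From HB Require Import structures.
From mathcomp Require Import all_boot all_order all_algebra.
From mathcomp Require Import all_classical all_reals all_analysis.
From mathcomp Require Import measurable_realfun complex ring lra zify.
Import Order.TTheory GRing.Theory Num.Theory numFieldNormedType.Exports.
Local Open Scope classical_set_scope.
Local Open Scope ring_scope.
Set Implicit Arguments.
Unset Strict Implicit.
Unset Printing Implicit Defensive.

(** The outputs y_i = K2 x_i satisfy y(t+1) = y + g/(t+1) (W_u zhat - D_u y), and
    a deviation x_i - xbar is recovered from y_i - ybar by a linear recursion with
    characteristic polynomial [bpoly], so it inherits the mean square decay of
    y_i - ybar (one stable first-order complex recursion per root).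

    Noise enters only through the bits s_ij, hence at each time the state takes
    finitely many values, and its law is computed by iterating explicit one-step
    operators [Tk] on pairs (state, topology).

    With delta = J y and e = zhat - Q y, both bounded, a weighted sum
    w1 |delta|^2 + w2 |e|^2 has one-step drift q_u / t + O(1/t^2), where q_u depends
    on the current topology u. Solving Poisson's equation for the chain gives a
    corrector that replaces q_u by its stationary mean up to O(1/t^2), and the
    assumptions on beta and gamma make that mean at most -kappa times the weighted
    sum, with kappa > 0 in case (i) and kappa > 1 in case (ii). Hence
    v(t+1) <= (1 - kappa/t) v(t) + C/t^2, which yields convergence to 0 and the
    rate O(1/t) respectively. *)

(** * Scalar recursions and their decay *)

Section Sequences.
Context {R : realType}.
Implicit Types (v a c q : nat -> R).

(** The bounds on [beta] are determinant conditions. Put p = gamma lambda_2, q = gamma lambda_G /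
    lambda_2 and r = 2 beta f_M pi_min - gamma alpha. The mean drift of the pair (|delta|^2, |e|^2)
    is governed by the symmetric matrix [[p, -q], [-q, r]]; the assumption of (i) reads p r > q^2,
    that of (ii) reads (p - 1)(r - 1) > q^2 with p > 1, so the least eigenvalue exceeds 0,
    respectively 1. The weights and kappa are read off this matrix.

    No single topology need contract anything: its graph may be disconnected, and only the estimates
    on its links are updated. Contraction holds for the stationary mean only, which is why a
    corrector is needed.

    All remainders must be uniform in the state. This comes from boundedness: estimates are
    projected to [-M, M], and t_0 > gamma d'_max - 1 makes each new output a convex combination of
    numbers in [-M, M].

    The error e contracts in mean because a bit has conditional mean F(c - y), and F has slope at
    least f_M on the range where its arguments live. *)

Definition tends_le0 v := forall e : R, 0 < e -> exists K : nat,
  forall k : nat, (K <= k)%N -> v k <= e.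

(** Like [tends_le0], an upper bound only: the corrected Lyapunov value may be negative. *)
Definition O_inv v := exists C : R, forall k : nat, v k <= C / k.+1%:R.

Lemma contraction_le v (rho D : R) : 0 <= rho -> rho < 1 ->
  (forall k, v k.+1 <= rho * v k + D) ->
  forall k, v k <= Num.max (v 0%N) (D / (1 - rho)).
Proof.
move=> r0 r1 H; set B := Num.max _ _.
have rp : 0 < 1 - rho by rewrite subr_gt0.
have hB : D <= (1 - rho) * B.
  by rewrite mulrC -ler_pdivrMr // /B le_max lexx orbT.
elim=> [|k IH]; first by rewrite /B le_max lexx.
apply: le_trans (H k) _.
have : rho * v k <= rho * B by apply: ler_wpM2l.
lra.
Qed.

(** The sequence (k+1) v_k obeys the same contraction with bounded forcing; the extra term rho v_k
    is bounded beforehand by [contraction_le]. *)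
Lemma contraction_O_inv v q (rho D : R) : 0 <= rho -> rho < 1 -> 0 <= D ->
  (forall k, v k.+1 <= rho * v k + D * q k) -> O_inv q -> O_inv v.
Proof.
move=> r0 r1 D0 H [C HC].
set C' := Num.max C 0.
have C'0 : 0 <= C' by rewrite /C' le_max lexx orbT.
have Hq k : D * q k <= D * C' / k.+1%:R.
  rewrite -mulrA; apply: ler_wpM2l => //; apply: le_trans (HC k) _.
  by apply: ler_wpM2r; rewrite ?invr_ge0 ?ler0n // /C' le_max lexx.
have DC0 : 0 <= D * C' by apply: mulr_ge0.
have H1 k : v k.+1 <= rho * v k + D * C'.
  apply: le_trans (H k) _; rewrite lerD2l; apply: le_trans (Hq k) _.
  by rewrite ler_piMr // invf_le1 ?ltr0n // ler1n.
have bv := contraction_le r0 r1 H1.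
set B := Num.max _ _ in bv.
pose w k := k.+1%:R * v k.
have H2 k : w k.+1 <= rho * w k + (rho * B + D * C' * 2).
  rewrite /w; have s0 : 0 < k.+1%:R :> R by rewrite ltr0n.
  have -> : k.+2%:R = k.+1%:R + 1 :> R by rewrite -[k.+2%:R]natr1.
  have e1 : (k.+1%:R + 1) * v k.+1 <= (k.+1%:R + 1) * (rho * v k + D * C' / k.+1%:R).
    apply: ler_wpM2l; first by lra.
    by apply: le_trans (H k) _; rewrite lerD2l.
  apply: le_trans e1 _.
  have -> : (k.+1%:R + 1) * (rho * v k + D * C' / k.+1%:R) =
     rho * (k.+1%:R * v k) + rho * v k + D * C' + D * C' / k.+1%:R.
    by field; lra.
  have e2 : rho * v k <= rho * B by apply: ler_wpM2l.
  have e3 : D * C' / k.+1%:R <= D * C'.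
    by rewrite ler_piMr // invf_le1 ?ltr0n // ler1n.
  move: e2 e3; set z1 := D * C' / _; set z2 := D * C'; set z3 := rho * v k.
  by set z4 := rho * (_ * _); set z5 := rho * B; lra.
have bw := contraction_le r0 r1 H2.
eexists => k; rewrite ler_pdivlMr ?ltr0n // mulrC; exact: bw.
Qed.

Lemma averaging_tends_le0 v a c :
  (forall k, 0 <= a k <= 1) ->
  (forall B : R, exists K, B <= \sum_(0 <= k < K) a k) ->
  (forall k, v k.+1 <= (1 - a k) * v k + a k * c k) ->
  tends_le0 c -> tends_le0 v.
Proof.
move=> Ha Hdiv H Hc e e0.
have e2 : 0 < e / 2 by lra.
have [K HK] := Hc _ e2.
pose A k := \sum_(0 <= i < k) a i.
have An k : A k.+1 = A k + a k by rewrite /A big_nat_recr.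
have Amono k j : A k <= A (k + j)%N.
  elim: j => [|j IH]; first by rewrite addn0.
  by rewrite addnS An; have := Ha (k + j)%N; lra.
set W := Num.max (v K - e / 2) 0.
have W0 : 0 <= W by rewrite /W le_max lexx orbT.
(* Since (1 - a)(1 + s + a) <= 1 + s, the excess of v over e/2 decays at
   least like the inverse of 1 + a_K + ... + a_(k-1). *)
have key j : (v (K + j)%N - e / 2) * (1 + (A (K + j)%N - A K)) <= W.
  elim: j => [|j IH].
    by rewrite addn0 subrr addr0 mulr1 /W le_max lexx.
  rewrite addnS An; have [a0 a1] := andP (Ha (K + j)%N).
  have AK := Amono K j.
  set s := A (K + j)%N - A K in IH *.
  have s0 : 0 <= s by rewrite /s; lra.
  set w := v (K + j)%N - e / 2 in IH *.
  set x := a (K + j)%N in a0 a1 *.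
  have hs : A (K + j)%N + x - A K = s + x by rewrite /s; lra.
  rewrite hs.
  have hw : v (K + j).+1 - e / 2 <= (1 - x) * w.
    have := H (K + j)%N; rewrite -/x.
    have : x * c (K + j)%N <= x * (e / 2).
      by apply: ler_wpM2l => //; apply: HK; rewrite leq_addr.
    rewrite /w; lra.
  have p1 : (v (K + j).+1 - e / 2) * (1 + (s + x)) <= (1 - x) * w * (1 + (s + x)).
    by apply: ler_wpM2r => //; lra.
  apply: le_trans p1 _.
  have [w0|w0] := lerP 0 w.
    have : 0 <= w * (x * s + x * x).
      by apply: mulr_ge0 => //; apply: addr_ge0; apply: mulr_ge0.
    lra.
  apply: le_trans W0; rewrite -mulrA mulr_ge0_le0 //; first by lra.
  by apply: mulr_le0_ge0; lra.
(* Once the weights accumulated after K reach W / (e/2), a value v_k > e would make the left side of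
   [key] at least e/2 + W. *)
have [K2 HK2] := Hdiv (A K + W / (e / 2)).
exists (K + K2)%N => k hk.
have := key (k - K)%N; rewrite subnKC; last by apply: leq_trans hk; rewrite leq_addr.
have hA : A K + W / (e / 2) <= A k.
  apply: le_trans HK2 _; have := Amono K2 (k - K2)%N.
  by rewrite subnKC //; apply: leq_trans hk; rewrite leq_addl.
move=> hk2; rewrite leNgt; apply/negP => hlt.
have : (e / 2) * (1 + W / (e / 2)) <= (v k - e / 2) * (1 + (A k - A K)).
  apply: ler_pM; try lra.
  by apply: addr_ge0 => //; apply: divr_ge0 => //; lra.
have -> : (e / 2) * (1 + W / (e / 2)) = e / 2 + W by field; lra.
lra.
Qed.

(** Since T + k <= T (k + 1), the series dominates kappa / T times the harmonic series. *)
Lemma harmonic_unbounded (T : nat) (kappa : R) : 0 < kappa -> (0 < T)%N ->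
  forall B : R, exists K, B <= \sum_(0 <= k < K) kappa / (T + k)%:R.
Proof.
move=> k0 T0 B.
have tp k : 0 < (T + k)%:R :> R by rewrite ltr0n; lia.
have : exists K, B * T%:R / kappa <= series harmonic K :> R.
  apply/not_existsP => h; apply: (@dvg_harmonic R).
  apply: nondecreasing_is_cvgn.
    apply/nondecreasing_seqP => k; rewrite /series /= big_nat_recr //= lerDl.
    by rewrite /harmonic invr_ge0.
  exists (B * T%:R / kappa) => _ [k _ <-].
  by have /negP := h k; rewrite -ltNge => /ltW.
move=> [K HK]; exists K.
have {}HK : B <= kappa / T%:R * series harmonic K.
  have T0' : 0 < T%:R :> R by rewrite ltr0n.
  have := ler_wpM2l (ltW (divr_gt0 k0 T0')) HK.
  by have -> : kappa / T%:R * (B * T%:R / kappa) = B by field; lra.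
apply: le_trans HK _; rewrite /series /= mulr_sumr; apply: ler_sum => k _.
rewrite /harmonic -mulrA; apply: ler_wpM2l; first exact: ltW.
rewrite -invfM lef_pV2 ?posrE -?natrM ?ltr0n ?muln_gt0 ?T0 ?ler_nat //; last by lia.
by rewrite mulnS leq_add2l leq_pmull.
Qed.

(** The recursion is an averaging with weights kappa/t towards C / (kappa t). The cap on kappa keeps
    the weights below 1 from the start. *)
Lemma drift_tends_le0 v (T : nat) (kappa C : R) : (0 < T)%N ->
  0 < kappa <= 1 -> 0 <= C ->
  (forall k, v k.+1 <= (1 - kappa / (T + k)%:R) * v k + C / (T + k)%:R ^+ 2) ->
  tends_le0 v.
Proof.
move=> T0 /andP[k0 k1] C0 H.
have tp k : 0 < (T + k)%:R :> R by rewrite ltr0n; lia.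
have t1 k : 1 <= (T + k)%:R :> R by rewrite ler1n; lia.
apply: (@averaging_tends_le0 v (fun k => kappa / (T + k)%:R)
   (fun k => C / kappa / (T + k)%:R)).
- move=> k; apply/andP; split; first by apply: divr_ge0; rewrite ?ler0n // ltW.
  by rewrite ler_pdivrMr ?tp // mul1r; exact: le_trans k1 (t1 k).
- exact: harmonic_unbounded.
- move=> k; apply: le_trans (H k) _; rewrite lerD2l.
  rewrite (_ : kappa / _ * _ = C / (T + k)%:R ^+ 2) //.
  by have := tp k; move=> ?; field; lra.
move=> e e0; have Ck : 0 <= C / kappa / e by rewrite !divr_ge0 // ltW.
exists (Num.truncn (C / kappa / e)).+1 => k hk.
rewrite ler_pdivrMr ?tp // -ler_pdivrMl // mulrC.
apply: le_trans (ltW (truncnS_gt _)) _; rewrite ler_nat.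
by apply: leq_trans hk _; lia.
Qed.

(** Multiplying by t turns the factor 1 - kappa/t into 1 - (kappa - 1)/t with forcing D/t, so t v
    stays bounded when kappa > 1. The cap kappa <= 2 keeps this factor nonnegative already at t =
    1. *)
Lemma drift_O_inv v (T : nat) (kappa C B : R) : (0 < T)%N ->
  1 < kappa <= 2 -> 0 <= C -> (forall k, `|v k| <= B) ->
  (forall k, v k.+1 <= (1 - kappa / (T + k)%:R) * v k + C / (T + k)%:R ^+ 2) ->
  O_inv v.
Proof.
move=> T0 /andP[k1 k2] C0 HB H.
have tp k : 0 < (T + k)%:R :> R by rewrite ltr0n; lia.
have t1 k : 1 <= (T + k)%:R :> R by rewrite ler1n; lia.
pose w k := (T + k)%:R * v k.
have B0 : 0 <= B by apply: le_trans (HB 0%N).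
set D := kappa * B + C * 2.
have D0 : 0 <= D by rewrite /D; apply: addr_ge0; apply: mulr_ge0 => //; lra.
have Hw k : w k.+1 <= (1 - (kappa - 1) / (T + k)%:R) * w k + D / (T + k)%:R.
  rewrite /w addnS -natr1; have tk := tp k; have t1k := t1 k.
  set t := (T + k)%:R in tk t1k *.
  have e1 : (t + 1) * v k.+1 <= (t + 1) * ((1 - kappa / t) * v k + C / t ^+ 2).
    by apply: ler_wpM2l; [lra|exact: H].
  apply: le_trans e1 _.
  have -> : (t + 1) * ((1 - kappa / t) * v k + C / t ^+ 2) =
    (1 - (kappa - 1) / t) * (t * v k) + (kappa * - v k + C + C / t) / t.
    by field; lra.
  rewrite lerD2l; apply: ler_wpM2r; first by rewrite invr_ge0 ltW.
  have : C / t <= C by rewrite ler_piMr // invf_le1.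
  have : kappa * - v k <= kappa * B.
    apply: ler_wpM2l; first by lra.
    by apply: le_trans (HB k); rewrite -normrN ler_norm.
  by rewrite /D; lra.
set W := Num.max (w 0%N) (D / (kappa - 1)).
have W0 : 0 <= W by rewrite /W le_max divr_ge0 ?orbT //; lra.
have bw k : w k <= W.
  elim: k => [|k IH]; first by rewrite /W le_max lexx.
  apply: le_trans (Hw k) _; have tk := tp k; have t1k := t1 k.
  set t := (T + k)%:R in tk t1k *.
  have hD : D / t <= (kappa - 1) * W / t.
    apply: ler_wpM2r; first by rewrite invr_ge0 ltW.
    by rewrite mulrC -ler_pdivrMr ?/W ?le_max ?lexx ?orbT //; lra.
  have : (1 - (kappa - 1) / t) * w k <= (1 - (kappa - 1) / t) * W.
    apply: ler_wpM2l => //; rewrite subr_ge0 ler_pdivrMr //; lra.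
  lra.
exists W => k; rewrite ler_pdivlMr ?ltr0n // mulrC.
(* For negative v_k, replacing k + 1 by T + k would go the wrong way. *)
have [v0|v0] := lerP 0 (v k); last first.
  by apply: le_trans W0; rewrite mulr_ge0_le0 ?ler0n // ltW.
apply: le_trans (bw k); rewrite /w; apply: ler_wpM2r => //.
by rewrite ler_nat; lia.
Qed.

(** Averaging with the constant weight 1 - rho towards D q / (1 - rho). *)
Lemma contraction_tends_le0 v q (rho D : R) : 0 <= rho -> rho < 1 -> 0 <= D ->
  (forall k, v k.+1 <= rho * v k + D * q k) -> tends_le0 q -> tends_le0 v.
Proof.
move=> r0 r1 D0 H Hq.
apply: (@averaging_tends_le0 v (fun => 1 - rho) (fun k => D / (1 - rho) * q k)).
- by move=> _; lra.
- move=> B; exists (Num.truncn `|B / (1 - rho)|).+1.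
  rewrite sumr_const_nat subn0 -[X in _ <= X]mulr_natr mulrC -ler_pdivrMr; last by lra.
  by apply: le_trans (ler_norm _) _; rewrite ltW // truncnS_gt.
- move=> k; rewrite (_ : (1 - rho) * _ = D * q k); last by field; lra.
  by rewrite subKr.
move=> e e0.
have D1 : 0 <= D / (1 - rho) by apply: divr_ge0 => //; lra.
have [K HK] := Hq (e / (D / (1 - rho) + 1)) (divr_gt0 e0 (ltr_wpDl D1 ltr01)).
exists K => k hk; apply: le_trans (ler_wpM2l D1 (HK k hk)) _.
rewrite mulrA ler_pdivrMr ?ltr_wpDl //; lra.
Qed.

End Sequences.

(** * Euclidean inner product and operator norm *)

Section Euclidean.
Context {R : realType}.

Definition dot (p : nat) (u v : 'cV[R]_p) : R := \sum_(k < p) u k 0 * v k 0.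

Lemma sqnorm_ge0 p (v : 'cV[R]_p) : 0 <= sqnorm v.
Proof. by apply: sumr_ge0 => k _; exact: sqr_ge0. Qed.

Lemma dotvv p (v : 'cV[R]_p) : dot v v = sqnorm v.
Proof. by apply: eq_bigr => k _; rewrite expr2. Qed.

Lemma dotC p (u v : 'cV[R]_p) : dot u v = dot v u.
Proof. by apply: eq_bigr => k _; rewrite mulrC. Qed.

Lemma dotDr p (u v w : 'cV[R]_p) : dot u (v + w) = dot u v + dot u w.
Proof. by rewrite -big_split; apply: eq_bigr => k _; rewrite mxE mulrDr. Qed.

Lemma dotZr p a (u v : 'cV[R]_p) : dot u (a *: v) = a * dot u v.
Proof. by rewrite /dot mulr_sumr; apply: eq_bigr => k _; rewrite mxE mulrCA. Qed.

Lemma dotDl p (u v w : 'cV[R]_p) : dot (u + v) w = dot u w + dot v w.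
Proof. by rewrite dotC dotDr !(dotC w). Qed.

Lemma dotZl p a (u v : 'cV[R]_p) : dot (a *: u) v = a * dot u v.
Proof. by rewrite dotC dotZr dotC. Qed.

Lemma dotNr p (u v : 'cV[R]_p) : dot u (- v) = - dot u v.
Proof. by rewrite -scaleN1r dotZr mulN1r. Qed.

Lemma dotBr p (u v w : 'cV[R]_p) : dot u (v - w) = dot u v - dot u w.
Proof. by rewrite dotDr dotNr. Qed.

Lemma dot_mulmxr p q (A : 'M[R]_(p, q)) u v : dot u (A *m v) = dot (A^T *m u) v.
Proof.
rewrite /dot; under eq_bigr do rewrite mxE mulr_sumr.
rewrite exchange_big; apply: eq_bigr => j _; rewrite mxE mulr_suml.
by apply: eq_bigr => i _; rewrite mxE mulrCA mulrA.
Qed.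

Lemma sqnormD p (u v : 'cV[R]_p) :
  sqnorm (u + v) = sqnorm u + 2 * dot u v + sqnorm v.
Proof. by rewrite -!dotvv dotDr !(dotC (u + v)) !dotDr (dotC v u); lra. Qed.

Lemma sqnormZ p a (v : 'cV[R]_p) : sqnorm (a *: v) = a ^+ 2 * sqnorm v.
Proof. by rewrite -!dotvv dotZr dotC dotZr mulrA expr2. Qed.

Lemma sqnorm_eq0 p (v : 'cV[R]_p) : sqnorm v = 0 -> v = 0.
Proof.
move=> /eqP; rewrite psumr_eq0; last by move=> k _; exact: sqr_ge0.
move=> /allP h; apply/matrixP => i j; rewrite ord1 mxE.
by have := h i (mem_index_enum _); rewrite /= sqrf_eq0 => /eqP.
Qed.

Lemma dot0r p (u : 'cV[R]_p) : dot u 0 = 0.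
Proof. by rewrite -(scale0r (0 : 'cV[R]_p)) dotZr mul0r. Qed.

(** Stated through sqnorm v <= th * ka so that operator norm bounds fit directly, and with th = 0
    allowed since [lambdaQW] and [lambdaQL] are only known to be nonnegative. *)
Lemma Young_dot p (u v : 'cV[R]_p) (th ka : R) :
  0 <= th -> 0 <= ka -> sqnorm v <= th * ka ->
  2 * dot u v <= th * sqnorm u + ka.
Proof.
rewrite le_eqVlt => /predU1P[<-|th0] ka0 h.
  rewrite mul0r in h; have /sqnorm_eq0 -> : sqnorm v = 0.
    by apply/eqP; rewrite eq_le h sqnorm_ge0.
  by rewrite dot0r mulr0 mul0r add0r.
have := sqnorm_ge0 (th *: u - v).
rewrite sqnormD sqnormZ dotC dotZr dotC -scaleN1r sqnormZ dotZr => h2.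
rewrite -(ler_pM2l th0); lra.
Qed.

Lemma CauchySchwarz_dot p (u v : 'cV[R]_p) : dot u v ^+ 2 <= sqnorm u * sqnorm v.
Proof.
have [u0|u0] := eqVneq (sqnorm u) 0.
  by rewrite u0 (sqnorm_eq0 u0) dotC dot0r expr0n mul0r.
have up : 0 < sqnorm u by rewrite lt_neqAle eq_sym u0 sqnorm_ge0.
have := sqnorm_ge0 (sqnorm u *: v - dot u v *: u).
rewrite sqnormD sqnormZ -scaleNr sqnormZ dotZr [dot (_ *: _) _]dotC dotZr.
by move=> h; rewrite -(ler_pM2l up); lra.
Qed.

(** The Frobenius bound serves only to show that the supremum in [opnorm] is over a bounded set. *)
Lemma sqnorm_mulmx_frob p q (A : 'M[R]_(p, q)) v :
  sqnorm (A *m v) <= (\sum_i \sum_j A i j ^+ 2) * sqnorm v.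
Proof.
rewrite [leLHS]/sqnorm mulr_suml; apply: ler_sum => i _; rewrite mxE.
have -> : \sum_j A i j * v j 0 = dot (row i A)^T v.
  by apply: eq_bigr => j _; rewrite !mxE.
apply: le_trans (CauchySchwarz_dot _ _) _; apply: ler_wpM2r; first exact: sqnorm_ge0.
by rewrite le_eqVlt; apply/orP; left; apply/eqP/eq_bigr => j _; rewrite !mxE.
Qed.

Lemma sqr_vnorm p (v : 'cV[R]_p) : vnorm v ^+ 2 = sqnorm v.
Proof. by rewrite sqr_sqrtr // sqnorm_ge0. Qed.

Lemma opnorm_ge p q (A : 'M[R]_(p, q)) (v : 'cV[R]_q) :
  vnorm v <= 1 -> vnorm (A *m v) <= opnorm A.
Proof.
move=> v1; apply: ub_le_sup; last by exists v.
exists (Num.sqrt (\sum_i \sum_j A i j ^+ 2)) => _ [w [w1 ->]].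
apply: ler_wsqrtr; apply: le_trans (sqnorm_mulmx_frob _ _) _.
rewrite ler_piMr //; first by do 2![apply: sumr_ge0 => ? _]; exact: sqr_ge0.
by rewrite -sqr_vnorm expr_le1 // sqrtr_ge0.
Qed.

Lemma sqnorm_mulmx_le p q (A : 'M[R]_(p, q)) v :
  sqnorm (A *m v) <= opnorm A ^+ 2 * sqnorm v.
Proof.
have [v0|v0] := eqVneq (sqnorm v) 0.
  by rewrite v0 (sqnorm_eq0 v0) mulmx0 mulr0 -(scale0r (0 : 'cV[R]_p)) sqnormZ expr0n mul0r.
have vp : 0 < vnorm v by rewrite sqrtr_gt0 lt_neqAle eq_sym v0 sqnorm_ge0.
have h : vnorm ((vnorm v)^-1 *: v) = 1.
  rewrite /vnorm sqnormZ exprVn sqr_vnorm mulVf //.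
  by rewrite sqrtr1.
have := @opnorm_ge _ _ A ((vnorm v)^-1 *: v); rewrite h lexx => /(_ isT) h1.
have o0 : 0 <= vnorm (A *m ((vnorm v)^-1 *: v)) by exact: sqrtr_ge0.
move: h1 (le_trans o0 h1) => /[swap] o1; rewrite -ler_sqr ?nnegrE //.
rewrite sqr_vnorm -scalemxAr sqnormZ exprVn ler_pdivrMl ?exprn_gt0 // sqr_vnorm.
by rewrite mulrC.
Qed.

End Euclidean.

(** * Graph Laplacians and the projection onto disagreement *)

Section Laplacian.
Context {R : realType}.
Variable N : nat.

Lemma laplacian_mulmxE (e : rel 'I_N) (v : 'cV[R]_N) i : irreflexive e ->
  (laplacian R e *m v) i 0 = \sum_(j | e i j) (v i 0 - v j 0).
Proof.
move=> eirr; rewrite mxE (bigD1 i) //= mxE eqxx.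
rewrite big_split /= sumr_const -[v i 0 *+ _]mulr_natl; congr (_ * _ + _).
  by congr (_%:R); apply: eq_card => j; apply/idP/idP; rewrite in_setE.
rewrite [in RHS]big_mkcond [RHS](bigD1 i) //= eirr add0r.
apply: eq_bigr => j ji; rewrite mxE eq_sym (negbTE ji).
by case: (e i j); rewrite ?mulN1r ?oppr0 ?mul0r.
Qed.

Lemma laplacian_tr (e : rel 'I_N) : symmetric e ->
  (laplacian R e)^T = laplacian R e.
Proof.
move=> es; apply/matrixP => i j; rewrite !mxE eq_sym.
by case: eqP => [->|_] //; rewrite es.
Qed.

Lemma laplacian_mul1 (e : rel 'I_N) : irreflexive e ->
  laplacian R e *m const_mx 1 = 0 :> 'cV[R]_N.
Proof.
move=> eirr; apply/matrixP => i j; rewrite ord1 laplacian_mulmxE //.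
by rewrite big1 => [|k _]; rewrite !mxE ?subrr.
Qed.

(** Symmetrisation: the form is written twice, with the roles of i and j exchanged, and added. Each
    edge occurs in both orders, hence the factor 2. *)
Lemma dot_laplacian (e : rel 'I_N) (v : 'cV[R]_N) : symmetric e -> irreflexive e ->
  2 * dot v (laplacian R e *m v) = \sum_i \sum_(j | e i j) (v i 0 - v j 0) ^+ 2.
Proof.
move=> es eirr.
have h : dot v (laplacian R e *m v) = \sum_i \sum_(j | e i j) v i 0 * (v i 0 - v j 0).
  by apply: eq_bigr => i _; rewrite laplacian_mulmxE // mulr_sumr.
have h2 : dot v (laplacian R e *m v) = \sum_i \sum_(j | e i j) v j 0 * (v j 0 - v i 0).
  rewrite h; under eq_bigr do rewrite big_mkcond.
  rewrite exchange_big; apply: eq_bigr => i _; rewrite [RHS]big_mkcond.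
  by apply: eq_bigr => j _; rewrite es.
rewrite mulr2n mulrDl mul1r {1}h h2 -big_split; apply: eq_bigr => i _.
by rewrite -big_split; apply: eq_bigr => j _; rewrite /=; ring.
Qed.

Lemma dot_laplacian_ge0 (e : rel 'I_N) (v : 'cV[R]_N) :
  symmetric e -> irreflexive e -> 0 <= dot v (laplacian R e *m v).
Proof.
move=> es ei; rewrite -(pmulr_rge0 _ (@ltr0Sn R 1)) dot_laplacian //.
by do 2![apply: sumr_ge0 => ? _]; exact: sqr_ge0.
Qed.

Lemma Jmat_mulE (v : 'cV[R]_N) i :
  (Jmat R N *m v) i 0 = v i 0 - N%:R^-1 * \sum_j v j 0.
Proof.
rewrite mulmxBl mul1mx -scalemxAl !mxE; congr (_ - _ * _).
by apply: eq_bigr => j _; rewrite mxE mul1r.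
Qed.

Lemma Jmat_mul_split (v : 'cV[R]_N) :
  v = Jmat R N *m v + (N%:R^-1 * \sum_j v j 0) *: const_mx 1.
Proof. by apply/matrixP => i j; rewrite ord1 [RHS]mxE Jmat_mulE !mxE mulr1 subrK. Qed.

Lemma sum_Jmat_mul (v : 'cV[R]_N) : (0 < N)%N -> \sum_i (Jmat R N *m v) i 0 = 0.
Proof.
move=> N0; under eq_bigr do rewrite Jmat_mulE.
rewrite sumrB sumr_const card_ord -[X in _ - X]mulr_natl mulrA divff ?pnatr_eq0 -?lt0n //.
by rewrite mul1r subrr.
Qed.

Lemma laplacian_Jmat (e : rel 'I_N) (v : 'cV[R]_N) : irreflexive e ->
  laplacian R e *m (Jmat R N *m v) = laplacian R e *m v.
Proof.
move=> ei; rewrite [in RHS](Jmat_mul_split v) mulmxDr -scalemxAr laplacian_mul1 //.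
by rewrite scaler0 addr0.
Qed.

Lemma Jmat_laplacian (e : rel 'I_N) (v : 'cV[R]_N) :
  symmetric e -> irreflexive e ->
  Jmat R N *m (laplacian R e *m v) = laplacian R e *m v.
Proof.
move=> es ei; apply/matrixP => i j; rewrite ord1 Jmat_mulE.
rewrite [X in _ * X](_ : _ = dot (const_mx 1) (laplacian R e *m v)).
  rewrite dot_mulmxr laplacian_tr // laplacian_mul1 // dotC dot0r mulr0 subr0 //.
by apply: eq_bigr => k _; rewrite [const_mx _ _ _]mxE mul1r.
Qed.

End Laplacian.

(** * Finite Markov chains and Poisson's equation *)

Section Markov.
Context {R : realType} {h : nat}.
Variables (Pm : 'M[R]_h) (pi : 'I_h -> R).
Hypothesis HPst : stochastic Pm.
Hypothesis HPirr : irreducible Pm.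
Hypothesis Hpi : stationary Pm pi.

Lemma stochasticX k : stochastic (Pm ^+ k).
Proof.
have [P0 P1] := HPst; elim: k => [|k [I0 I1]].
  rewrite expr0; split=> [u v|u]; first by rewrite mxE ler0n.
  rewrite (bigD1 u) //= mxE eqxx big1 ?addr0 // => v vu.
  by rewrite mxE eq_sym (negbTE vu).
rewrite exprS; split=> [u v|u].
  by rewrite mxE sumr_ge0 // => w _; rewrite mulr_ge0.
under eq_bigr do rewrite mxE.
rewrite exchange_big -[RHS](P1 u); apply: eq_bigr => w _.
by rewrite -mulr_sumr I1 mulr1.
Qed.

Lemma stationaryX k v : \sum_u pi u * (Pm ^+ k) u v = pi v.
Proof.
have [_ _ Hs] := Hpi; elim: k v => [|k IH] v.
  rewrite expr0 (bigD1 v) //= mxE eqxx mulr1 big1 ?addr0 // => u uv.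
  by rewrite mxE (negbTE uv) mulr0.
rewrite exprSr; under eq_bigr do rewrite mxE mulr_sumr.
rewrite exchange_big -[RHS]Hs; apply: eq_bigr => w _ /=.
by rewrite -IH mulr_suml; apply: eq_bigr => u _; rewrite mulrA.
Qed.

(** Some state u carries mass, and pi v >= pi u * (Pm^k) u v > 0 for a suitable k. *)
Lemma stationary_gt0 v : 0 < pi v.
Proof.
have [pi0 pi1 _] := Hpi.
have [u pu] : exists u, 0 < pi u.
  apply/not_existsP => H; have : \sum_u pi u = 0.
    apply: big1 => u _; apply/eqP; rewrite eq_le pi0 andbT leNgt.
    by apply/negP/H.
  by rewrite pi1 => /eqP; rewrite oner_eq0.
have [k [_ Pk]] := HPirr u v.
rewrite -(stationaryX k) (bigD1 u) //=; apply: ltr_wpDr.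
  by apply: sumr_ge0 => w _; rewrite mulr_ge0 //; apply: (stochasticX k).1.
exact: mulr_gt0.
Qed.

Lemma pimin_gt0 : 0 < pimin pi.
Proof.
rewrite /pimin; elim/big_ind: _ => // [x y x0 y0|u _]; last exact: stationary_gt0.
by rewrite lt_min x0 y0.
Qed.

(** Maximum principle: at a maximiser m the Pm^k-average of g m - g w is zero, so g equals g m at
    every state reachable from m. *)
Lemma harmonic_const (g : 'I_h -> R) :
  (forall u, \sum_v Pm u v * g v = g u) -> forall u v, g u = g v.
Proof.
move=> hg.
have hgk k u : \sum_v (Pm ^+ k) u v * g v = g u.
  elim: k u => [|k IH] u.
    rewrite expr0 (bigD1 u) //= mxE eqxx mul1r big1 ?addr0 // => v vu.
    by rewrite mxE eq_sym (negbTE vu) mul0r.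
  rewrite exprS; under eq_bigr do rewrite mxE mulr_suml.
  rewrite exchange_big -[RHS]hg; apply: eq_bigr => w _ /=.
  by rewrite -IH mulr_sumr; apply: eq_bigr => v _; rewrite mulrA.
move=> u0 v0; pose m := [arg max_(i > u0) g i]%O.
have hm v : g v <= g m by rewrite /m; case: arg_maxP => //= i _; apply.
suff gm v : g v = g m by rewrite !gm.
have [k [_ Pk]] := HPirr m v.
have [Q0 Q1] := stochasticX k.
have : \sum_w (Pm ^+ k) m w * (g m - g w) = 0.
  under eq_bigr do rewrite mulrBr.
  by rewrite sumrB -mulr_suml Q1 mul1r hgk subrr.
move=> /eqP; rewrite psumr_eq0; last by move=> w _; rewrite mulr_ge0 // subr_ge0.
move=> /allP /(_ v (mem_index_enum _)) /=.
by rewrite mulf_eq0 gt_eqF //= subr_eq0 => /eqP.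
Qed.

(* The fundamental matrix (1 - P + 1 pi)^-1 solves Poisson's equation. *)
Lemma Poisson_equation : exists Z : 'I_h -> 'I_h -> R, forall q : 'I_h -> R,
  let qc v := q v - \sum_u pi u * q u in
  let g u := \sum_v Z u v * qc v in
  forall u, g u - \sum_v Pm u v * g v = qc u.
Proof.
have [pi0 pi1 Hs] := Hpi; have [P0 P1] := HPst.
pose F : 'M[R]_h := \matrix_(u, v) ((u == v)%:R - Pm u v + pi v).
have FE (g : 'cV[R]_h) u : (F *m g) u 0 =
    g u 0 - \sum_v Pm u v * g v 0 + \sum_v pi v * g v 0.
  rewrite mxE; under eq_bigr do rewrite mxE mulrDl mulrBl.
  rewrite big_split sumrB /=; congr (_ - _ + _).
  rewrite (bigD1 u) //= eqxx mul1r big1 ?addr0 // => v vu.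
  by rewrite eq_sym (negbTE vu) mul0r.
have piF (g : 'cV[R]_h) : \sum_u pi u * (F *m g) u 0 = \sum_v pi v * g v 0.
  under eq_bigr do rewrite FE mulrDr mulrBr.
  rewrite big_split sumrB /= -mulr_suml pi1 mul1r.
  rewrite [X in _ - X](_ : _ = \sum_u pi u * g u 0) ?subrr ?add0r //.
  under eq_bigr do rewrite mulr_sumr.
  rewrite exchange_big; apply: eq_bigr => v _ /=.
  by rewrite -Hs mulr_suml; apply: eq_bigr => u _; rewrite mulrA.
(* A kernel vector has zero pi-mean by [piF], so it is harmonic, so constant, so zero. *)
have Fu : F \in unitmx.
  rewrite -unitmx_tr unitmxE unitfE; apply/det0P => -[w w0 wF].
  have Fw : F *m w^T = 0 by rewrite -[F]trmxK -trmx_mul wF trmx0.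
  have piw : \sum_v pi v * w^T v 0 = 0.
    by rewrite -piF Fw big1 // => u _; rewrite mxE mulr0.
  have hw u : \sum_v Pm u v * w^T v 0 = w^T u 0.
    have := FE w^T u; rewrite Fw piw addr0 mxE => /esym/eqP.
    by rewrite subr_eq0 => /eqP.
  have cst := harmonic_const hw.
  case/eqP: w0; apply/matrixP => i u; rewrite ord1 mxE.
  have -> : w 0 u = w^T u 0 by rewrite mxE.
  rewrite -piw; under eq_bigr do rewrite (cst _ u).
  by rewrite -mulr_suml pi1 mul1r.
exists (fun u v => invmx F u v) => q qc g u.
pose Q : 'cV[R]_h := \col_v qc v.
have gE v : g v = (invmx F *m Q) v 0.
  by rewrite /g mxE; apply: eq_bigr => w _; rewrite [Q _ _]mxE.
have FQ : F *m (invmx F *m Q) = Q by rewrite mulKVmx.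
have piQ : \sum_v pi v * (invmx F *m Q) v 0 = 0.
  rewrite -piF FQ; under eq_bigr do rewrite mxE /qc mulrBr.
  by rewrite sumrB -mulr_suml pi1 mul1r subrr.
have := FE (invmx F *m Q) u; rewrite FQ piQ addr0 mxE => ->.
by rewrite gE; congr (_ - _); apply: eq_bigr => v _; rewrite gE.
Qed.

End Markov.

(** * Quantitative monotonicity of the normal distribution function *)

Section NormalDistribution.
Context {R : realType}.
Variable sigma : R.
Hypothesis sigma_gt0 : 0 < sigma.

Let sigma_neq0 : sigma != 0. Proof. by rewrite gt_eqF. Qed.

Lemma fn_gt0 x : 0 < fn sigma x.
Proof.
by rewrite /fn normal_pdfE // mulr_gt0 ?expR_gt0 // normal_peak_gt0.
Qed.

Lemma fn_anti x y : `|x| <= `|y| -> fn sigma y <= fn sigma x.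
Proof.
move=> xy; rewrite /fn !normal_pdfE // ler_wpM2l ?normal_peak_ge0 //.
rewrite /normal_fun ler_expR !subr0 !mulNr lerN2 ler_wpM2r //.
  by rewrite invr_ge0 mulrn_wge0 // sqr_ge0.
by rewrite -[x ^+ 2]real_normK ?num_real // -[y ^+ 2]real_normK ?num_real // ler_sqr ?nnegrE.
Qed.

Lemma Fn_ge0 x : 0 <= Fn sigma x.
Proof. by rewrite fine_ge0. Qed.

Lemma Fn_le1 x : Fn sigma x <= 1.
Proof.
rewrite /Fn -lee_fin fineK ?fin_num_measure //.
exact: probability_le1.
Qed.

Lemma normal_prob_setC x :
  fine (normal_prob 0 sigma (~` `]-oo, x])) = 1 - Fn sigma x.
Proof.
by rewrite probability_setC // fineB ?fin_num_measure.
Qed.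

(** The increment is the mass of ]x, y], an integral of a density bounded below by l. *)
Lemma Fn_increment x y (l : R) : x <= y -> 0 <= l ->
  (forall z, x <= z <= y -> l <= fn sigma z) ->
  l * (y - x) <= Fn sigma y - Fn sigma x.
Proof.
move=> xy l0 hl.
have -> : Fn sigma y - Fn sigma x = fine (normal_prob 0 sigma `]x, y]).
  apply/eqP; rewrite subr_eq /Fn -fineD ?fin_num_measure //.
  rewrite addrC -measureU //.
    by rewrite -itv_bndbnd_setU.
  by apply/seteqP; split => z //=; rewrite !in_itv /= => -[h /andP[]]; rewrite ltNge h.
rewrite -lee_fin fineK ?fin_num_measure //.
have -> : (l * (y - x))%:E = (\int[lebesgue_measure]_(z in `]x, y]) l%:E)%E.
  rewrite integral_cst //= lebesgue_measure_itv /= lte_fin.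
  move: xy; rewrite le_eqVlt => /predU1P[->|->]; last by rewrite EFinM.
  by rewrite ltxx subrr mulr0 mule0.
rewrite /normal_prob; apply: ge0_le_integral => //=.
- apply/measurable_EFinP; apply: measurable_funTS; exact: measurable_normal_pdf.
- move=> z; rewrite in_itv /= => /andP[xz zy]; rewrite lee_fin.
  by apply: hl; rewrite ltW.
Qed.

Lemma fM_gt0 (N h : nat) (E : 'I_h -> rel 'I_N) c M : 0 < fM E c sigma M.
Proof.
rewrite /fM; elim/big_ind: _ => [|x y x0 y0|? _]; [exact: fn_gt0| |exact: fn_gt0].
by rewrite lt_min x0 y0.
Qed.

(** Strong monotonicity, the source of the contraction of the estimation error. Between c - z and c
    - y every argument has modulus at most |c| + M, where the density is at least f(|c| + M). *)
Lemma Fn_monotone_fM (N h : nat) (E : 'I_h -> rel 'I_N) c M i j y z :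
  adjU E i j -> `|y| <= M -> `|z| <= M ->
  (z - y) * (Fn sigma (c i j - z) - Fn sigma (c i j - y)) <=
  - fM E c sigma M * (z - y) ^+ 2.
Proof.
move=> ij; wlog yz : y z / y <= z => [H|].
  move=> hy hz; have [|/ltW] := lerP y z => yz; first exact: H.
  by have := H z y yz hz hy; lra.
rewrite !ler_norml => /andP[y1 y2] /andP[z1 z2].
have h1 : fM E c sigma M * ((c i j - y) - (c i j - z)) <=
    Fn sigma (c i j - y) - Fn sigma (c i j - z).
  apply: Fn_increment; [lra|exact/ltW/fM_gt0|move=> x /andP[x1 x2]].
  apply: (@le_trans _ _ (fn sigma (`|c i j| + M))).
    exact: (@bigmin_le_cond _ _ _ _ (i, j) _ (fun p => fn sigma (`|c p.1 p.2| + M))).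
  apply: fn_anti; rewrite [leRHS]ger0_norm; last by have := normr_ge0 (c i j); lra.
  rewrite ler_norml; have := ler_norm (c i j); have := ler_norm (- c i j).
  by rewrite normrN; lra.
have zy : 0 <= z - y by lra.
by have := ler_wpM2l zy h1; lra.
Qed.

End NormalDistribution.

(** * The second eigenvalue: positivity and variational bound *)

Section AlgebraicConnectivity.
Context {R : realType} {N : nat}.
Variables (L : 'M[R]_N) (lam : nat -> R).
Hypothesis N_ge2 : (2 <= N)%N.
Hypothesis L_sym : L^T = L.
Hypothesis L_mul1 : L *m const_mx 1 = 0 :> 'cV[R]_N.
Hypothesis L_psd : forall v : 'cV[R]_N, 0 <= dot v (L *m v).
Hypothesis L_ker : forall v : 'cV[R]_N,
  dot v (L *m v) = 0 -> \sum_i v i 0 = 0 -> v = 0.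
Hypothesis L_char : char_poly L = \prod_(i < N) ('X - (lam i)%:P).
Hypothesis lam_sorted : forall i j : nat, (i <= j < N)%N -> lam i <= lam j.

Let i0 : 'I_N := Ordinal (ltn_trans (ltnSn 0) N_ge2).

Let sum_col j : \sum_i L i j = 0.
Proof.
transitivity ((L *m const_mx 1 : 'cV[R]_N) j 0); last by rewrite L_mul1 mxE.
rewrite mxE; apply: eq_bigr => i _.
by rewrite [const_mx _ _ _]mxE mulr1 -[in RHS]L_sym mxE.
Qed.

(** Its determinant is the cofactor of X in the characteristic polynomial, so its value at 0 tells
    whether 0 is a simple root. *)
Definition reduced_char_mx : 'M[{poly R}]_N :=
  \matrix_(i, j) if i == i0 then 1 else char_poly_mx L i j.

(* Adding all rows of X - L to the first one turns it into (X, ..., X). *)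
Lemma char_poly_reduced : char_poly L = 'X * \det reduced_char_mx.
Proof.
pose U : 'M[{poly R}]_N := \matrix_(i, j) ((i == i0) || (i == j))%:R.
have detU : \det U = 1.
  rewrite -det_tr det_trig; last first.
    apply/is_trig_mxP => i j ij; rewrite !mxE.
    have /negbTE -> : j != i0 by rewrite -val_eqE /= -lt0n (leq_ltn_trans _ ij).
    by have /negbTE -> : j != i by rewrite -val_eqE /= gtn_eqF.
  by rewrite big1 // => i _; rewrite !mxE eqxx orbT.
rewrite /char_poly -[LHS]mul1r -detU -det_mulmx.
have UE i j : (U *m char_poly_mx L) i j =
    if i == i0 then 'X else char_poly_mx L i j.
  rewrite mxE; case: eqP => [->|/eqP ne].
    under eq_bigr do rewrite !mxE eqxx /= mul1r.
    rewrite sumrB -rmorph_sum sum_col rmorph0 subr0 (bigD1 j) //= eqxx mulr1n.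
    by rewrite big1 ?addr0 // => k /negbTE ->; rewrite mulr0n.
  rewrite (bigD1 i) //= mxE eqxx orbT mul1r big1 ?addr0 // => k ki.
  by rewrite mxE (negbTE ne) eq_sym (negbTE ki) mul0r.
rewrite (@determinant_multilinear _ _ _ reduced_char_mx reduced_char_mx i0 'X 0).
- by rewrite mul0r addr0.
- by apply/rowP => j; rewrite [LHS]mxE UE eqxx !mxE eqxx mulr1 mul0r addr0.
- apply/matrixP => i j; rewrite [LHS]mxE [RHS]mxE UE mxE.
  by rewrite eq_sym (negbTE (neq_lift _ _)).
- apply/matrixP => i j; rewrite [LHS]mxE [RHS]mxE UE mxE.
  by rewrite eq_sym (negbTE (neq_lift _ _)).
Qed.

(** A kernel vector at X = 0 has zero coordinate sum by row [i0], and L v vanishes off [i0]. The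
    entries of L v sum to zero, so L v = 0 and [L_ker] applies. *)
Lemma det_reduced_neq0 : (\det reduced_char_mx).[0] != 0.
Proof.
rewrite -/(horner_eval 0 _) -det_map_mx -det_tr; apply/det0P => -[v v0 vM].
have vE i : \sum_j v 0 j * (if i == i0 then 1 else - L i j) = 0.
  transitivity ((v *m (map_mx (horner_eval 0) reduced_char_mx)^T) 0 i); last first.
    by rewrite vM mxE.
  rewrite [RHS]mxE; apply: eq_bigr => j _; rewrite !mxE /horner_eval; case: eqP => _.
    by rewrite hornerC.
  by rewrite hornerD hornerN hornerC hornerMn hornerX mul0rn add0r.
have vs : \sum_j v^T j 0 = 0.
  by rewrite -[RHS](vE i0); apply: eq_bigr => j _; rewrite eqxx mulr1 mxE.
have Lv i : i != i0 -> (L *m v^T) i 0 = 0.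
  move=> ne; rewrite mxE; apply/eqP; rewrite -oppr_eq0 -sumrN; apply/eqP.
  by rewrite -[RHS](vE i) (negbTE ne); apply: eq_bigr => j _; rewrite mxE mulrN mulrC.
have Lv0 : (L *m v^T) i0 0 = 0.
  have : dot (const_mx 1) (L *m v^T) = 0 by rewrite dot_mulmxr L_sym L_mul1 dotC dot0r.
  rewrite /dot (bigD1 i0) //= big1 ?addr0; last first.
    by move=> i ne; rewrite Lv ?mulr0.
  by rewrite [const_mx _ _ _]mxE mul1r.
case/eqP: v0; rewrite -[v]trmxK (_ : v^T = 0) ?trmx0 //; apply: L_ker => //.
rewrite /dot big1 // => i _.
by have [->|ne] := eqVneq i i0; rewrite ?Lv0 ?Lv ?mulr0.
Qed.

Let rootE x : root (char_poly L) x -> exists i : 'I_N, x = lam i.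
Proof.
rewrite L_char /root horner_prod => /prodf_eq0[i _].
by rewrite hornerXsubC subr_eq0 => /eqP ->; exists i.
Qed.

Let lam0 : lam 0 = 0.
Proof.
have [i li] : exists i : 'I_N, 0 = lam i.
  by apply: rootE; rewrite char_poly_reduced /root hornerM hornerX mul0r.
apply/eqP; rewrite eq_le {1}li lam_sorted ?leq0n ?ltn_ord //=.
have : root (char_poly L) (lam 0).
  rewrite L_char /root horner_prod; apply/prodf_eq0; exists i0 => //.
  by rewrite hornerXsubC subrr.
rewrite -eigenvalue_root_char => /eigenvalueP[v vL v0].
have /eqP : L *m v^T = lam 0 *: v^T.
  by rewrite -[L]L_sym -trmx_mul vL linearZ.
move=> /eqP Lv; have := L_psd v^T; rewrite Lv dotZr dotvv.
rewrite pmulr_lge0 // lt_neqAle sqnorm_ge0 andbT eq_sym.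
by apply: contraNneq v0 => /sqnorm_eq0 vt; rewrite -[v]trmxK vt trmx0.
Qed.

(** If [lam 1] were 0, cancelling X between the two factorisations of the characteristic polynomial
    would leave a cofactor vanishing at 0. *)
Lemma lam1_gt0 : 0 < lam 1.
Proof.
have h0 : lam 0 <= lam 1 by apply: lam_sorted; rewrite N_ge2.
rewrite lt_neqAle -{2}lam0 h0 andbT eq_sym.
apply: contraNneq det_reduced_neq0 => l1.
have X0 : 'X != 0 :> {poly R} by rewrite polyX_eq0.
have /(mulfI X0) -> : 'X * \det reduced_char_mx =
    'X * \prod_(i < N | i != i0) ('X - (lam i)%:P).
  rewrite -char_poly_reduced L_char (bigD1 i0) //=.
  by rewrite (_ : lam i0 = 0) ?subr0.
rewrite horner_prod; apply/prodf_eq0; exists (Ordinal N_ge2); first by rewrite -val_eqE.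
by rewrite /= l1 subr0 hornerX.
Qed.

(** Row vectors, the shape to which [EVT_min_rV] applies. *)
Let sphere0 : set 'rV[R]_N := [set v | \sum_i v 0 i = 0 /\ \sum_i v 0 i ^+ 2 = 1].

Let coord_sum_continuous (f : 'I_N -> R -> R) : (forall i, continuous (f i)) ->
  continuous (fun v : 'rV[R]_N => \sum_i f i (v 0 i)).
Proof.
move=> fc; apply: continuous_big => [|i _]; first exact: add_continuous.
by move=> v; apply: continuous_comp; [exact: coord_continuous|exact: fc].
Qed.

Let sphere0_compact : compact sphere0.
Proof.
apply: bounded_closed_compact.
  exists 1; split=> [|x x1 v [_ v1]]; first exact: num_real.
  rewrite /= [leLHS]/Num.Def.normr /= mx_normrE; apply/bigmax_leP; split=> [|[i j] _ /=].
    by rewrite ltW // (lt_trans ltr01 x1).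
  apply: le_trans (ltW x1); rewrite ord1 -(@expr_le1 _ 2) // real_normK ?num_real //.
  by rewrite -v1 (bigD1 j) //= lerDl sumr_ge0 // => k _; exact: sqr_ge0.
have -> : sphere0 = ((fun v : 'rV[R]_N => \sum_i v 0 i) @^-1` [set x | x = 0]) `&`
   ((fun v : 'rV[R]_N => \sum_i v 0 i ^+ 2) @^-1` [set x | x = 1]) by [].
apply: closedI; apply: preimage_closed; try exact: closed_eq; move=> v _.
  by apply: (coord_sum_continuous (f := fun _ x => x)) => i x; exact: cvg_id.
by apply: (coord_sum_continuous (f := fun _ x => x ^+ 2)) => i; exact: exprn_continuous.
Qed.

Let sphere0_neq0 : sphere0 !=set0.
Proof.
pose i1 : 'I_N := Ordinal N_ge2.
pose s : R := (Num.sqrt 2)^-1.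
have i10 : i1 != i0 by rewrite -val_eqE.
have s2 : s ^+ 2 = 2^-1 by rewrite exprVn sqr_sqrtr.
exists (\row_i (if i == i0 then s else if i == i1 then - s else 0)); split.
  rewrite (bigD1 i0) //= (bigD1 i1) //= !mxE eqxx (negbTE i10) eqxx big1.
    by rewrite addr0 subrr.
  by move=> i /andP[/negbTE h1 /negbTE h2]; rewrite mxE h1 h2.
rewrite (bigD1 i0) //= (bigD1 i1) //= !mxE eqxx (negbTE i10) eqxx big1.
  by rewrite sqrrN s2; lra.
by move=> i /andP[/negbTE h1 /negbTE h2]; rewrite mxE h1 h2 expr0n.
Qed.

Let q (v : 'rV[R]_N) : R := dot v^T (L *m v^T).

Let q_continuous : continuous q.
Proof.
have -> : q = fun v => \sum_i v 0 i * \sum_j L i j * v 0 j.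
  apply/funext => v; apply: eq_bigr => i _; rewrite !mxE; congr (_ * _).
  by apply: eq_bigr => j _; rewrite mxE.
apply: continuous_big => [|i _]; first exact: add_continuous.
move=> v; have h1 := @coord_continuous R 1 N 0 i v.
have h2 : continuous (fun v : 'rV[R]_N => \sum_j L i j * v 0 j).
  apply: (coord_sum_continuous (f := fun j x => L i j * x)) => j x.
  by apply: cvgM; [exact: cvg_cst|exact: cvg_id].
exact: (cvgM h1 (h2 v)).
Qed.

(* The minimum of the quadratic form over unit vectors orthogonal to 1 is
   attained at an eigenvector, whose eigenvalue is positive. *)
Lemma lam1_le_dot (v : 'cV[R]_N) : \sum_i v i 0 = 0 ->
  lam 1 * sqnorm v <= dot v (L *m v).
Proof.
have /= [] := EVT_min_rV sphere0_neq0 sphere0_compact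
  (continuous_subspaceT q_continuous).
move=> w0; rewrite inE => -[w0s w01] wmin.
pose w : 'cV[R]_N := w0^T; pose mu := q w0.
have ws : \sum_i w i 0 = 0 by rewrite -[RHS]w0s; apply: eq_bigr => i _; rewrite mxE.
have w1 : sqnorm w = 1 by rewrite -[RHS]w01; apply: eq_bigr => i _; rewrite mxE.
have muE : dot w (L *m w) = mu by [].
have mumin (x : 'cV[R]_N) : \sum_i x i 0 = 0 -> mu * sqnorm x <= dot x (L *m x).
  move=> xs; have [x0|x0] := eqVneq (sqnorm x) 0.
    by rewrite x0 mulr0.
  have xp : 0 < vnorm x by rewrite sqrtr_gt0 lt_neqAle eq_sym x0 sqnorm_ge0.
  have : mu <= q ((vnorm x)^-1 *: x)^T.
    apply: wmin; rewrite inE; split.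
      under eq_bigr do rewrite !mxE.
      by rewrite -mulr_sumr xs mulr0.
    under eq_bigr do rewrite !mxE exprMn.
    by rewrite -mulr_sumr -/(sqnorm x) exprVn sqr_vnorm mulVf.
  rewrite /q trmxK -scalemxAr dotZr dotC dotZr mulrA -expr2 exprVn sqr_vnorm.
  by rewrite ler_pdivlMl ?lt_neqAle ?sqnorm_ge0 1?eq_sym ?x0 // dotC mulrC.
have mupos : 0 < mu.
  rewrite lt_neqAle L_psd andbT; apply/negP => /eqP mu0.
  have w00 : w = 0 by apply: L_ker; rewrite ?muE.
  by move: w1; rewrite w00 -dotvv dot0r => /eqP; rewrite eq_sym oner_eq0.
(* The residual of the eigenvector equation is itself an admissible direction. Minimality along w +
   s d gives a quadratic in s, nonnegative everywhere and without constant term, whose linear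
   coefficient is 2 |d|^2; hence d = 0. *)
have [d dE] : exists d, d = L *m w - mu *: w by eexists.
have ds : \sum_i d i 0 = 0.
  have -> : \sum_i d i 0 = dot (const_mx 1) d.
    by apply: eq_bigr => i _; rewrite [const_mx _ _ _]mxE mul1r.
  rewrite dE dotBr dot_mulmxr L_sym L_mul1 dotC dot0r dotZr sub0r.
  rewrite (_ : dot _ w = 0) ?mulr0 ?oppr0 // -[RHS]ws.
  by apply: eq_bigr => i _; rewrite [const_mx _ _ _]mxE mul1r.
have dquad s : 0 <= 2 * s * sqnorm d + s ^+ 2 * (dot d (L *m d) - mu * sqnorm d).
  have hs : \sum_i (w + s *: d) i 0 = 0.
    transitivity (\sum_i w i 0 + s * \sum_i d i 0); last by rewrite ws ds mulr0 addr0.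
    rewrite mulr_sumr -big_split; apply: eq_bigr => i _ /=.
    by rewrite [LHS]mxE [X in _ + X]mxE.
  have := mumin _ hs.
  rewrite sqnormD w1 sqnormZ mulmxDr -scalemxAr !dotDl !dotDr !dotZl !dotZr muE.
  have -> : dot w (L *m d) = dot d (L *m w).
    by rewrite [RHS]dotC -[in RHS]L_sym -dot_mulmxr.
  have -> : sqnorm d = dot d (L *m w) - mu * dot w d.
    by rewrite -dotvv {2}dE dotBr dotZr (dotC d w).
  by lra.
have d0 : sqnorm d = 0.
  apply/eqP; rewrite eq_le sqnorm_ge0 andbT leNgt; apply/negP => dp.
  set K := dot d (L *m d) - mu * sqnorm d in dquad.
  have K0 : 0 < `|K| + 1 by rewrite ltr_wpDl.
  (* A negative s small enough for the linear term to outweigh the quadratic one. *)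
  have := dquad (- (sqnorm d / (`|K| + 1))).
  set s := sqnorm d / _; have s0 : 0 < s by apply: divr_gt0.
  have sE : sqnorm d = s * (`|K| + 1) by rewrite /s divfK // gt_eqF.
  have : s ^+ 2 * K <= s ^+ 2 * `|K| by rewrite ler_wpM2l ?sqr_ge0 ?ler_norm.
  have : 0 < s ^+ 2 by rewrite exprn_gt0.
  have : 0 <= s ^+ 2 * `|K| by rewrite mulr_ge0 ?sqr_ge0.
  by rewrite sE; lra.
have Lw : L *m w = mu *: w by apply/eqP; rewrite -subr_eq0 -dE (sqnorm_eq0 d0).
(* The minimum mu is an eigenvalue, hence some [lam i]; as mu > 0 = [lam 0], the index is at least
   1. *)
have [i mi] : exists i : 'I_N, mu = lam i.
  apply: rootE; rewrite -eigenvalue_root_char; apply/eigenvalueP.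
  exists w^T; first by rewrite -[in LHS]L_sym -trmx_mul Lw linearZ.
  apply/eqP => wt; have := w1; rewrite -[w]trmxK wt trmx0 -dotvv dot0r.
  by move=> /eqP; rewrite eq_sym oner_eq0.
move=> vs; apply: le_trans (mumin _ vs); apply: ler_wpM2r; first exact: sqnorm_ge0.
rewrite mi; apply: lam_sorted; rewrite ltn_ord andbT lt0n.
by apply: contraTneq mupos => i00; rewrite mi i00 lam0 ltxx.
Qed.

End AlgebraicConnectivity.

(** * One step of the network and its transition operator *)

Section OneStep.
Context {R : realType} {n N h : nat}.
Variables (a b : nat -> R) (E : 'I_h -> rel 'I_N) (Pm : 'M[R]_h).
Variables (c : 'I_N -> 'I_N -> R) (sigma beta gamma M : R) (t0 : nat).

Definition state := (('I_N -> 'cV[R]_n) * ('I_N -> 'I_N -> R))%type.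
(** One bit per ordered pair of neighbours in the union graph: a finite type, so expectations over
    bits are finite sums. *)
Definition bits := {ffun 'I_(npairs E) -> bool}.

Definition outp (S : state) (i : 'I_N) : R := rdot (K2 n b) (S.1 i).

Definition znext (k : nat) (S : state) (u : 'I_h) (s : 'I_N -> 'I_N -> bool)
    (i j : 'I_N) : R :=
  if adjU E i j then
    projM M (S.2 i j + beta / (t0 + 1 + k)%:R * (E u i j)%:R
                       * (Fn sigma (c i j - S.2 i j) - (s i j)%:R))
  else S.2 i j.

Lemma znext_adj k S u s i j : adjU E i j -> znext k S u s i j =
  projM M (S.2 i j + beta / (t0 + 1 + k)%:R * (E u i j)%:R
                     * (Fn sigma (c i j - S.2 i j) - (s i j)%:R)).
Proof. by rewrite /znext => ->. Qed.

(** The bits are an argument, so the same map serves the random trajectory and the enumeration of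
    all bit patterns. *)
Definition step (k : nat) (S : state) (u : 'I_h) (s : 'I_N -> 'I_N -> bool) : state :=
  (fun i => Amat n a *m S.1 i +
     (rdot (K1 n a b) (S.1 i) + gamma / (t0 + 1 + k).+1%:R *
        \sum_(j | E u i j) (znext k S u s i j - rdot (K2 n b) (S.1 i))) *: Bvec R n,
   znext k S u s).

Lemma step_ext k S u s s' : (forall i j, adjU E i j -> s i j = s' i j) ->
  step k S u s = step k S u s'.
Proof.
move=> ss; have zz : znext k S u s = znext k S u s'.
  apply/funext => i; apply/funext => j; rewrite /znext.
  by case: ifP => // ij; rewrite ss.
by rewrite /step zz.
Qed.

(** Extension by false to pairs that never communicate; by [step_ext] these values do not matter. *)
Definition bitsOf (s : bits) (i j : 'I_N) : bool :=
  [exists p, (pairOf p == (i, j)) && s p].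

Lemma bitsOf_pairOf (s : bits) p : bitsOf s (pairOf p).1 (pairOf p).2 = s p.
Proof.
apply/existsP/idP => [[q /andP[/eqP]]|sp]; last by exists p; rewrite -surjective_pairing eqxx.
by rewrite -surjective_pairing => /enum_val_inj ->.
Qed.

Lemma adjU_pairOf (p : 'I_(npairs E)) : adjU E (pairOf p).1 (pairOf p).2.
Proof. exact: (enum_valP p). Qed.

Lemma pairOf_inj : injective (@pairOf N h E).
Proof. exact: enum_val_inj. Qed.

Lemma pairOf_surj i j : adjU E i j -> exists p : 'I_(npairs E), pairOf p = (i, j).
Proof.
move=> ij; have ijin : (i, j) \in [pred p : 'I_N * 'I_N | adjU E p.1 p.2] by [].
by exists (enum_rank_in ijin (i, j)); rewrite /pairOf enum_rankK_in.
Qed.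

Definition bprob (S : state) (p : 'I_(npairs E)) (x : bool) : R :=
  let F := Fn sigma (c (pairOf p).1 (pairOf p).2 - outp S (pairOf p).2) in
  if x then F else 1 - F.

(* [Tk k phi S u] is the conditional expectation of phi after the step at time
   t0 + 1 + k, given the state S and the topology u. *)
Definition Tk (k : nat) (phi : state -> 'I_h -> R) (S : state) (u : 'I_h) : R :=
  \sum_(s : bits) (\prod_p bprob S p (s p)) *
     \sum_v Pm u v * phi (step k S u (bitsOf s)) v.

Fixpoint TT (k j : nat) (phi : state -> 'I_h -> R) : state -> 'I_h -> R :=
  if j is j'.+1 then Tk k (TT k.+1 j' phi) else phi.

(** The definition peels the first step, as integration over histories requires; peeling the last
    one yields recursions in the number of steps. *)
Lemma TT_last k j phi : TT k j.+1 phi = TT k j (Tk (k + j) phi).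
Proof.
elim: j k => [|j IH] k; first by rewrite addn0.
by rewrite -[LHS]/(Tk k (TT k.+1 j.+1 phi)) IH addSnnS.
Qed.

(** Deterministic trajectory for prescribed topologies and bits. Topologies are indexed by absolute
    time, bits by step number. *)
Fixpoint straj (S0 : state) (u : nat -> 'I_h) (s : nat -> bits) (k : nat) : state :=
  if k is k'.+1 then
    step k' (straj S0 u s k') (u (t0 + 1 + k')%N) (bitsOf (s k'))
  else S0.

Lemma straj_ext S0 u u' s s' k :
  (forall j, (j < t0 + 1 + k)%N -> u j = u' j) ->
  (forall j, (j < k)%N -> s j = s' j) -> straj S0 u s k = straj S0 u' s' k.
Proof.
elim: k => [|k IH] hu hs //=; rewrite IH ?hu ?hs //; try lia.
  by move=> j jk; apply: hu; lia.
by move=> j jk; apply: hs; lia.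
Qed.

Definition hprob S0 (u : nat -> 'I_h) (s : nat -> bits) (k : nat) : R :=
  \prod_(0 <= j < k) \prod_p bprob (straj S0 u s j) p (s j p).

End OneStep.

(** * Law of the trajectory along finite histories *)

Section Histories.
Context {R : realType} {dsp : measure_display} {T : measurableType dsp}.
Variable P : probability T R.
Variables (n N h : nat) (a b : nat -> R) (E : 'I_h -> rel 'I_N) (Pm : 'M[R]_h).
Variables (c : 'I_N -> 'I_N -> R) (sigma beta gamma M : R) (t0 : nat).
Variables (x0 : 'I_N -> 'cV[R]_n) (z0 : 'I_N -> 'I_N -> R).
Variables (m : nat -> T -> 'I_h) (dn : nat -> 'I_N -> 'I_N -> {RV P >-> R}).
Hypothesis Hmmeas : forall (t : nat) (u : 'I_h), measurable [set w | m t w = u].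
Hypothesis Hmarkov : forall (k : nat) (u : nat -> 'I_h),
  P (chain_ev m k.+1 u) = (P (chain_ev m k u) * (Pm (u k) (u k.+1))%:E)%E.
Hypothesis Hnoise : forall (k : nat) (u : nat -> 'I_h) (s : seq (nat * 'I_N * 'I_N))
                   (B : nat * 'I_N * 'I_N -> set R),
      uniq s -> (forall q, q \in s -> adjU E q.1.2 q.2) ->
      (forall q, measurable (B q)) ->
      P (chain_ev m k u `&` [set w | forall q, q \in s -> B q (dn q.1.1 q.1.2 q.2 w)])
      = (P (chain_ev m k u)
         * (\prod_(q <- s) fine (normal_prob 0 sigma (B q)))%:E)%E.

Local Notation state := (@state R n N).
Local Notation bits := (bits E).
Local Notation S0 := (x0, z0).
Local Notation step := (step a b E c sigma beta gamma M t0).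
Local Notation straj := (straj a b c sigma beta gamma M t0 S0).
Local Notation TT := (TT a b E Pm c sigma beta gamma M t0).
Local Notation Tk := (Tk a b E Pm c sigma beta gamma M t0).
Local Notation outp := (outp b).
Local Notation bprob := (bprob b c sigma).
Local Notation hprob := (hprob a b c sigma beta gamma M t0 S0).

Definition trj (w : T) (k : nat) : state :=
  traj a b E c sigma beta gamma M t0 x0 z0
    (fun s => m s w) (fun s i j => dn s i j w) k.

Definition rbit (j : nat) (w : T) (i i' : 'I_N) : bool :=
  outp (trj w j) i' + dn (t0 + 1 + j) i i' w <= c i i'.

Lemma trjS w k : trj w k.+1 = step k (trj w k) (m (t0 + 1 + k) w) (rbit k w).
Proof. by []. Qed.

(** The topology about to act at time t0 + 1 + k is part of the history, but only the k bit vectors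
    already used are. *)
Definition Hev (k : nat) (u : nat -> 'I_h) (s : nat -> bits) : set T :=
  chain_ev m (t0 + 1 + k) u `&`
  [set w | forall j, (j < k)%N -> forall p, rbit j w (pairOf p).1 (pairOf p).2 = s j p].

Lemma Hev_trj k u s w j : Hev k u s w -> (j <= k)%N -> trj w j = straj u s j.
Proof.
move=> [hu hs]; elim: j => [|j IH] jk //.
rewrite trjS IH ?(ltnW jk) // hu /=; last by lia.
apply: step_ext => i i' /pairOf_surj[p pE].
by have := hs j jk p; rewrite -(bitsOf_pairOf (s j) p) pE /= => ->.
Qed.

Definition hseq (k : nat) : seq (nat * 'I_N * 'I_N) :=
  [seq ((t0 + 1 + j)%N, (pairOf p).1, (pairOf p).2)
    | j <- iota 0 k, p <- enum 'I_(npairs E)].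

Definition hset (u : nat -> 'I_h) (s : nat -> bits) (q : nat * 'I_N * 'I_N) : set R :=
  let j := (q.1.1 - (t0 + 1))%N in
  let H : set R := (`]-oo, c q.1.2 q.2 - outp (straj u s j) q.2]%classic)%R in
  if bitsOf (s j) q.1.2 q.2 then H else ~` H.

Lemma hset_measurable u s q : measurable (hset u s q).
Proof. by rewrite /hset; case: ifP => _; [|apply: measurableC]; exact: measurable_itv. Qed.

(** A bit compares a noise with a random output. Once earlier topologies and bits are prescribed
    this output is deterministic, so by induction the history becomes a product event in the noises,
    the form that [Hnoise] covers. *)
Lemma HevE k u s : Hev k u s = chain_ev m (t0 + 1 + k) u `&`
  [set w | forall q, q \in hseq k -> hset u s q (dn q.1.1 q.1.2 q.2 w)].
Proof.
have key w j p : trj w j = straj u s j ->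
   hset u s ((t0 + 1 + j)%N, (pairOf p).1, (pairOf p).2)
     (dn (t0 + 1 + j) (pairOf p).1 (pairOf p).2 w) <->
   rbit j w (pairOf p).1 (pairOf p).2 = s j p.
  move=> tE; rewrite /hset /= addKn bitsOf_pairOf /rbit tE.
  case: (s j p) => /=; rewrite /= in_itv /= lerBrDl //.
  by split => [/negP/negbTE|->].
apply/seteqP; split=> w [hu hs]; split=> //.
  move=> _ /allpairsP[[j p] /= [jk _ ->]] /=; apply/key.
    by apply: (Hev_trj (conj hu hs)); move: jk; rewrite mem_iota; lia.
  by apply: hs; move: jk; rewrite mem_iota; lia.
have main j : (j <= k)%N -> trj w j = straj u s j /\
   forall j', (j' < j)%N -> forall p, rbit j' w (pairOf p).1 (pairOf p).2 = s j' p.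
  elim: j => [|j IH] jk //; have [tE hb] := IH (ltnW jk).
  have hj p : rbit j w (pairOf p).1 (pairOf p).2 = s j p.
    apply/(key _ _ _ tE); apply: (hs (_, _, _)); apply/allpairsP; exists (j, p).
    by rewrite mem_iota mem_enum; split => //; lia.
  split; last first.
    by move=> j'; rewrite ltnS leq_eqVlt => /predU1P[->|/hb].
  rewrite trjS tE hu /=; last by lia.
  apply: step_ext => i i' /pairOf_surj[p pE].
  by have := hj p; rewrite -(bitsOf_pairOf (s j) p) pE.
by move=> j jk; exact: (main k (leqnn k)).2.
Qed.

Lemma hseq_uniq k : uniq (hseq k).
Proof.
apply: allpairs_uniq; [exact: iota_uniq|exact: enum_uniq|].
move=> [j p] [j' p'] _ _ /= [/addnI -> e1 e2]; congr (_, _).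
by apply: pairOf_inj; rewrite [LHS]surjective_pairing e1 e2 -surjective_pairing.
Qed.

Lemma chain_ev_measurable k u : measurable (chain_ev m k u).
Proof.
have -> : chain_ev m k u = \bigcap_(s in `I_k.+1) [set w | m s w = u s] by [].
by apply: bigcap_measurableType => s _; exact: Hmmeas.
Qed.

Lemma Hev_measurable k u s : measurable (Hev k u s).
Proof.
rewrite HevE; apply: measurableI; first exact: chain_ev_measurable.
elim: (hseq k) => [|q l IH].
  by rewrite (_ : [set w | _] = setT) //; apply/seteqP; split.
rewrite (_ : [set w | _] = (dn q.1.1 q.1.2 q.2 @^-1` hset u s q) `&`
    [set w | forall q, q \in l -> hset u s q (dn q.1.1 q.1.2 q.2 w)]).
  apply: measurableI => //; rewrite -[X in measurable X]setTI.
  by apply: measurable_funP => //; exact: hset_measurable.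
apply/seteqP; split=> w /=.
  by move=> H; split=> [|q' q'l]; apply: H; rewrite inE ?eqxx // q'l orbT.
by move=> [H1 H2] q'; rewrite inE => /predU1P[->|/H2].
Qed.

Lemma P_Hev k u s :
  P (Hev k u s) = (P (chain_ev m (t0 + 1 + k) u) * (hprob u s k)%:E)%E.
Proof.
rewrite HevE Hnoise; last exact: hset_measurable.
- congr (_ * _%:E)%E; rewrite /hseq big_allpairs_dep /hprob /index_iota subn0.
  apply: eq_bigr => j _; rewrite big_enum; apply: eq_bigr => p _ /=.
  rewrite /hset /= addKn bitsOf_pairOf /bprob; case: (s j p) => //.
  exact: normal_prob_setC.
- exact: hseq_uniq.
by move=> _ /allpairsP[[j p] /= [_ _ ->]]; exact: adjU_pairOf.
Qed.

Lemma measurable_fun_bigsetU_seq (I : eqType) (l : seq I) (F : I -> set T)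
    (f : T -> \bar R) : (forall i, measurable (F i)) ->
  (forall i, measurable_fun (F i) f) ->
  measurable_fun (\big[setU/set0]_(i <- l) F i) f.
Proof.
move=> mF mf; elim: l => [|i l IH].
  by rewrite big_nil; exact: measurable_fun_set0.
rewrite big_cons; apply/measurable_funU => //.
by apply: bigsetU_measurable.
Qed.

Definition upd (A : Type) (f : nat -> A) (k : nat) (x : A) (j : nat) : A :=
  if j == k then x else f j.

Lemma upd_lt A (f : nat -> A) k x j : (j < k)%N -> upd f k x j = f j.
Proof. by move=> jk; rewrite /upd ltn_eqF. Qed.

Lemma upd_eq A (f : nat -> A) k x : upd f k x k = x.
Proof. by rewrite /upd eqxx. Qed.

Let child k u s (vx : 'I_h * bits) :=
  Hev k.+1 (upd u (t0 + 1 + k.+1) vx.1) (upd s k vx.2).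

Lemma Hev_split k u s :
  Hev k u s = \big[setU/set0]_(vx <- index_enum _) child k u s vx.
Proof.
rewrite -bigcup_seq; apply/seteqP; split=> w.
  move=> [hu hs]; pose x : bits := [ffun p => rbit k w (pairOf p).1 (pairOf p).2].
  exists (m (t0 + 1 + k.+1) w, x); first by rewrite /= mem_index_enum.
  split=> j /= jk.
    move: jk; rewrite leq_eqVlt => /predU1P[->|jk]; first by rewrite upd_eq.
    by rewrite upd_lt // hu //; lia.
  move: jk; rewrite ltnS leq_eqVlt => /predU1P[->|jk] p; first by rewrite upd_eq ffunE.
  by rewrite upd_lt // hs.
move=> [vx _ [hu hs]]; split=> j /= jk.
  by rewrite hu ?upd_lt //; lia.
by move=> p; rewrite hs ?upd_lt //; lia.
Qed.

Lemma child_trivIset k u s (D : set ('I_h * bits)) : trivIset D (child k u s).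
Proof.
move=> [v x] [v' x'] _ _ [w [[hu hs] [hu' hs']]] /=; congr (_, _).
  have := hu _ (leqnn _); have := hu' _ (leqnn _).
  by rewrite !upd_eq /= => -> ->.
apply/ffunP => p; have := hs k (ltnSn k) p; have := hs' k (ltnSn k) p.
by rewrite !upd_eq /= => -> ->.
Qed.

Let straj_child k (u : nat -> 'I_h) (s : nat -> bits) v x :
  straj (upd u (t0 + 1 + k.+1) v) (upd s k x) k = straj u s k.
Proof.
apply: straj_ext => j jk; rewrite upd_lt //; lia.
Qed.

Lemma P_child k u s v x : P (child k u s (v, x)) =
  (P (Hev k u s) *
    (Pm (u (t0 + 1 + k)%N) v * \prod_p bprob (straj u s k) p (x p))%:E)%E.
Proof.
rewrite /child P_Hev addnS Hmarkov -addnS upd_eq upd_lt; last by lia.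
rewrite (_ : chain_ev m _ _ = chain_ev m (t0 + 1 + k) u); last first.
  by apply/seteqP; split=> w /= H j jk; rewrite H // upd_lt //; lia.
rewrite P_Hev -!muleA; congr (_ * _)%E; rewrite -!EFinM; congr (_%:E).
rewrite mulrCA; congr (_ * _); rewrite /hprob big_nat_recr //= straj_child upd_eq.
congr (_ * _); apply: eq_big_nat => j /andP[_ jk]; rewrite upd_lt //.
rewrite (_ : straj _ _ j = straj u s j) //; apply: straj_ext => i ij.
  by rewrite upd_lt //; lia.
by rewrite upd_lt //; lia.
Qed.

Section Integral.
Variable phi : state -> 'I_h -> R.
Hypothesis phi_ge0 : forall S u, 0 <= phi S u.

Let f (k : nat) (w : T) : \bar R := (phi (trj w k) (m (t0 + 1 + k) w))%:E.

(** Induction on the number of remaining steps, splitting a history into its one-step extensions.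
    Measurability is carried along because the splitting needs a measurable integrand. *)
Lemma integral_Hev j k u s :
  measurable_fun (Hev k u s) (f (k + j)) /\
  (\int[P]_(w in Hev k u s) f (k + j) w =
   P (Hev k u s) * (TT k j phi (straj u s k) (u (t0 + 1 + k)%N))%:E)%E.
Proof.
elim: j k u s => [|j IH] k u s.
  rewrite addn0; have fE w : Hev k u s w ->
     f k w = (phi (straj u s k) (u (t0 + 1 + k)%N))%:E.
    by move=> Hw; rewrite /f (Hev_trj Hw) //; case: Hw => -> //.
  split.
    apply: (eq_measurable_fun (cst (phi (straj u s k) (u (t0 + 1 + k)%N))%:E)).
      by move=> w; rewrite inE => /fE.
    exact: measurable_cst.
  rewrite (eq_integral (cst (phi (straj u s k) (u (t0 + 1 + k)%N))%:E)).
    by rewrite (integral_cst P (Hev_measurable k u s)) muleC.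
  by move=> w; rewrite inE => /fE.
have mchild vx : measurable (child k u s vx) by exact: Hev_measurable.
have fchild vx : measurable_fun (child k u s vx) (f (k + j.+1)).
  by rewrite -addSnnS; exact: (IH _ _ _).1.
have mf := @measurable_fun_bigsetU_seq _ (index_enum _) _ _ mchild fchild.
split; first by rewrite Hev_split.
rewrite {1}Hev_split ge0_integral_bigsetU //; last 3 first.
- exact: index_enum_uniq.
- exact: child_trivIset.
- by move=> w _; rewrite /f lee_fin.
have Pf : P (Hev k u s) \is a fin_num by apply: fin_num_measure; exact: Hev_measurable.
transitivity (\sum_(vx : 'I_h * bits) (P (Hev k u s) *
   (Pm (u (t0 + 1 + k)%N) vx.1 * (\prod_p bprob (straj u s k) p (vx.2 p)) *
    TT k.+1 j phi (step k (straj u s k) (u (t0 + 1 + k)%N) (bitsOf vx.2)) vx.1)%:E))%E.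
  apply: eq_bigr => -[v x] _ /=; rewrite -addSnnS (IH _ _ _).2 -/(child k u s (v, x)).
  rewrite P_child -muleA -EFinM; congr (_ * (_ * _)%:E)%E.
  rewrite /= straj_child !upd_eq upd_lt //; lia.
rewrite -(fineK Pf); under eq_bigr do rewrite -EFinM.
rewrite sumEFin -EFinM; congr (_%:E); rewrite -mulr_sumr; congr (_ * _).
rewrite /= /Tk -(pair_big predT predT (fun v (x : bits) => Pm (u (t0 + 1 + k)%N) v *
  (\prod_p bprob (straj u s k) p (x p)) *
    TT k.+1 j phi (step k (straj u s k) (u (t0 + 1 + k)%N) (bitsOf x)) v)) /=.
rewrite exchange_big; apply: eq_bigr => x _; rewrite mulr_sumr.
by apply: eq_bigr => v _; rewrite mulrCA mulrA.
Qed.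

Let ext (g : {ffun 'I_(t0 + 1).+1 -> 'I_h}) (j : nat) : 'I_h := g (inord j).
Let nobits : nat -> bits := fun _ => [ffun => false].

(** The space is partitioned by the topologies at times 0, ..., t0 + 1, before any bit is sent;
    [nobits] is a placeholder. The initial law of the chain, which is arbitrary, survives only in
    the weights. *)
Lemma integral_trj k :
  (\int[P]_w f k w =
   (\sum_(g : {ffun 'I_(t0 + 1).+1 -> 'I_h}) fine (P (chain_ev m (t0 + 1) (ext g))) *
      TT 0 k phi S0 (ext g (t0 + 1)%N))%:E)%E.
Proof.
pose C g := Hev 0 (ext g) nobits.
have CE g : C g = chain_ev m (t0 + 1) (ext g).
  by rewrite /C /Hev addn0 (_ : [set w | _] = setT) ?setIT //; apply/seteqP; split.
have Ccover : [set: T] = \big[setU/set0]_(g <- index_enum _) C g.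
  rewrite -bigcup_seq; apply/seteqP; split=> // w _.
  exists [ffun j : 'I_(t0 + 1).+1 => m j w]; first by rewrite /= mem_index_enum.
  by rewrite CE => j jt; rewrite /ext ffunE inordK.
have mC g : measurable (C g) by exact: Hev_measurable.
have fC g : measurable_fun (C g) (f k) by exact: (integral_Hev k 0 _ _).1.
have mf := @measurable_fun_bigsetU_seq _ (index_enum _) _ _ mC fC.
rewrite {1}Ccover ge0_integral_bigsetU //; last 3 first.
- exact: index_enum_uniq.
- move=> g g' _ _ [w]; rewrite !CE => -[hg hg']; apply/ffunP => j.
  have jt : (j <= t0 + 1)%N by rewrite -ltnS.
  have := hg j jt; have := hg' j jt; rewrite /ext !inord_val => <- //.
- by move=> w _; rewrite /f lee_fin.
rewrite -sumEFin; apply: eq_bigr => g _; rewrite (integral_Hev k 0 _ _).2.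
rewrite addn0 /= -/(C g) CE EFinM fineK //.
by apply: fin_num_measure; exact: chain_ev_measurable.
Qed.

End Integral.

(** Separates probability from analysis: the weights depend neither on phi nor on k, so it suffices
    to bound [TT] for each initial topology. *)
Lemma integral_trj_TT : exists (I : finType) (wt : I -> R) (u : I -> 'I_h),
  (forall i, 0 <= wt i) /\
  forall phi : state -> R, (forall S, 0 <= phi S) -> forall k,
    (\int[P]_w (phi (trj w k))%:E =
     (\sum_i wt i * TT 0 k (fun S _ => phi S) S0 (u i))%:E)%E.
Proof.
do 3![eexists]; split; last first.
  by move=> phi phi0 k; exact: (integral_trj (phi := fun S _ => phi S)).
by move=> g; rewrite fine_ge0.
Qed.

End Histories.

(** * Elementary estimates and the closed output loop *)

Lemma norm_sum_le {R : realType} (I : finType) (Q : pred I) (F : I -> R) (B : R) :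
  0 <= B -> (forall i, Q i -> `|F i| <= B) -> `|\sum_(i | Q i) F i| <= #|I|%:R * B.
Proof.
move=> B0 HF; apply: le_trans (ler_norm_sum _ _ _) _.
apply: (@le_trans _ _ (\sum_(i : I) B)).
  by rewrite big_mkcond; apply: ler_sum => i _; case: ifP => // /HF.
by rewrite sumr_const mulr_natl.
Qed.

Lemma sqr_increment {R : realType} (x y B d : R) : `|x| <= B -> `|y| <= B ->
  `|x - y| <= d -> `|x ^+ 2 - y ^+ 2| <= 2 * B * d.
Proof.
move=> hx hy hd; rewrite subr_sqr normrM mulrC; apply: ler_pM => //.
by apply: le_trans (ler_normD _ _) _; lra.
Qed.

Lemma projM_bound {R : realType} (M z : R) : 0 <= M -> `|projM M z| <= M.
Proof.
move=> M0; rewrite /projM ler_norml le_max lexx /= ge_max ge_min lexx /=.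
by rewrite andbT; lra.
Qed.

Lemma projM_nonexpansive {R : realType} (M y z : R) : `|y| <= M ->
  `|projM M z - y| <= `|z - y|.
Proof.
rewrite ler_norml => /andP[y1 y2]; rewrite /projM.
case: (lerP M z) => h1.
  have -> : Num.max (- M) M = M by apply: max_r; lra.
  by rewrite !ger0_norm; lra.
case: (lerP (- M) z) => h2 //.
by rewrite !ler0_norm; lra.
Qed.

(** The gains satisfy K2 B = 1 and K2 A = K2 - K1, so the feedback K1 cancels the drift of the
    output and leaves a pure integrator. *)
Lemma rdot_K2_closed_loop {R : realType} (n : nat) (a b : nat -> R) (x : 'cV[R]_n) (v : R) :
  (0 < n)%N ->
  rdot (K2 n b) (Amat n a *m x + (rdot (K1 n a b) x + v) *: Bvec R n) =
  rdot (K2 n b) x + v.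
Proof.
move=> n_gt0; have ln : (n.-1 < n)%N by rewrite prednK.
have B1 : rdot (K2 n b) (Bvec R n) = 1.
  pose l : 'I_n := Ordinal ln.
  rewrite /rdot (bigD1 l) //= !mxE /= prednK // eqxx /bext eqxx.
  rewrite gtn_eqF // mulr1 big1 ?addr0 // => k kl; rewrite !mxE.
  case: eqP => [kn|_]; last by rewrite mulr0.
  by case/eqP: kl; apply/val_inj => /=; lia.
have A1 : rdot (K2 n b) (Amat n a *m x) = rdot (K2 n b) x - rdot (K1 n a b) x.
  rewrite /rdot -sumrB; under eq_bigr do rewrite [(_ *m _) _ _]mxE mulr_sumr.
  rewrite exchange_big; apply: eq_bigr => l _ /=.
  under eq_bigr do rewrite mulrA.
  rewrite -mulr_suml -mulrBl; congr (_ * _); rewrite !mxE.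
  under eq_bigr do rewrite !mxE.
  pose l' : 'I_n := Ordinal ln.
  rewrite (bigD1 l') //= prednK // eqxx {1}/bext eqxx gtn_eqF // mul1r.
  suff -> : \sum_(k < n | k != l') bext n b k.+1 *
     (if k.+1 == n then a l.+1 else if l == k.+1 :> nat then 1 else 0) = bext n b l.
    by ring.
  have kn (k : 'I_n) : k != l' -> k.+1 == n = false.
    by move=> kl; apply/eqP => kn; case/eqP: kl; apply/val_inj => /=; lia.
  (* The first column of A has no entry from the superdiagonal, in agreement with
     [bext n b 0 = 0]. *)
  have [l0|l0] := posnP l.
    rewrite /bext l0 /= big1 // => k /kn ->; rewrite mulr0 //.
  have lp : (l.-1 < n)%N by have := ltn_ord l; lia.
  rewrite (bigD1 (Ordinal lp)) /=; last by rewrite -val_eqE /=; have := ltn_ord l; lia.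
  rewrite prednK // ltn_eqF ?ltn_ord // eqxx mulr1 big1 ?addr0 // => k.
  move=> /andP[/kn -> kl]; case: eqP => [lk|_]; last by rewrite mulr0.
  by case/eqP: kl; apply/val_inj => /=; lia.
have rdotDZ (K : 'rV[R]_n) x1 y1 e : rdot K (x1 + e *: y1) = rdot K x1 + e * rdot K y1.
  rewrite /rdot mulr_sumr -big_split; apply: eq_bigr => l _ /=.
  by rewrite !mxE; ring.
by rewrite rdotDZ A1 B1; ring.
Qed.

(** * Bit expectations, the invariant region and the calculus of [TT] *)

Section Dynamics.
Context {R : realType} {n N h : nat}.
Variables (a b : nat -> R) (E : 'I_h -> rel 'I_N) (Pm : 'M[R]_h).
Variables (c : 'I_N -> 'I_N -> R) (sigma beta gamma M : R) (t0 : nat).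
Hypothesis n_gt0 : (0 < n)%N.
Hypothesis HPst : stochastic Pm.
Hypothesis gamma_gt0 : 0 < gamma.
Hypothesis M_gt0 : 0 < M.
Hypothesis Ht0 : gamma * (dmaxU E)%:R - 1 < t0%:R.

Local Notation state := (@state R n N).
Local Notation np := (npairs E).
Local Notation bits := (bits E).
Local Notation step := (step a b E c sigma beta gamma M t0).
Local Notation znext := (znext E c sigma beta M t0).
Local Notation TT := (TT a b E Pm c sigma beta gamma M t0).
Local Notation Tk := (Tk a b E Pm c sigma beta gamma M t0).
Local Notation outp := (outp b).
Local Notation bprob := (bprob b c sigma).
Implicit Types (S : state) (u v : 'I_h) (s : bits).

Definition Ebit S (g : bits -> R) : R := \sum_(s : bits) (\prod_p bprob S p (s p)) * g s.

Lemma TkE k phi S u :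
  Tk k phi S u = Ebit S (fun s => \sum_v Pm u v * phi (step k S u (bitsOf s)) v).
Proof. by []. Qed.

Let bprob_ge0 S (p : 'I_np) x : 0 <= bprob S p x.
Proof. by rewrite /bprob; case: x; rewrite ?subr_ge0; [exact: Fn_ge0|exact: Fn_le1]. Qed.

Lemma Ebit_le S g1 g2 : (forall s, g1 s <= g2 s) -> Ebit S g1 <= Ebit S g2.
Proof.
move=> g12; apply: ler_sum => s _; apply: ler_wpM2l => //.
by apply: prodr_ge0 => p _.
Qed.

Let Ebit_one S : \sum_(s : bits) \prod_p bprob S p (s p) = 1.
Proof.
rewrite -(bigA_distr_bigA (fun (p : 'I_np) (x : bool) => bprob S p x)) big1 // => p _.
by rewrite big_bool /bprob /= addrC subrK.
Qed.

Lemma Ebit_affine S x y g : Ebit S (fun s => x * g s + y) = x * Ebit S g + y.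
Proof.
rewrite /Ebit; under eq_bigr do rewrite mulrDr.
rewrite big_split /= -mulr_suml Ebit_one mul1r mulr_sumr; congr (_ + _).
by apply: eq_bigr => s _; rewrite mulrCA.
Qed.

Lemma Ebit_cst S y : Ebit S (fun=> y) = y.
Proof. by rewrite /Ebit -mulr_suml Ebit_one mul1r. Qed.

Lemma EbitD S g1 g2 : Ebit S (fun s => g1 s + g2 s) = Ebit S g1 + Ebit S g2.
Proof.
by rewrite /Ebit -big_split; apply: eq_bigr => s _; rewrite mulrDr.
Qed.

(** The bit is absorbed as an extra factor at p, so the sum over patterns still factorises over
    pairs. *)
Lemma Ebit_bit S p : Ebit S (fun s => (s p)%:R) =
  Fn sigma (c (pairOf p).1 (pairOf p).2 - outp S (pairOf p).2).
Proof.
pose F (q : 'I_np) (x : bool) := bprob S q x * (if q == p then x%:R else 1).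
transitivity (\sum_(s : bits) \prod_q F q (s q)).
  apply: eq_bigr => s _; rewrite big_split /=; congr (_ * _).
  rewrite (bigD1 p) //= eqxx big1 ?mulr1 // => q qp.
  by rewrite (negbTE qp).
rewrite -(bigA_distr_bigA F) (bigD1 p) //= [X in _ * X]big1 ?mulr1.
  by rewrite big_bool /F eqxx /= mulr1 mulr0 addr0.
move=> q /negbTE qp; rewrite big_bool /F qp /bprob /= !mulr1 addrC subrK //.
Qed.

Lemma Ebit_sum_bit S (w : 'I_np -> R) (F : 'I_np -> R) :
  Ebit S (fun s => \sum_p w p * (F p - (s p)%:R)) =
  \sum_p w p * (F p - Fn sigma (c (pairOf p).1 (pairOf p).2 - outp S (pairOf p).2)).
Proof.
rewrite {1}/Ebit; under eq_bigr do rewrite mulr_sumr.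
rewrite exchange_big; apply: eq_bigr => p _ /=.
rewrite -Ebit_bit; transitivity (Ebit S (fun s => - w p * (s p)%:R + w p * F p)).
  by apply: eq_bigr => s _; congr (_ * _); ring.
by rewrite Ebit_affine; ring.
Qed.

Definition incr k S u (s : 'I_N -> 'I_N -> bool) (i : 'I_N) : R :=
  \sum_(j | E u i j) (znext k S u s i j - outp S i).

Lemma outp_step k S u (s : 'I_N -> 'I_N -> bool) i :
  outp (step k S u s) i = outp S i + gamma / (t0 + 1 + k).+1%:R * incr k S u s i.
Proof. exact: rdot_K2_closed_loop. Qed.

Definition Inv S := (forall i, `|outp S i| <= M) /\
  (forall i j, adjU E i j -> `|S.2 i j| <= M).

Let E_adjU u i j : E u i j -> adjU E i j.
Proof. by move=> uij; apply/existsP; exists u. Qed.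

Lemma znext_bound k S u (s : 'I_N -> 'I_N -> bool) i j : adjU E i j -> `|znext k S u s i j| <= M.
Proof. by move=> ij; rewrite znext_adj //; apply: projM_bound; exact: ltW. Qed.

(** The condition on t0 gives gamma d / (t + 1) <= 1 for every degree d, which makes the new output
    a convex combination of the old one and of projected estimates. *)
Lemma Inv_step k S u (s : 'I_N -> 'I_N -> bool) : Inv S -> Inv (step k S u s).
Proof.
move=> [Iy Iz]; split=> [i|i j ij]; last exact: znext_bound.
rewrite outp_step /incr sumrB sumr_const.
set d := #|_|; set T := (t0 + 1 + k).+1%:R.
have T0 : 0 < T by rewrite ltr0n.
have dT : gamma * d%:R <= T.
  have dd : (d <= dmaxU E)%N.
    apply: leq_trans (leq_bigmax (F := fun i => #|nbrU E i|) i).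
    by apply: subset_leq_card; apply/fintype.subsetP => j ij; rewrite inE; exact: E_adjU ij.
  have h1 : gamma * d%:R <= gamma * (dmaxU E)%:R by rewrite ler_pM2l // ler_nat.
  have h2 : t0%:R + 1 <= T by rewrite natr1 ler_nat ltnS -addnA leq_addr.
  by apply: le_trans h1 _; apply: le_trans h2; rewrite -lerBlDr; exact: ltW.
set Z := \sum_(j | _) _.
have hZ : `|Z| <= d%:R * M.
  apply: le_trans (ler_norm_sum _ _ _) _.
  apply: (@le_trans _ _ (\sum_(j | E u i j) M)).
    by apply: ler_sum => j /E_adjU; exact: znext_bound.
  by rewrite sumr_const mulr_natl.
have -> : outp S i + gamma / T * (Z - outp S i *+ d) =
   (1 - gamma * d%:R / T) * outp S i + gamma / T * Z.
  by rewrite -[_ *+ d]mulr_natl; field; rewrite gt_eqF.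
have f1 : 0 <= 1 - gamma * d%:R / T by rewrite subr_ge0 ler_pdivrMr ?mul1r.
have f2 : 0 <= gamma / T by apply: divr_ge0; apply: ltW.
apply: le_trans (ler_normD _ _) _; rewrite [`|_ * outp S i|]normrM [`|_ * Z|]normrM (ger0_norm f1) (ger0_norm f2).
have g1 := ler_wpM2l f1 (Iy i).
have g2 := ler_wpM2l f2 hZ.
have -> : M = (1 - gamma * d%:R / T) * M + gamma / T * (d%:R * M) by field; rewrite gt_eqF.
exact: lerD.
Qed.

Lemma Tk_le k phi psi S u : Inv S ->
  (forall S' v, Inv S' -> phi S' v <= psi S' v) -> Tk k phi S u <= Tk k psi S u.
Proof.
move=> IS H; rewrite !TkE; apply: Ebit_le => s; apply: ler_sum => v _.
by apply: ler_wpM2l; [exact: HPst.1|apply: H; exact: Inv_step].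
Qed.

Lemma Tk_affine k phi S u x y :
  Tk k (fun S v => x * phi S v + y) S u = x * Tk k phi S u + y.
Proof.
rewrite !TkE -Ebit_affine; apply: eq_bigr => s _; congr (_ * _).
under eq_bigr do rewrite mulrDr.
rewrite big_split /= -mulr_suml HPst.2 mul1r mulr_sumr; congr (_ + _).
by apply: eq_bigr => v _; rewrite mulrCA.
Qed.

Lemma TT_le j k phi psi S u : Inv S ->
  (forall S' v, Inv S' -> phi S' v <= psi S' v) -> TT k j phi S u <= TT k j psi S u.
Proof.
elim: j k S u => [|j IH] k S u IS H /=; first exact: H.
by apply: Tk_le => // S' v IS'; apply: IH.
Qed.

Lemma TT_affine j k phi S u x y :
  TT k j (fun S v => x * phi S v + y) S u = x * TT k j phi S u + y.
Proof.
elim: j k S u => [|j IH] k S u //=.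
rewrite -Tk_affine !TkE; do 2![apply: eq_bigr => ? _; congr (_ * _)].
exact: IH.
Qed.

Lemma Tk_lin k phi psi S u x y :
  Tk k (fun S v => x * phi S v + y * psi S v) S u = x * Tk k phi S u + y * Tk k psi S u.
Proof.
rewrite !TkE /Ebit !mulr_sumr -big_split; apply: eq_bigr => s _ /=.
rewrite mulrCA [y * _]mulrCA -mulrDr; congr (_ * _).
by rewrite !mulr_sumr -big_split; apply: eq_bigr => v _ /=; ring.
Qed.

Lemma TT_lin j k phi psi S u x y :
  TT k j (fun S v => x * phi S v + y * psi S v) S u =
  x * TT k j phi S u + y * TT k j psi S u.
Proof.
elim: j k S u => [|j IH] k S u //=; rewrite -Tk_lin !TkE.
by do 2![apply: eq_bigr => ? _; congr (_ * _)]; exact: IH.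
Qed.

End Dynamics.

Lemma sqnorm_bound {R : realType} (p : nat) (v : 'cV[R]_p) (B : R) :
  (forall i, `|v i 0| <= B) -> sqnorm v <= p%:R * B ^+ 2.
Proof.
move=> vB; apply: (@le_trans _ _ (\sum_(i < p) B ^+ 2)).
  apply: ler_sum => i _; rewrite -[v i 0 ^+ 2]real_normK ?num_real //.
  by rewrite ler_sqr ?nnegrE //; apply: le_trans (vB i).
by rewrite sumr_const card_ord mulr_natl.
Qed.

(** * Lyapunov drift of disagreement and estimation error *)

Section Lyapunov.
Context {R : realType} {n N h : nat}.
Variables (a b : nat -> R) (E : 'I_h -> rel 'I_N) (Pm : 'M[R]_h) (pi : 'I_h -> R).
Variables (c : 'I_N -> 'I_N -> R) (sigma beta gamma M : R) (t0 : nat).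
Hypothesis n_gt0 : (0 < n)%N.
Hypothesis N_gt0 : (0 < N)%N.
Hypothesis Esym : forall u, symmetric (E u).
Hypothesis Eirr : forall u, irreflexive (E u).
Hypothesis HPst : stochastic Pm.
Hypothesis Hpi : stationary Pm pi.
Hypothesis sigma_gt0 : 0 < sigma.
Hypothesis beta_gt0 : 0 < beta.
Hypothesis gamma_gt0 : 0 < gamma.
Hypothesis M_gt0 : 0 < M.
Hypothesis Ht0 : gamma * (dmaxU E)%:R - 1 < t0%:R.

Variables (l2 w1 w2 kappa : R).
Hypothesis l2_gt0 : 0 < l2.
Hypothesis lG_gt0 : 0 < lambdaG R E.
Hypothesis Hl2 : forall v : 'cV[R]_N, \sum_i v i 0 = 0 ->
  l2 * sqnorm v <= dot v ((\sum_u pi u *: laplacian R (E u)) *m v).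
Hypothesis w1_gt0 : 0 < w1.
Hypothesis w2_gt0 : 0 < w2.
Hypothesis kappa_ge0 : 0 <= kappa.

Local Notation rho := (lambdaG R E / l2).
Local Notation alpha := (alphaC E l2).
Local Notation fMv := (fM E c sigma M).
Local Notation pmin := (pimin pi).

(** Both inequalities say that [[p, -q], [-q, r]] maps the positive vector (w1, w2) to at least
    kappa times itself, with p = gamma l2, q = gamma rho, r = 2 beta f_M pi_min - gamma alpha. *)
Hypothesis Hkappa1 : kappa * w1 <= gamma * (w1 * l2 - w2 * rho).
Hypothesis Hkappa2 : kappa * w2 <=
  w2 * (2 * beta * fMv * pmin - gamma * alpha) - gamma * (w1 * rho).

Local Notation state := (@state R n N).
Local Notation np := (npairs E).
Local Notation bits := (bits E).
Local Notation step := (step a b E c sigma beta gamma M t0).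
Local Notation znext := (znext E c sigma beta M t0).
Local Notation TT := (TT a b E Pm c sigma beta gamma M t0).
Local Notation Tk := (Tk a b E Pm c sigma beta gamma M t0).
Local Notation outp := (outp b).
Local Notation incr := (incr b E c sigma beta M t0).
Local Notation Inv := (Inv b E M).
Local Notation Ebit := (Ebit b c sigma).
Local Notation tm k := ((t0 + 1 + k)%:R : R).
Implicit Types (S : state) (u v : 'I_h).

Definition yv S : 'cV[R]_N := \col_i outp S i.
Definition dl S : 'cV[R]_N := Jmat R N *m yv S.
Definition ev S : 'cV[R]_np := \col_p (S.2 (pairOf p).1 (pairOf p).2 - outp S (pairOf p).2).
(** Intermediate error: the estimate is already updated, the output not yet. *)
Definition eps k S u s : 'cV[R]_np :=
  \col_p (znext k S u s (pairOf p).1 (pairOf p).2 - outp S (pairOf p).2).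
Definition incrv k S u s : 'cV[R]_N := \col_i incr k S u s i.

(** The control gain is gamma / (t + 1) while the estimator uses beta / t; the mismatch is of order
    1/t^2. *)
Let tau k : R := gamma / (t0 + 1 + k).+1%:R.

Let tm_ge1 k : 1 <= tm k. Proof. by rewrite ler1n addn1 addSn. Qed.
Let tm_gt0 k : 0 < tm k. Proof. exact: lt_le_trans ltr01 (tm_ge1 k). Qed.

Let E_adjU u i j : E u i j -> adjU E i j.
Proof. by move=> uij; apply/existsP; exists u. Qed.

Lemma sum_pairOf (F : 'I_N * 'I_N -> R) :
  \sum_(p < np) F (pairOf p) = \sum_i \sum_(j | adjU E i j) F (i, j).
Proof.
rewrite pair_big_dep /= /npairs /pairOf.
rewrite -(big_enum_val (A := [pred p : 'I_N * 'I_N | adjU E p.1 p.2]) F).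
by apply: eq_big => -[i j].
Qed.

Lemma Wmat_mulE u (f : 'I_N -> 'I_N -> R) i :
  (Wmat R E u *m \col_p f (pairOf p).1 (pairOf p).2) i 0 = \sum_(j | E u i j) f i j.
Proof.
rewrite mxE; under eq_bigr do rewrite !mxE.
rewrite (sum_pairOf (fun x => ((x.1 == i) && E u x.1 x.2)%:R * f x.1 x.2)) /=.
rewrite (bigD1 i) //= [X in _ + X]big1 ?addr0.
  rewrite big_mkcond [RHS]big_mkcond; apply: eq_bigr => j _; rewrite eqxx /=.
  have [uij|_] := boolP (E u i j); first by rewrite (E_adjU uij) mul1r.
  by rewrite mul0r if_same.
by move=> k /negbTE ki; rewrite big1 // => j _; rewrite ki mul0r.
Qed.

Lemma Qmat_mulE (v : 'cV[R]_N) p : (Qmat R E *m v) p 0 = v (pairOf p).2 0.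
Proof.
rewrite mxE (bigD1 (pairOf p).2) //= mxE eqxx mul1r big1 ?addr0 // => k.
by rewrite mxE eq_sym => /negbTE ->; rewrite mul0r.
Qed.

(** Splits zhat_ij - y_i into zhat_ij - y_j and y_j - y_i, and uses L J = L. *)
Lemma incrvE k S u s :
  incrv k S u s = Wmat R E u *m eps k S u s - laplacian R (E u) *m dl S.
Proof.
apply/matrixP => i j; rewrite ord1 laplacian_Jmat // [LHS]mxE [RHS]mxE [X in _ + X]mxE.
rewrite (Wmat_mulE u (fun i j => znext k S u s i j - outp S j)).
rewrite laplacian_mulmxE // -sumrB; apply: eq_bigr => l _.
by rewrite ![yv S _ _]mxE; lra.
Qed.

Lemma yv_step k S u s : yv (step k S u s) = yv S + tau k *: incrv k S u s.
Proof. by apply/matrixP => i j; rewrite !mxE outp_step. Qed.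

Lemma dl_step k S u s :
  dl (step k S u s) = dl S + tau k *: (Jmat R N *m incrv k S u s).
Proof. by rewrite /dl yv_step mulmxDr -scalemxAr. Qed.

Lemma ev_step k S u s :
  ev (step k S u s) = eps k S u s - tau k *: (Qmat R E *m incrv k S u s).
Proof.
apply/matrixP => p j; rewrite ord1 [RHS]mxE [X in _ + X]mxE [X in _ - X]mxE Qmat_mulE.
by rewrite [LHS]mxE [incrv _ _ _ _ _ _]mxE [eps _ _ _ _ _ _]mxE outp_step //= opprD addrA.
Qed.

(** Crude bounds on [Inv]: this one and those derived from it below enter only remainder terms. *)
Let rB : R := N%:R * (2 * M).

Let rB_ge0 : 0 <= rB.
Proof. by rewrite /rB mulr_ge0 // mulr_ge0 // ltW. Qed.

Let norm2M (x y : R) : `|x| <= M -> `|y| <= M -> `|x - y| <= 2 * M.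
Proof. by move=> hx hy; apply: le_trans (ler_normB _ _) _; lra. Qed.

Lemma incr_bound k S u s i : Inv S -> `|incr k S u s i| <= rB.
Proof.
move=> [Iy Iz]; rewrite /rB -[N in N%:R]card_ord; apply: norm_sum_le.
  by rewrite mulr_ge0 // ltW.
by move=> j /E_adjU ij; apply: norm2M => //; exact: znext_bound.
Qed.

Let CJ : R := N%:R * (2 * rB) ^+ 2.
Let CQ : R := np%:R * rB ^+ 2.

Lemma J_incrv_bound k S u s : Inv S -> sqnorm (Jmat R N *m incrv k S u s) <= CJ.
Proof.
move=> IS; apply: sqnorm_bound => i; rewrite Jmat_mulE.
have Nn : N%:R != 0 :> R by rewrite pnatr_eq0 -lt0n.
have h1 : `|incrv k S u s i 0| <= rB by rewrite mxE; exact: incr_bound.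
have h2 : `|N%:R^-1 * \sum_j incrv k S u s j 0| <= rB.
  rewrite normrM ger0_norm ?invr_ge0 // ler_pdivrMl ?ltr0n //.
  rewrite -[N in N%:R * _]card_ord; apply: norm_sum_le => // j _.
  by rewrite mxE; exact: incr_bound.
by apply: le_trans (ler_normB _ _) _; lra.
Qed.

Lemma Q_incrv_bound k S u s : Inv S -> sqnorm (Qmat R E *m incrv k S u s) <= CQ.
Proof.
move=> IS; apply: sqnorm_bound => p; rewrite Qmat_mulE mxE; exact: incr_bound.
Qed.

Definition Phi S : R := w1 * sqnorm (dl S) + w2 * sqnorm (ev S).

Let lG_le u : opnorm (Jmat R N *m Wmat R E u) ^+ 2 <= lambdaG R E.
Proof. exact: (le_bigmax _ (fun u => opnorm (Jmat R N *m Wmat R E u) ^+ 2)). Qed.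
Let lQW_le u : opnorm (Qmat R E *m Wmat R E u) ^+ 2 <= lambdaQW R E.
Proof. exact: (le_bigmax _ (fun u => opnorm (Qmat R E *m Wmat R E u) ^+ 2)). Qed.
Let lQL_le u : opnorm (Qmat R E *m laplacian R (E u)) ^+ 2 <= lambdaQL R E.
Proof. exact: (le_bigmax _ (fun u => opnorm (Qmat R E *m laplacian R (E u)) ^+ 2)). Qed.
Let lQW_ge0 : 0 <= lambdaQW R E.
Proof. by rewrite /lambdaQW; elim/big_ind: _ => [|x y x0 y0|u _]; rewrite ?le_max ?x0 ?sqr_ge0. Qed.
Let lQL_ge0 : 0 <= lambdaQL R E.
Proof. by rewrite /lambdaQL; elim/big_ind: _ => [|x y x0 y0|u _]; rewrite ?le_max ?x0 ?sqr_ge0. Qed.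

Let rho_gt0 : 0 < rho. Proof. exact: divr_gt0. Qed.

Lemma alphaC_ge0 : 0 <= alpha.
Proof.
rewrite /alphaC addr_ge0 ?mulr_ge0 ?sqrtr_ge0 ?invr_ge0 //; exact: ltW.
Qed.

Lemma sqnorm_mul2_le p q r (A : 'M[R]_(p, q)) (B : 'M[R]_(q, r)) (v : 'cV[R]_r) (l : R) :
  opnorm (A *m B) ^+ 2 <= l -> sqnorm (A *m (B *m v)) <= l * sqnorm v.
Proof.
move=> hl; rewrite mulmxA; apply: le_trans (sqnorm_mulmx_le _ _) _.
by apply: ler_wpM2r; [exact: sqnorm_ge0|].
Qed.

Let tau_gt0 k : 0 < tau k. Proof. by rewrite /tau divr_gt0 ?ltr0n. Qed.

(** Origin of [rho]: Young's inequality on the cross term with weight l2 leaves lambda_G / l2 in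
    front of the error. It spends half of the decay 2 l2 that the mean Laplacian provides. *)
Lemma sqnorm_dl_step k S u s : Inv S ->
  sqnorm (dl (step k S u s)) <= sqnorm (dl S) +
    tau k * (l2 * sqnorm (dl S) + rho * sqnorm (eps k S u s)
             - 2 * dot (dl S) (laplacian R (E u) *m dl S)) + tau k ^+ 2 * CJ.
Proof.
move=> IS; rewrite dl_step sqnormD sqnormZ dotZr.
have hJ := ler_wpM2l (sqr_ge0 (tau k)) (J_incrv_bound k u s IS).
apply: lerD hJ; rewrite lerD2l mulrCA ler_pM2l //.
rewrite incrvE mulmxBr Jmat_laplacian // dotBr mulrBr lerD2r.
apply: Young_dot; first exact: ltW.
  by rewrite mulr_ge0 ?sqnorm_ge0 // ltW.
rewrite mulrA mulrCA divff ?gt_eqF // mulr1; exact: sqnorm_mul2_le.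
Qed.

(** Origin of [alphaC]: the term in Q W costs 2 sqrt(lambda_QW); the term in Q L is split so that
    the coefficient of |delta|^2 is again [rho], which costs lambda_QL l2 / lambda_G. *)
Lemma sqnorm_ev_step k S u s : Inv S ->
  sqnorm (ev (step k S u s)) <= sqnorm (eps k S u s) +
    tau k * (alpha * sqnorm (eps k S u s) + rho * sqnorm (dl S)) + tau k ^+ 2 * CQ.
Proof.
move=> IS; rewrite ev_step sqnormD -scaleNr sqnormZ dotZr sqrrN.
have hQ := ler_wpM2l (sqr_ge0 (tau k)) (Q_incrv_bound k u s IS).
apply: lerD hQ; rewrite lerD2l.
set e := eps k S u s; set x := dot _ _.
suff hx : 2 * - x <= alpha * sqnorm e + rho * sqnorm (dl S).
  by have := ler_wpM2l (ltW (tau_gt0 k)) hx; lra.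
rewrite /x incrvE mulmxBr dotBr -/e.
have h1 : 2 * dot e (- (Qmat R E *m (Wmat R E u *m e))) <=
    Num.sqrt (lambdaQW R E) * sqnorm e + Num.sqrt (lambdaQW R E) * sqnorm e.
  apply: Young_dot; rewrite ?mulr_ge0 ?sqrtr_ge0 ?sqnorm_ge0 //.
  rewrite mulrA -expr2 sqr_sqrtr // -scaleN1r sqnormZ sqrrN expr1n mul1r.
  exact: sqnorm_mul2_le.
have h2 : 2 * dot e (Qmat R E *m (laplacian R (E u) *m dl S)) <=
    lambdaQL R E * l2 / lambdaG R E * sqnorm e + rho * sqnorm (dl S).
  apply: Young_dot; rewrite ?mulr_ge0 ?invr_ge0 ?sqnorm_ge0 //; try exact: ltW.
  rewrite (_ : _ * (_ * _) = lambdaQL R E * sqnorm (dl S)); last first.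
    by field; rewrite !gt_eqF.
  exact: sqnorm_mul2_le.
move: h1; rewrite dotNr /alphaC; lra.
Qed.

Definition Lq u S : R := \sum_i \sum_(j | E u i j) (outp S i - outp S j) ^+ 2.
Definition Eq u S : R :=
  \sum_(p < np) (E u (pairOf p).1 (pairOf p).2)%:R * ev S p 0 ^+ 2.

Lemma LqE u S : 2 * dot (dl S) (laplacian R (E u) *m dl S) = Lq u S.
Proof.
rewrite dot_laplacian //; apply: eq_bigr => i _; apply: eq_bigr => j _.
by rewrite /dl !Jmat_mulE ![yv S _ _]mxE; congr (_ ^+ 2); lra.
Qed.

Lemma Lq_ge0 u S : 0 <= Lq u S.
Proof. by do 2![apply: sumr_ge0 => ? _]; exact: sqr_ge0. Qed.

Lemma Eq_ge0 u S : 0 <= Eq u S.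
Proof. by apply: sumr_ge0 => p _; rewrite mulr_ge0 // sqr_ge0. Qed.

Let sqr_2M (x : R) : `|x| <= 2 * M -> `|x ^+ 2| <= (2 * M) ^+ 2.
Proof.
move=> hx; rewrite normrX ler_sqr ?nnegrE //; exact: le_trans hx.
Qed.

Let LB : R := N%:R * (N%:R * (2 * M) ^+ 2).
Let EB : R := np%:R * (2 * M) ^+ 2.

Let M2_ge0 : 0 <= (2 * M) ^+ 2. Proof. exact: sqr_ge0. Qed.
Let LB_ge0 : 0 <= LB. Proof. by rewrite /LB mulr_ge0 // mulr_ge0. Qed.
Let EB_ge0 : 0 <= EB. Proof. by rewrite /EB mulr_ge0. Qed.

Lemma Lq_bound u S : Inv S -> `|Lq u S| <= LB.
Proof.
move=> [Iy _]; rewrite /LB -[N in N%:R * (_ * _)]card_ord.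
apply: norm_sum_le; first by rewrite mulr_ge0.
move=> i _; rewrite -[N in N%:R]card_ord; apply: norm_sum_le => // j _.
by apply: sqr_2M; apply: norm2M.
Qed.

Lemma ev_bound S p : Inv S -> `|ev S p 0| <= 2 * M.
Proof.
move=> [Iy Iz]; rewrite mxE; apply: norm2M => //; apply: Iz; exact: adjU_pairOf.
Qed.

Let norm_bool_mul (x : bool) (y : R) : `|x%:R * y| <= `|y|.
Proof. by case: x; rewrite ?mul1r ?mul0r ?normr0. Qed.

Lemma Eq_bound u S : Inv S -> `|Eq u S| <= EB.
Proof.
move=> IS; rewrite /EB -[np in np%:R]card_ord; apply: norm_sum_le => // p _.
by apply: le_trans (norm_bool_mul _ _) _; apply: sqr_2M; exact: ev_bound.
Qed.

Let Fdiff_bound (x : R) (y : bool) : `|Fn sigma x - y%:R| <= 1.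
Proof.
have := Fn_ge0 sigma x; have := Fn_le1 sigma x.
by rewrite ler_norml; case: y => /=; lra.
Qed.

Let dF S (s : bits) p : R :=
  Fn sigma (c (pairOf p).1 (pairOf p).2 - S.2 (pairOf p).1 (pairOf p).2) - (s p)%:R.

(** The outputs lie in [-M, M], so projecting does not move an estimate away from them; the square
    is then expanded, with |F - s| <= 1 in the quadratic term. *)
Lemma sqnorm_eps_le k S u (s : bits) : Inv S ->
  sqnorm (eps k S u (bitsOf s)) <= sqnorm (ev S) +
    2 * (beta / tm k) *
      (\sum_p (E u (pairOf p).1 (pairOf p).2)%:R * ev S p 0 * dF S s p) +
    np%:R * (beta / tm k) ^+ 2.
Proof.
move=> [Iy Iz].
apply: (@le_trans _ _ (\sum_p (ev S p 0 ^+ 2 + 2 * (beta / tm k) *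
  ((E u (pairOf p).1 (pairOf p).2)%:R * ev S p 0 * dF S s p) + (beta / tm k) ^+ 2))); last first.
  by rewrite !big_split /= -mulr_sumr sumr_const card_ord lerD2l mulr_natl.
apply: ler_sum => p _; rewrite [eps _ _ _ _ _ _]mxE znext_adj ?adjU_pairOf //.
rewrite (bitsOf_pairOf s p) -/(dF S s p).
set y := outp S (pairOf p).2; set z := S.2 _ _; set B := beta / tm k.
set X := projM _ _ - y.
have hX : X ^+ 2 <= (z + B * (E u (pairOf p).1 (pairOf p).2)%:R * dF S s p - y) ^+ 2.
  rewrite -[X ^+ 2]real_normK ?num_real // -[leRHS]real_normK ?num_real //.
  by rewrite ler_sqr ?nnegrE //; apply: projM_nonexpansive; exact: Iy.
apply: le_trans hX _.
have -> : ev S p 0 = z - y by rewrite mxE.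
have hd : (E u (pairOf p).1 (pairOf p).2)%:R * dF S s p ^+ 2 <= 1 :> R.
  have : dF S s p ^+ 2 <= 1.
    rewrite -[dF S s p ^+ 2]real_normK ?num_real // expr_le1 //; exact: Fdiff_bound.
  by case: (E u _ _); rewrite ?mul1r ?mul0r.
have := ler_wpM2l (sqr_ge0 B) hd; rewrite mulr1.
by case: (E u _ _); rewrite /= ?mulr1n ?mulr0n; lra.
Qed.

(** Averaging turns the bit into F(c - y), and [Fn_monotone_fM] applies to each active pair. *)
Lemma Ebit_dF S u : Inv S ->
  Ebit S (fun s => \sum_p (E u (pairOf p).1 (pairOf p).2)%:R * ev S p 0 * dF S s p)
  <= - fMv * Eq u S.
Proof.
move=> [Iy Iz]; rewrite Ebit_sum_bit /Eq mulr_sumr; apply: ler_sum => p _.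
rewrite -mulrA [leRHS]mulrCA; apply: ler_wpM2l => //.
by rewrite mxE; apply: Fn_monotone_fM => //; [exact: adjU_pairOf|apply: Iz; exact: adjU_pairOf].
Qed.

(** The part of the first-order drift that depends on the current topology. *)
Definition qf S u : R := - (gamma * w1 * Lq u S) - 2 * beta * fMv * w2 * Eq u S.

Local Notation aa := (w1 * rho + w2 * alpha).
Let C1 : R := gamma * w1 * LB + (w2 + gamma * aa) * (np%:R * beta ^+ 2)
              + gamma ^+ 2 * (w1 * CJ + w2 * CQ).

Let C1_ge0 : 0 <= C1.
Proof.
have al0 := alphaC_ge0; have r0 := ltW rho_gt0.
have g0 := ltW gamma_gt0; have w10 := ltW w1_gt0; have w20 := ltW w2_gt0.
have aa0 : 0 <= aa by rewrite addr_ge0 ?(mulr_ge0 w10 r0) ?(mulr_ge0 w20 al0).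
have CJ0 : 0 <= CJ by rewrite /CJ mulr_ge0 ?sqr_ge0.
have CQ0 : 0 <= CQ by rewrite /CQ mulr_ge0 ?sqr_ge0.
have h1 := mulr_ge0 (mulr_ge0 g0 w10) LB_ge0.
have h2 : 0 <= np%:R * beta ^+ 2 by rewrite mulr_ge0 ?sqr_ge0.
have h3 := mulr_ge0 (addr_ge0 w20 (mulr_ge0 g0 aa0)) h2.
have h4 := mulr_ge0 (sqr_ge0 gamma) (addr_ge0 (mulr_ge0 w10 CJ0) (mulr_ge0 w20 CQ0)).
exact: addr_ge0 (addr_ge0 h1 h3) h4.
Qed.

Lemma Ebit_Phi k S u : Inv S ->
  Ebit S (fun s : bits => Phi (step k S u (bitsOf s))) <=
  Phi S + (qf S u + gamma * (w1 * l2 + w2 * rho) * sqnorm (dl S)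
           + gamma * aa * sqnorm (ev S)) / tm k + C1 / tm k ^+ 2.
Proof.
move=> IS; set D := sqnorm (dl S); set e := sqnorm (ev S).
have al0 := alphaC_ge0; have r0 := ltW rho_gt0.
have g0 := ltW gamma_gt0; have w10 := ltW w1_gt0; have w20 := ltW w2_gt0.
have b0 := ltW beta_gt0.
have aa0 : 0 <= aa by rewrite addr_ge0 ?(mulr_ge0 w10 r0) ?(mulr_ge0 w20 al0).
have t0' := ltW (tau_gt0 k).
have D0 : 0 <= D by exact: sqnorm_ge0.
have e0 : 0 <= e by exact: sqnorm_ge0.
have f0 : 0 <= fMv by exact/ltW/fM_gt0.
have L0 := Lq_ge0 u S; have Q0 := Eq_ge0 u S.
have LLB : Lq u S <= LB by apply: le_trans (Lq_bound u IS); exact: ler_norm.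
pose U := w1 * D + tau k * ((w1 * l2 + w2 * rho) * D) - tau k * (w1 * Lq u S)
  + tau k ^+ 2 * (w1 * CJ + w2 * CQ).
pose K := w2 + tau k * aa.
pose it := (tm k)^-1.
have K0 : 0 <= K by rewrite addr_ge0 ?mulr_ge0.
pose Y (s : bits) := \sum_p (E u (pairOf p).1 (pairOf p).2)%:R * ev S p 0 * dF S s p.
have h1 (s : bits) : Phi (step k S u (bitsOf s)) <=
    K * (2 * (beta * it)) * Y s + (U + K * (e + np%:R * (beta * it) ^+ 2)).
  have p1 := sqnorm_dl_step k u (bitsOf s) IS.
  have p2 := sqnorm_ev_step k u (bitsOf s) IS.
  rewrite LqE in p1.
  have q1 := ler_wpM2l w10 p1; have q2 := ler_wpM2l w20 p2.
  have q3 := ler_wpM2l K0 (sqnorm_eps_le k u s IS).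
  move: q1 q2 q3; rewrite /Phi -/D -/e -/(Y s) -/it /K /U.
  by set x1 := sqnorm (dl _); set x2 := sqnorm (ev _); set x3 := sqnorm (eps _ _ _ _); lra.
apply: le_trans (Ebit_le b c sigma S h1) _; rewrite Ebit_affine //.
have hY : Ebit S Y <= - fMv * Eq u S by exact: Ebit_dF.
have it0 : 0 <= it by rewrite invr_ge0 ltW.
have it1 : it <= 1 by rewrite invf_le1.
have Kb0 : 0 <= K * (2 * (beta * it)) by rewrite !mulr_ge0.
have hK := ler_wpM2l Kb0 hY.
(* Terms of positive sign allow enlarging tau to gamma / t. The negative term in [Lq] does not;
   there the replacement costs gamma / t^2 times a bound on [Lq]. *)
have tauE : tau k <= gamma * it.
  by rewrite /tau ler_wpM2l // lef_pV2 ?posrE ?tm_gt0 ?ltr0n ?ler_nat.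
have tauD : gamma * it - tau k <= gamma * it ^+ 2.
  rewrite /tau /it -natr1; have tp := tm_gt0 k; set t := (tm k) in tp *.
  rewrite (_ : gamma / t - _ = gamma * (t^-1 * (t + 1)^-1)); last first.
    by field; rewrite !gt_eqF // ltr_wpDr.
  apply: ler_wpM2l => //; rewrite expr2; apply: ler_wpM2l; first by rewrite invr_ge0 ltW.
  by rewrite lef_pV2 ?posrE ?ltr_wpDr // lerDl.
rewrite /Phi -/D -/e /qf -exprVn -/it.
have m1 := ler_wpM2r (mulr_ge0 (addr_ge0 (mulr_ge0 w10 (ltW l2_gt0)) (mulr_ge0 w20 r0)) D0) tauE.
have m2 := ler_wpM2r (mulr_ge0 w10 L0) tauD.
have m3 := ler_wpM2l (mulr_ge0 (mulr_ge0 g0 (sqr_ge0 it)) w10) LLB.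
have m4 := ler_wpM2r (mulr_ge0 aa0 e0) tauE.
have tau_g : tau k <= gamma.
  by apply: le_trans tauE _; rewrite ler_piMr.
have nb : 0 <= np%:R * (beta * it) ^+ 2 by rewrite mulr_ge0 ?sqr_ge0.
have m5 := ler_wpM2r (mulr_ge0 aa0 nb) tau_g.
have m6 : tau k ^+ 2 <= (gamma * it) ^+ 2.
  by rewrite ler_sqr ?nnegrE // mulr_ge0.
have CC0 : 0 <= w1 * CJ + w2 * CQ.
  by rewrite addr_ge0 // mulr_ge0 // /CJ /CQ mulr_ge0 // sqr_ge0.
have m7 := ler_wpM2r CC0 m6.
have m8 : 0 <= tau k * aa * (2 * (beta * it) * (fMv * Eq u S)) by rewrite !mulr_ge0.
move: hK m1 m2 m3 m4 m5 m7 m8; rewrite /K /U /C1.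
set z1 := Ebit S Y; set z2 := Lq u S; set z3 := Eq u S; set z4 := tau k.
by set z5 := CJ; set z6 := CQ; set z7 := LB; set z8 := np%:R; lra.
Qed.

Lemma outp_step_diff k S u s i : Inv S ->
  `|outp (step k S u s) i - outp S i| <= gamma * rB / tm k.
Proof.
move=> IS; rewrite outp_step // addrAC subrr add0r -/(tau k) normrM gtr0_norm //.
apply: le_trans (ler_wpM2l (ltW (tau_gt0 k)) (incr_bound k u s i IS)) _.
rewrite [leRHS]mulrAC; apply: ler_wpM2r => //.
by rewrite /tau ler_pM2l // lef_pV2 ?posrE ?tm_gt0 ?ltr0n ?ler_nat.
Qed.

Lemma znext_diff k S u s i j : adjU E i j -> Inv S ->
  `|znext k S u s i j - S.2 i j| <= beta / tm k.
Proof.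
move=> ij [Iy Iz]; rewrite znext_adj //.
apply: le_trans (projM_nonexpansive _ (Iz i j ij)) _.
have b0 : 0 <= beta / tm k by rewrite divr_ge0 // ltW.
rewrite addrAC subrr add0r -mulrA normrM (ger0_norm b0) ler_piMr //.
exact: le_trans (norm_bool_mul _ _) (Fdiff_bound _ _).
Qed.

Lemma Lq_step_diff k S u s v : Inv S ->
  `|Lq v (step k S u s) - Lq v S| <=
  N%:R * (N%:R * (2 * (2 * M) * (2 * (gamma * rB / tm k)))).
Proof.
move=> IS; have IS' : Inv (step k S u s) by apply: Inv_step.
have g0 : 0 <= gamma * rB / tm k by rewrite !mulr_ge0 ?invr_ge0 // ltW.
have M0 := ltW M_gt0.
have c0 : 0 <= 2 * (2 * M) * (2 * (gamma * rB / tm k)).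
  by apply: mulr_ge0; apply: mulr_ge0 => //; exact: mulr_ge0.
rewrite -sumrB -[N in N%:R * (_ * _)]card_ord; apply: norm_sum_le.
  exact: mulr_ge0.
move=> i _; rewrite -sumrB -[N in N%:R]card_ord; apply: norm_sum_le => //.
move=> j _; apply: sqr_increment; [exact: (norm2M (IS'.1 i) (IS'.1 j))|exact: (norm2M (IS.1 i) (IS.1 j))|].
have d1 := outp_step_diff k u s i IS; have d2 := outp_step_diff k u s j IS.
rewrite (_ : _ - _ = (outp (step k S u s) i - outp S i) - (outp (step k S u s) j - outp S j)).
  by apply: le_trans (ler_normB _ _) _; lra.
by lra.
Qed.

Lemma Eq_step_diff k S u s v : Inv S ->
  `|Eq v (step k S u s) - Eq v S| <=
  np%:R * (2 * (2 * M) * (beta / tm k + gamma * rB / tm k)).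
Proof.
move=> IS; have IS' : Inv (step k S u s) by apply: Inv_step.
have g0 : 0 <= gamma * rB / tm k by rewrite !mulr_ge0 ?invr_ge0 // ltW.
have b0 : 0 <= beta / tm k by rewrite divr_ge0 // ltW.
have M0 := ltW M_gt0.
have c0 : 0 <= 2 * (2 * M) * (beta / tm k + gamma * rB / tm k).
  by apply: mulr_ge0; [apply: mulr_ge0 => //; exact: mulr_ge0|exact: addr_ge0].
rewrite -sumrB -[np in np%:R]card_ord; apply: norm_sum_le => //.
move=> p _; rewrite -mulrBr; apply: le_trans (norm_bool_mul _ _) _.
apply: sqr_increment; [exact: ev_bound|exact: ev_bound|].
have d1 := outp_step_diff k u s (pairOf p).2 IS.
have d2 := znext_diff k u s (adjU_pairOf p) IS.
rewrite !mxE (_ : _ - _ = (znext k S u s (pairOf p).1 (pairOf p).2 - S.2 (pairOf p).1 (pairOf p).2)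
  - (outp (step k S u s) (pairOf p).2 - outp S (pairOf p).2)) /=.
  by apply: le_trans (ler_normB _ _) _; lra.
by rewrite /=; lra.
Qed.

Let Bq : R := gamma * w1 * LB + 2 * beta * fMv * w2 * EB.
Let Lc : R := gamma * w1 * (N%:R * (N%:R * (2 * (2 * M) * (2 * (gamma * rB))))) +
  2 * beta * fMv * w2 * (np%:R * (2 * (2 * M) * (beta + gamma * rB))).

Let cL_ge0 : 0 <= gamma * w1. Proof. by rewrite mulr_ge0 // ltW. Qed.
Let cE_ge0 : 0 <= 2 * beta * fMv * w2.
Proof. by rewrite !mulr_ge0 // ?ltW // fM_gt0. Qed.

Lemma qf_bound S u : Inv S -> `|qf S u| <= Bq.
Proof.
move=> IS; rewrite /qf; apply: le_trans (ler_normB _ _) _; rewrite normrN.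
rewrite [`|_ * Lq u S|]normrM [`|_ * Eq u S|]normrM (ger0_norm cL_ge0) (ger0_norm cE_ge0).
by apply: lerD; apply: ler_wpM2l => //; [exact: Lq_bound|exact: Eq_bound].
Qed.

(** The state moves by O(1/t) per step, so the corrector, already divided by t, changes with it by
    O(1/t^2). *)
Lemma qf_step_diff k S u s v : Inv S ->
  `|qf (step k S u s) v - qf S v| <= Lc / tm k.
Proof.
move=> IS; have d1 := Lq_step_diff k u s v IS; have d2 := Eq_step_diff k u s v IS.
set x := Lq v _ - _ in d1; set y := Eq v _ - _ in d2.
rewrite (_ : _ - _ = - (gamma * w1 * x) - 2 * beta * fMv * w2 * y); last first.
  by rewrite /qf /x /y; lra.
apply: le_trans (ler_normB _ _) _; rewrite normrN.
rewrite [`|_ * x|]normrM [`|_ * y|]normrM (ger0_norm cL_ge0) (ger0_norm cE_ge0).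
have m1 := ler_wpM2l cL_ge0 d1; have m2 := ler_wpM2l cE_ge0 d2.
apply: le_trans (lerD m1 m2) _.
by rewrite le_eqVlt; apply/orP; left; apply/eqP; rewrite /Lc; field; rewrite gt_eqF.
Qed.

Lemma sum_pi_Lq S : \sum_u pi u * Lq u S =
  2 * dot (dl S) ((\sum_u pi u *: laplacian R (E u)) *m dl S).
Proof.
rewrite mulmx_suml.
rewrite (big_morph (dot (dl S)) (@dotDr _ _ _) (dot0r _)) mulr_sumr.
by apply: eq_bigr => u _; rewrite -LqE -scalemxAl dotZr; ring.
Qed.

(** Each pair is an edge of at least one graph, and that topology alone has stationary weight at
    least [pimin]. *)
Lemma sum_pi_Eq S : pmin * sqnorm (ev S) <= \sum_u pi u * Eq u S.
Proof.
have [p0 _ _] := Hpi.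
under eq_bigr do rewrite mulr_sumr.
rewrite exchange_big mulr_sumr; apply: ler_sum => p _ /=.
under eq_bigr do rewrite mulrA.
rewrite -mulr_suml; apply: ler_wpM2r; first exact: sqr_ge0.
have /existsP[u uE] := adjU_pairOf p.
rewrite (bigD1 u) //= uE mulr1; apply: ler_wpDr.
  by apply: sumr_ge0 => v _; rewrite mulr_ge0.
exact: bigmin_le.
Qed.

(** The coefficients of |delta|^2 and |e|^2 are compared separately, by [Hkappa1] and [Hkappa2]. *)
Lemma mean_drift S :
  \sum_u pi u * qf S u + gamma * (w1 * l2 + w2 * rho) * sqnorm (dl S)
    + gamma * aa * sqnorm (ev S) <= - kappa * Phi S.
Proof.
have D0 := sqnorm_ge0 (dl S); have e0 := sqnorm_ge0 (ev S).
have hL : 2 * (l2 * sqnorm (dl S)) <= \sum_u pi u * Lq u S.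
  by rewrite sum_pi_Lq ler_pM2l // Hl2 // sum_Jmat_mul.
have hE := sum_pi_Eq S.
have -> : \sum_u pi u * qf S u = - (gamma * w1 * \sum_u pi u * Lq u S)
     - 2 * beta * fMv * w2 * \sum_u pi u * Eq u S.
  rewrite !mulr_sumr -sumrN -sumrB; apply: eq_bigr => u _; rewrite /qf; ring.
have m1 := ler_wpM2l cL_ge0 hL; have m2 := ler_wpM2l cE_ge0 hE.
have m3 := ler_wpM2r D0 Hkappa1; have m4 := ler_wpM2r e0 Hkappa2.
move: m1 m2 m3 m4; rewrite /Phi.
set z1 := \sum_u pi u * Lq u S; set z2 := \sum_u pi u * Eq u S.
set z3 := sqnorm (dl S); set z4 := sqnorm (ev S); set r := rho; set al := alpha.
by set z5 := pmin; set z6 := fMv; lra.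
Qed.

Variable Z : 'I_h -> 'I_h -> R.
Hypothesis HZ : forall q : 'I_h -> R,
  let qc v := q v - \sum_u pi u * q u in
  let g u := \sum_v Z u v * qc v in
  forall u, g u - \sum_v Pm u v * g v = qc u.

(** The solution of Poisson's equation for the centred q, linear in q. *)
Definition corr (q : 'I_h -> R) u : R := \sum_v Z u v * (q v - \sum_w pi w * q w).

Let Zs : R := \sum_u \sum_v `|Z u v|.
Let Zs_ge0 : 0 <= Zs. Proof. by do 2![apply: sumr_ge0 => ? _]. Qed.

Lemma corr_bound q (B : R) u : (forall v, `|q v| <= B) -> `|corr q u| <= Zs * (2 * B).
Proof.
move=> qB; have [p0 p1 _] := Hpi.
have B0 : 0 <= B by apply: le_trans (qB u).
have hm : `|\sum_w pi w * q w| <= B.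
  apply: le_trans (ler_norm_sum _ _ _) _; rewrite -[B]mul1r -p1 mulr_suml.
  by apply: ler_sum => w _; rewrite normrM ger0_norm // ler_wpM2l.
apply: le_trans (ler_norm_sum _ _ _) _.
apply: (@le_trans _ _ (\sum_v `|Z u v| * (2 * B))).
  apply: ler_sum => v _; rewrite normrM ler_wpM2l //.
  by apply: le_trans (ler_normB _ _) _; have := qB v; lra.
rewrite -mulr_suml; apply: ler_wpM2r; first by lra.
by rewrite /Zs [leRHS](bigD1 u) //= lerDl; do 2![apply: sumr_ge0 => ? _].
Qed.

Lemma corrB q1 q2 u : corr q1 u - corr q2 u = corr (fun v => q1 v - q2 v) u.
Proof.
rewrite /corr -sumrB; apply: eq_bigr => v _; rewrite -mulrBr; congr (_ * _).
by under [in RHS]eq_bigr do rewrite mulrBr; rewrite sumrB; ring.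
Qed.

(* First-order corrector: it replaces the topology-dependent drift [qf S u] by
   its stationary mean, up to O(1/t^2). *)
Definition Psi k S u : R := Phi S + corr (qf S) u / tm k.

Let Cg : R := Zs * (2 * Bq).
Let CL : R := Zs * (2 * Lc).

Let Bq_ge0 : 0 <= Bq.
Proof.
by apply: addr_ge0; apply: mulr_ge0.
Qed.

Let Lc_ge0 : 0 <= Lc.
Proof.
have M0 := ltW M_gt0; have g0 := ltW gamma_gt0; have b0 := ltW beta_gt0.
have M4 : 0 <= 2 * (2 * M) by apply: mulr_ge0 => //; exact: mulr_ge0.
have gr : 0 <= gamma * rB by exact: mulr_ge0.
apply: addr_ge0; apply: mulr_ge0 => //; apply: mulr_ge0 => //.
  by apply: mulr_ge0 => //; apply: mulr_ge0 => //; exact: mulr_ge0.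
by apply: mulr_ge0 => //; exact: addr_ge0.
Qed.

Let Cg_ge0 : 0 <= Cg. Proof. by apply: mulr_ge0 => //; exact: mulr_ge0. Qed.
Let CL_ge0 : 0 <= CL. Proof. by apply: mulr_ge0 => //; exact: mulr_ge0. Qed.

Lemma Psi_Phi k S u : Inv S -> `|Psi k S u - Phi S| <= Cg / tm k.
Proof.
move=> IS; rewrite /Psi addrAC subrr add0r normrM [`|_^-1|]ger0_norm ?invr_ge0 //.
by apply: ler_wpM2r; rewrite ?invr_ge0 //; apply: corr_bound => v; exact: qf_bound.
Qed.

Lemma Phi_ge0 S : 0 <= Phi S.
Proof. by rewrite addr_ge0 // mulr_ge0 ?sqnorm_ge0 // ltW. Qed.

Let CP : R := w1 * (N%:R * (2 * M) ^+ 2) + w2 * EB.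

Lemma Phi_bound S : Inv S -> Phi S <= CP.
Proof.
move=> IS; apply: lerD; apply: ler_wpM2l; try exact: ltW; apply: sqnorm_bound; last first.
  by move=> p; exact: ev_bound.
move=> i; rewrite Jmat_mulE; have [Iy _] := IS; rewrite mxE.
apply: norm2M => //; rewrite normrM ger0_norm ?invr_ge0 // ler_pdivrMl ?ltr0n //.
rewrite -[N in N%:R * _]card_ord; apply: norm_sum_le; first exact: ltW.
by move=> j _; rewrite mxE.
Qed.

Let CD : R := C1 + (CL + Cg) + kappa * Cg.
Let CD_ge0 : 0 <= CD.
Proof. by apply: addr_ge0; [apply: addr_ge0 => //; exact: addr_ge0|exact: mulr_ge0]. Qed.

Lemma Psi_drift k S u : Inv S ->
  Tk k (Psi k.+1) S u <= (1 - kappa / tm k) * Psi k S u + CD / tm k ^+ 2.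
Proof.
move=> IS; have tp := tm_gt0 k; have t1 := tm_ge1 k.
have [P0 P1] := HPst.
pose it := (tm k)^-1; have it0 : 0 <= it by rewrite invr_ge0 ltW.
have h1 (s : bits) : \sum_v Pm u v * Psi k.+1 (step k S u (bitsOf s)) v <=
    Phi (step k S u (bitsOf s)) +
    ((\sum_v Pm u v * corr (qf S) v) * it + (CL + Cg) * it ^+ 2).
  set S' := step k S u (bitsOf s); have IS' : Inv S' by apply: Inv_step.
  (* Two replacements in the corrector, each of cost O(1/t^2): the old state for the new one ([CL]),
     and 1/t for 1/(t + 1) ([Cg]). *)
  have hv v : Psi k.+1 S' v <= Phi S' + (corr (qf S) v * it + (CL + Cg) * it ^+ 2).
    rewrite /Psi lerD2l addnS -natr1 -/(tm k); set t := tm k.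
    have hc : `|corr (qf S') v - corr (qf S) v| <= CL * it.
      rewrite corrB /CL -!mulrA; apply: corr_bound => w; exact: qf_step_diff.
    have hg : `|corr (qf S) v| <= Cg by apply: corr_bound => w; exact: qf_bound.
    set x := corr (qf S') v in hc *; set y := corr (qf S) v in hc hg *.
    have jt : (t + 1)^-1 <= it by rewrite lef_pV2 ?posrE ?ltr_wpDr // lerDl.
    have j0 : 0 <= (t + 1)^-1 by rewrite invr_ge0 addr_ge0 // ltW.
    have e1 : x / (t + 1) = y * it + (x - y) / (t + 1) - y * (it * (t + 1)^-1).
      rewrite /it -/t; field; rewrite !gt_eqF // ltr_wpDr //.
    have e2 : (x - y) / (t + 1) <= CL * it * it.
      apply: (@le_trans _ _ (CL * it * (t + 1)^-1)).
        by apply: ler_wpM2r => //; apply: le_trans hc; exact: ler_norm.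
      by apply: ler_wpM2l => //; rewrite mulr_ge0.
    have e3 : - y * (it * (t + 1)^-1) <= Cg * (it * it).
      apply: (@le_trans _ _ (Cg * (it * (t + 1)^-1))).
        apply: ler_wpM2r; first by rewrite mulr_ge0.
        by apply: le_trans hg; rewrite -normrN ler_norm.
      by apply: ler_wpM2l => //; apply: ler_wpM2l.
    rewrite e1; move: e2 e3; set z1 := (x - y) / (t + 1); set z2 := it * (t + 1)^-1.
    lra.
  apply: (@le_trans _ _ (\sum_v Pm u v * (Phi S' + (corr (qf S) v * it + (CL + Cg) * it ^+ 2)))).
    by apply: ler_sum => v _; apply: ler_wpM2l.
  have sumE (X Y : R) (F : 'I_h -> R) : \sum_v Pm u v * (X + (F v * it + Y)) =
      X + ((\sum_v Pm u v * F v) * it + Y).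
    transitivity (\sum_v (Pm u v * X + (Pm u v * F v * it + Pm u v * Y))).
      by apply: eq_bigr => v _; ring.
    by rewrite !big_split /= -!mulr_suml P1 !mul1r.
  by rewrite sumE.
rewrite TkE; apply: le_trans (Ebit_le b c sigma S h1) _.
rewrite EbitD Ebit_cst.
have h2 := Ebit_Phi k u IS.
have hZ := HZ (qf S) u; rewrite /= -/(corr (qf S) u) in hZ.
rewrite (_ : \sum_v Pm u v * _ = \sum_v Pm u v * corr (qf S) v) // in hZ.
have h3 := mean_drift S.
have h4 : Psi k S u - Phi S <= Cg * it.
  by apply: le_trans (Psi_Phi k u IS); exact: ler_norm.
have h5 := ler_wpM2r it0 h3.
have h6 := ler_wpM2l (mulr_ge0 kappa_ge0 it0) h4.
have PsiE : Psi k S u = Phi S + corr (qf S) u * it by [].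
move: h2 hZ h5 h6; rewrite PsiE /CD -!exprVn -/it.
set z1 := Ebit S _; set z2 := \sum_v Pm u v * _; set z3 := corr _ _.
set z4 := \sum_u0 pi u0 * _; set z5 := sqnorm (dl S); set z6 := sqnorm (ev S).
set z7 := qf S u; set z8 := Phi S; set r := rho; set al := alpha => h2 hZ h5 h6.
(* By Poisson's equation the averaged corrector is the old one minus [qf S u] plus the stationary
   mean, so [qf S u] cancels and its mean remains. *)
have hZ2 : z2 * it = (z3 - z7 + z4) * it by congr (_ * _); lra.
by lra.
Qed.

Variable S0 : state.
Hypothesis InvS0 : Inv S0.

Local Notation V u0 k := (TT 0 k (Psi k) S0 u0).

Let V_rec u0 k : V u0 k.+1 <= (1 - kappa / tm k) * V u0 k + CD / tm k ^+ 2.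
Proof.
rewrite TT_last add0n -TT_affine //; apply: TT_le => // S u; exact: Psi_drift.
Qed.

Let TT_cst k y u : TT 0 k (fun _ _ => y) S0 u = y.
Proof.
transitivity (0 * TT 0 k (fun _ _ => 0) S0 u + y); last by rewrite mul0r add0r.
rewrite -TT_affine //; congr (TT 0 k _ _ _).
by apply/funext => S'; apply/funext => v; rewrite mul0r add0r.
Qed.

Let V_bound u0 k : `|V u0 k| <= CP + Cg.
Proof.
have hb S u : Inv S -> `|Psi k S u| <= CP + Cg.
  move=> IS; rewrite -(subrK (Phi S) (Psi k S u)) addrC.
  apply: le_trans (ler_normD _ _) _; apply: lerD.
    by rewrite ger0_norm ?Phi_ge0 // Phi_bound.
  apply: le_trans (Psi_Phi k u IS) _; rewrite ler_piMr // invf_le1 //.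
rewrite ler_norml; apply/andP; split;
  [rewrite -[leLHS](TT_cst k _ u0)|rewrite -[leRHS](TT_cst k _ u0)];
  by apply: TT_le => // S u IS; have := hb S u IS; rewrite ler_norml => /andP[].
Qed.

Let sqnorm_dl_le u0 k :
  TT 0 k (fun S _ => sqnorm (dl S)) S0 u0 <= w1^-1 * (V u0 k + Cg / tm k).
Proof.
rewrite mulrDr -TT_affine //; apply: TT_le => // S u IS.
rewrite -mulrDr ler_pdivlMl //; apply: (@le_trans _ _ (Phi S)).
  by rewrite lerDl mulr_ge0 ?sqnorm_ge0 // ltW.
have := Psi_Phi k u IS; rewrite ler_norml => /andP[h1 _]; lra.
Qed.

Lemma sqnorm_dl_tends_le0 u0 : 0 < kappa <= 1 ->
  tends_le0 (fun k => TT 0 k (fun S _ => sqnorm (dl S)) S0 u0).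
Proof.
move=> hk; have T0 : (0 < t0 + 1)%N by rewrite addn1.
have hV := drift_tends_le0 T0 hk CD_ge0 (V_rec u0).
move=> e e0; have we : 0 < w1 * e / 2 by rewrite divr_gt0 // mulr_gt0.
have [K HK] := hV _ we.
exists (maxn K (Num.truncn (Cg / (w1 * e / 2))).+1) => k.
rewrite geq_max => /andP[hK hk2].
apply: le_trans (sqnorm_dl_le u0 k) _; rewrite ler_pdivrMl //.
have h1 := HK k hK.
have h2 : Cg / tm k <= w1 * e / 2.
  rewrite ler_pdivrMr // mulrC -ler_pdivrMr //.
  apply: le_trans (ltW (truncnS_gt _)) _; rewrite ler_nat.
  by apply: leq_trans hk2 _; rewrite leq_addl.
lra.
Qed.

Lemma sqnorm_dl_O_inv u0 : 1 < kappa <= 2 ->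
  O_inv (fun k => TT 0 k (fun S _ => sqnorm (dl S)) S0 u0).
Proof.
move=> hk; have T0 : (0 < t0 + 1)%N by rewrite addn1.
have [C HC] := drift_O_inv T0 hk CD_ge0 (V_bound u0) (V_rec u0).
exists (w1^-1 * (C + Cg)) => k; apply: le_trans (sqnorm_dl_le u0 k) _.
rewrite -[leRHS]mulrA; apply: ler_wpM2l; first by rewrite invr_ge0 ltW.
rewrite mulrDl; apply: lerD => //; apply: ler_wpM2l => //.
by rewrite lef_pV2 ?posrE ?tm_gt0 ?ltr0n ?ler_nat // -add1n leq_add2r leq_addl.
Qed.

End Lyapunov.

(** * Squared modulus of complex numbers *)

Section ComplexModulus.
Context {R : realType}.

Definition sqn (z : R[i]) : R := complex.Re z ^+ 2 + complex.Im z ^+ 2.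

Lemma sqn_ge0 z : 0 <= sqn z.
Proof. by rewrite addr_ge0 ?sqr_ge0. Qed.

Lemma sqn_real (x : R) : sqn (x%:C)%C = x ^+ 2.
Proof. by rewrite /sqn /= expr0n addr0. Qed.

Lemma sqn_lt1 (z : R[i]) : `|z| < 1 -> sqn z < 1.
Proof.
rewrite normc_def -[1](rmorph1 (real_complex R)) ltcR -/(sqn z) => h.
by rewrite -(sqr_sqrtr (sqn_ge0 z)) expr_lt1 // sqrtr_ge0.
Qed.

(** Young's inequality with eta = (1 - |z|^2)/2; then (1 + eta) |z|^2 <= (1 + |z|^2)/2 because (1 -
    |z|^2)^2 >= 0. *)
Lemma sqnMD (z p q : R[i]) : sqn z < 1 ->
  sqn (p + z * q) <= (1 + sqn z) / 2 * sqn q + (1 + ((1 - sqn z) / 2)^-1) * sqn p.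
Proof.
move=> z1; have z0 := sqn_ge0 z; have q0 := sqn_ge0 q.
set eta := (1 - sqn z) / 2; have e0 : 0 < eta by rewrite /eta; lra.
have sq (x y : R) : (x + y) ^+ 2 <= (1 + eta^-1) * x ^+ 2 + (1 + eta) * y ^+ 2.
  have -> : (1 + eta^-1) * x ^+ 2 + (1 + eta) * y ^+ 2 =
     (x + y) ^+ 2 + eta^-1 * (x - eta * y) ^+ 2 by field; lra.
  by rewrite lerDl mulr_ge0 ?sqr_ge0 // invr_ge0 ltW.
have h : sqn (p + z * q) <= (1 + eta^-1) * sqn p + (1 + eta) * (sqn z * sqn q).
  case: p z q {z1 z0 q0} @eta e0 sq => [p1 p2] [z1 z2] [q1 q2] eta e0 sq.
  rewrite /sqn /=; have := sq p1 (z1 * q1 - z2 * q2); have := sq p2 (z1 * q2 + z2 * q1).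
  by lra.
apply: le_trans h _; rewrite addrC lerD2r mulrA ler_wpM2r //.
have : 0 <= (1 - sqn z) * (1 - sqn z) by rewrite mulr_ge0 //; lra.
by rewrite /eta; lra.
Qed.

End ComplexModulus.

(** * From output disagreement to state deviations *)

Section Deviations.
Context {R : realType} {n N h : nat}.
Variables (a b : nat -> R) (E : 'I_h -> rel 'I_N) (Pm : 'M[R]_h).
Variables (c : 'I_N -> 'I_N -> R) (sigma beta gamma M : R) (t0 : nat).
Hypothesis n_gt0 : (0 < n)%N.
Hypothesis HPst : stochastic Pm.
Hypothesis gamma_gt0 : 0 < gamma.
Hypothesis M_gt0 : 0 < M.
Hypothesis Ht0 : gamma * (dmaxU E)%:R - 1 < t0%:R.
Hypothesis Hschur : forall z : R[i], root (bpoly n b) z -> `|z| < 1.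

Local Notation state := (@state R n N).
Local Notation step := (step a b E c sigma beta gamma M t0).
Local Notation TT := (TT a b E Pm c sigma beta gamma M t0).
Local Notation Tk := (Tk a b E Pm c sigma beta gamma M t0).
Local Notation outp := (outp b).
Local Notation Inv := (Inv b E M).
Local Notation dl := (dl b).
Implicit Types (S : state) (i : 'I_N) (q : {poly R[i]}).

Definition dev S i (l : nat) : R :=
  if insub l is Some o then (S.1 i - xbar S.1) (o : 'I_n) 0 else 0.

Lemma devE S i (o : 'I_n) : dev S i o = (S.1 i - xbar S.1) o 0.
Proof. by rewrite /dev valK. Qed.

Lemma dev_step k S u s i l : (l.+1 < n)%N -> dev (step k S u s) i l = dev S i l.+1.
Proof.
move=> ln; rewrite -[l in LHS]/(val (Ordinal (ltnW ln))) -[l.+1]/(val (Ordinal ln)) !devE.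
set o := Ordinal (ltnW ln); set o' := Ordinal ln.
have xE j : (step k S u s).1 j o 0 = S.1 j o' 0.
  rewrite /step /= !mxE (ltn_eqF ln) mulr0 addr0 (bigD1 o') //= mxE (ltn_eqF ln) eqxx mul1r.
  rewrite big1 ?addr0 // => m; rewrite -val_eqE /= mxE (ltn_eqF ln) => /negbTE /= ->.
  by rewrite mul0r.
have bE : xbar (step k S u s).1 o 0 = xbar S.1 o' 0.
  rewrite /xbar [LHS]mxE [RHS]mxE !summxE; congr (_ * _).
  by apply: eq_bigr => j _; exact: xE.
by rewrite [LHS]mxE [RHS]mxE [X in _ + X]mxE [X in _ = _ + X]mxE xE bE.
Qed.

(** A polynomial read as a linear functional of the deviation, X^l picking component l.
    Multiplication by X becomes the time shift, and [bpoly] becomes the output disagreement. *)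
Definition Lf q S i : R[i] := \sum_(0 <= l < n) q`_l * ((dev S i l)%:C)%C.

Lemma LfB q1 q2 S i : Lf (q1 - q2) S i = Lf q1 S i - Lf q2 S i.
Proof.
by rewrite /Lf -sumrB; apply: eq_bigr => l _; rewrite coefB mulrBl.
Qed.

Lemma LfZ z q S i : Lf (z *: q) S i = z * Lf q S i.
Proof.
by rewrite /Lf mulr_sumr; apply: eq_bigr => l _; rewrite coefZ mulrA.
Qed.

(** A is a companion matrix and the input enters the last component only, which the size condition
    excludes. *)
Lemma Lf_step q k S u s i : (size q < n)%N ->
  Lf q (step k S u s) i = Lf ('X * q) S i.
Proof.
move=> qn; rewrite /Lf -[X in index_iota 0 X](prednK n_gt0).
rewrite big_nat_recr //= big_nat_recl //= nth_default ?mul0r ?addr0; last first.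
  by rewrite -ltnS prednK.
rewrite coefXM /= mul0r add0r; apply: eq_big_nat => l /andP[_ ln].
by rewrite coefXM /= dev_step // -ltn_predRL.
Qed.

Lemma Lf_XsubC z q S i : Lf (q * ('X - z%:P)) S i = Lf ('X * q) S i - z * Lf q S i.
Proof. by rewrite mulrBr LfB [q * 'X]mulrC [q * _]mulrC mul_polyC LfZ. Qed.

Lemma coef_bpoly l : (l < n)%N -> (bpoly n b)`_l = ((bext n b l.+1)%:C)%C.
Proof.
move=> ln; rewrite /bpoly coefD coefXn coef_sum /bext /=.
have [ln1|ln1] := eqVneq l.+1 n.
  have -> : (l == n.-1) = true by rewrite -ln1 eqxx.
  rewrite big_nat_cond big1 ?addr0 // => k /andP[/andP[k1 kn] _].
  rewrite coefZ coefXn (_ : (l == k.-1) = false) ?mulr0 //.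
  by apply/eqP => lk; move: kn; rewrite -ln1 lk prednK // ltnn.
have ln2 : (l.+1 < n)%N by rewrite ltn_neqAle ln1.
have -> : (l == n.-1) = false by rewrite -eqSS prednK // (negbTE ln1).
rewrite add0r (bigD1_seq l.+1) ?iota_uniq ?mem_index_iota //=.
rewrite coefZ coefXn eqxx mulr1 big_nat_cond big1 ?addr0 // => k.
move=> /andP[/andP[k1 kn] kl]; rewrite coefZ coefXn (_ : (l == k.-1) = false) ?mulr0 //.
by rewrite -eqSS prednK // eq_sym (negbTE kl).
Qed.

Lemma size_bpoly : size (bpoly n b) = n.
Proof.
apply/eqP; rewrite eqn_leq; apply/andP; split.
  rewrite /bpoly; apply: leq_trans (size_polyD _ _) _.
  rewrite size_polyXn prednK // geq_max leqnn /=.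
  rewrite big_nat_cond; elim/big_ind: _ => [|p q hp hq|k].
  - by rewrite size_poly0.
  - by apply: leq_trans (size_polyD _ _) _; rewrite geq_max hp.
  move=> /andP[/andP[k1 kn] _]; apply: leq_trans (size_scale_leq _ _) _.
  by rewrite size_polyXn prednK // ltnW.
have ln : (n.-1 < n)%N by rewrite prednK.
rewrite -{1}(prednK n_gt0); apply: contraTT isT; rewrite -ltnNge => /ltnSE sz.
have := coef_bpoly ln; rewrite nth_default // prednK // /bext eqxx gtn_eqF //.
by move=> /(congr1 (@complex.Re R)) /= /eqP; rewrite eq_sym oner_eq0.
Qed.

Lemma monic_bpoly : bpoly n b \is monic.
Proof.
rewrite monicE lead_coefE size_bpoly coef_bpoly; last by rewrite prednK.
by rewrite prednK // /bext eqxx gtn_eqF.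
Qed.

Lemma dlE S i : dl S i 0 = \sum_(0 <= l < n) bext n b l.+1 * dev S i l.
Proof.
rewrite big_mkord Jmat_mulE mxE; under [X in _ * X]eq_bigr do rewrite mxE.
rewrite -[outp S i]/(rdot _ _); under [X in _ * X]eq_bigr do rewrite -[outp _ _]/(rdot _ _).
rewrite /rdot exchange_big mulr_sumr -sumrB; apply: eq_bigr => l _ /=.
rewrite devE !mxE summxE -mulr_sumr; ring.
Qed.

Lemma Lf_bpoly S i : Lf (bpoly n b) S i = ((dl S i 0)%:C)%C.
Proof.
rewrite dlE raddf_sum /=; apply: eq_big_nat => l /andP[_ ln].
by rewrite coef_bpoly // -rmorphM.
Qed.

Lemma Lf_Xn S i (l : 'I_n) : Lf 'X^l S i = ((dev S i l)%:C)%C.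
Proof.
rewrite /Lf big_mkord (bigD1 l) //= coefXn eqxx mul1r big1 ?addr0 // => k kl.
by rewrite coefXn val_eqE (negbTE kl) mul0r.
Qed.

Variables (S0 : state) (u0 : 'I_h) (i : 'I_N).
Hypothesis InvS0 : Inv S0.

Definition msq q (k : nat) : R := TT 0 k (fun S _ => sqn (Lf q S i)) S0 u0.

Lemma TT_eq k j phi psi S u : (forall S u, phi S u = psi S u) ->
  TT k j phi S u = TT k j psi S u.
Proof. by move=> pp; congr (TT k j _ S u); apply/funext => S'; apply/funext => u'. Qed.

Let Tk_det k (phi psi : state -> R) S u :
  (forall s, phi (step k S u s) = psi S) -> Tk k (fun S _ => phi S) S u = psi S.
Proof.
move=> H; rewrite TkE -[RHS](@Ebit_cst R n N h b E c sigma S); apply: eq_bigr => s _.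
by rewrite -mulr_suml HPst.2 mul1r H.
Qed.

Lemma msq_shift q k : (size q < n)%N -> msq q k.+1 = msq ('X * q) k.
Proof.
move=> qn; rewrite /msq TT_last; apply: TT_eq => S u.
by apply: (@Tk_det _ _ (fun S => sqn (Lf ('X * q) S i))) => s; rewrite Lf_step.
Qed.

(** From X q = q (X - z) + z q: dividing by a linear factor with a stable root costs one
    contraction. *)
Lemma msq_contract q (z : R[i]) k : (size q < n)%N -> sqn z < 1 ->
  msq q k.+1 <= (1 + sqn z) / 2 * msq q k +
     (1 + ((1 - sqn z) / 2)^-1) * msq (q * ('X - z%:P)) k.
Proof.
move=> qn z1; rewrite msq_shift // /msq -TT_lin; apply: TT_le => // S u _.
rewrite (_ : Lf ('X * q) S i = Lf (q * ('X - z%:P)) S i + z * Lf q S i); last first.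
  by rewrite Lf_XsubC subrK.
exact: sqnMD.
Qed.

(** Stands for [tends_le0] or [O_inv]; the closure properties below are all that the argument uses,
    so both conclusions share it. *)
Variable C : (nat -> R) -> Prop.
Hypothesis C_contract : forall (v q : nat -> R) (rho D : R), 0 <= rho -> rho < 1 -> 0 <= D ->
  (forall k, v k.+1 <= rho * v k + D * q k) -> C q -> C v.
Hypothesis C_shift : forall v, C v -> C (fun k => v k.+1).
Hypothesis C_sum : forall (I : finType) (F : I -> nat -> R),
  (forall j, C (F j)) -> C (fun k => \sum_j F j k).
Hypothesis C_le : forall v w : nat -> R, (forall k, v k <= w k) -> C w -> C v.

(** Induction on the roots, removing one linear factor at a time; the size bound keeps every
    intermediate product within reach of [msq_contract]. *)
Let msq_divide (r : seq R[i]) q : (forall z, z \in r -> sqn z < 1) ->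
  (size q + size r <= n)%N -> C (msq (q * \prod_(z <- r) ('X - z%:P))) -> C (msq q).
Proof.
elim: r q => [|z r IH] q hr sz; first by rewrite big_nil mulr1.
rewrite big_cons mulrA => H.
have z1 : sqn z < 1 by apply: hr; rewrite mem_head.
have qn : (size q < n)%N by apply: leq_trans sz; rewrite /= addnS ltnS leq_addr.
have Cq : C (msq (q * ('X - z%:P))).
  apply: IH H; first by move=> y yr; apply: hr; rewrite in_cons yr orbT.
  apply: leq_trans sz; rewrite /= addnS -addSn leq_add2r.
  apply: leq_trans (size_polyMleq _ _) _; by rewrite size_XsubC addn2.
apply: (C_contract _ _ _ _ Cq) => [||| k]; last exact: msq_contract.
- by have := sqn_ge0 z; lra.
- by lra.
- by rewrite addr_ge0 // invr_ge0; lra.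
Qed.

Let C_msq1 : C (fun k => TT 0 k (fun S _ => sqnorm (dl S)) S0 u0) -> C (msq 1).
Proof.
move=> Cd; have [r rE] := closed_field_poly_normal (bpoly n b).
rewrite (monicP monic_bpoly) scale1r in rE.
apply: (@msq_divide r).
- by move=> z zr; apply/sqn_lt1/Hschur; rewrite rE root_prod_XsubC.
- by rewrite size_poly1 add1n -(size_prod_XsubC r id) -rE size_bpoly.
rewrite mul1r -rE; apply: C_le Cd => k; apply: TT_le => // S u _.
rewrite Lf_bpoly sqn_real [leRHS]/sqnorm (bigD1 i) //= lerDl.
by apply: sumr_ge0 => j _; exact: sqr_ge0.
Qed.

(** Component l is component 0 seen l steps later. *)
Let C_msqX l : (l < n)%N -> C (msq 1) -> C (msq 'X^l).
Proof.
move=> + C1; elim: l => [|l IH] ln; first by rewrite expr0.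
have := C_shift (IH (ltnW ln)); rewrite exprS.
by apply: C_le => k; rewrite msq_shift // size_polyXn.
Qed.

Let TT_sum k (I : finType) (F : I -> state -> 'I_h -> R) :
  TT 0 k (fun S u => \sum_j F j S u) S0 u0 = \sum_j TT 0 k (F j) S0 u0.
Proof.
elim: (index_enum I) => [|j l IH].
  pose O : state -> 'I_h -> R := fun _ _ => 0.
  rewrite big_nil; transitivity (0 * TT 0 k O S0 u0 + 0 * TT 0 k O S0 u0).
    by rewrite -TT_lin; apply: TT_eq => S u; rewrite big_nil !mul0r addr0.
  by rewrite !mul0r addr0.
rewrite big_cons -IH -[X in _ = X + _]mul1r -[X in _ = _ + X]mul1r -TT_lin.
by apply: TT_eq => S u; rewrite big_cons !mul1r.
Qed.

Lemma deviation_from_dl : C (fun k => TT 0 k (fun S _ => sqnorm (dl S)) S0 u0) ->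
  C (fun k => TT 0 k (fun S _ => sqnorm (S.1 i - xbar S.1)) S0 u0).
Proof.
move=> /C_msq1 C1.
apply: (C_le _ (C_sum (fun l : 'I_n => C_msqX (ltn_ord l) C1))) => k.
rewrite -TT_sum le_eqVlt; apply/orP; left; apply/eqP; apply: TT_eq => S u.
by apply: eq_bigr => l _; rewrite Lf_Xn sqn_real devE.
Qed.

End Deviations.

(** * Closure properties of the decay classes, and the choice of weights *)

Section DecayClasses.
Context {R : realType}.
Implicit Types v w : nat -> R.

Lemma tends_le0_le v w : (forall k, v k <= w k) -> tends_le0 w -> tends_le0 v.
Proof.
by move=> vw hw e /hw[K HK]; exists K => k /HK; exact: le_trans.
Qed.

Lemma tends_le0_shift v : tends_le0 v -> tends_le0 (fun k => v k.+1).
Proof. by move=> hv e /hv[K HK]; exists K => k /leqW; exact: HK. Qed.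

Lemma tends_le0_scale v x : 0 <= x -> tends_le0 v -> tends_le0 (fun k => x * v k).
Proof.
move=> x0 hv e e0; have x1 : 0 < x + 1 by rewrite ltr_wpDl.
have [K HK] := hv _ (divr_gt0 e0 x1); exists K => k /HK h.
apply: le_trans (ler_wpM2l x0 h) _; rewrite mulrA ler_pdivrMr //; lra.
Qed.

Lemma tends_le0_sum (I : finType) (F : I -> nat -> R) :
  (forall j, tends_le0 (F j)) -> tends_le0 (fun k => \sum_j F j k).
Proof.
move=> hF; elim: (index_enum I) => [|j l IH] e e0.
  by exists 0%N => k _; rewrite big_nil ltW.
have e2 : 0 < e / 2 by lra.
have [K1 HK1] := hF j _ e2; have [K2 HK2] := IH _ e2.
exists (maxn K1 K2) => k; rewrite geq_max => /andP[/HK1 h1 /HK2 h2].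
by rewrite big_cons; lra.
Qed.

Lemma O_inv_le v w : (forall k, v k <= w k) -> O_inv w -> O_inv v.
Proof. by move=> vw [C HC]; exists C => k; apply: le_trans (HC k). Qed.

Lemma O_inv_ge0 v : O_inv v -> exists2 C : R, 0 <= C & forall k, v k <= C / k.+1%:R.
Proof.
move=> [C HC]; exists (Num.max C 0); first by rewrite le_max lexx orbT.
move=> k; apply: le_trans (HC k) _; apply: ler_wpM2r; first by rewrite invr_ge0.
by rewrite le_max lexx.
Qed.

Lemma O_inv_shift v : O_inv v -> O_inv (fun k => v k.+1).
Proof.
move=> /O_inv_ge0[C C0 HC]; exists C => k; apply: le_trans (HC k.+1) _.
by apply: ler_wpM2l => //; rewrite lef_pV2 ?posrE ?ltr0n // ler_nat.
Qed.

Lemma O_inv_scale v x : 0 <= x -> O_inv v -> O_inv (fun k => x * v k).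
Proof.
by move=> x0 [C HC]; exists (x * C) => k; rewrite -mulrA ler_wpM2l.
Qed.

Lemma O_inv_sum (I : finType) (F : I -> nat -> R) :
  (forall j, O_inv (F j)) -> O_inv (fun k => \sum_j F j k).
Proof.
move=> hF; elim: (index_enum I) => [|j l [C2 H2]].
  by exists 0 => k; rewrite big_nil mul0r.
have [C1 H1] := hF j; exists (C1 + C2) => k.
by rewrite big_cons mulrDl lerD.
Qed.

(* With w1 = q and w2 = p - kappa, the first inequality is an equality and the
   second one says that kappa is at most the least eigenvalue of
   [[p, -q], [-q, r]]. *)
Lemma contraction_weights (p q r kappa0 : R) : 0 < q -> kappa0 < p ->
  q ^+ 2 < (p - kappa0) * (r - kappa0) ->
  exists kappa w1 w2 : R, [/\ kappa0 < kappa <= kappa0 + 1, 0 < w1, 0 < w2,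
    kappa * w1 <= p * w1 - q * w2 & kappa * w2 <= r * w2 - q * w1].
Proof.
move=> q0 pk hq.
have P0 : 0 < p - kappa0 by lra.
have R0 : 0 < r - kappa0.
  by rewrite -(pmulr_rgt0 _ P0); apply: lt_trans hq; rewrite exprn_gt0.
set P := p - kappa0 in P0 hq *; set Q := r - kappa0 in R0 hq *.
have PQ : 0 < P + Q by rewrite addr_gt0.
(* Determinant over trace, a lower bound for the least eigenvalue of [[P, -q], [-q, Q]]. In [eta],
   the bound P/2 keeps w2 positive and the bound 1 caps kappa as the drift lemmas require. *)
set d := (P * Q - q ^+ 2) / (P + Q).
have d0 : 0 < d by rewrite divr_gt0 // subr_gt0.
set eta := Num.min 1 (Num.min d (P / 2)).
have eta0 : 0 < eta by rewrite !lt_min ltr01 d0 divr_gt0.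
have eta1 : eta <= 1 by rewrite ge_min lexx.
have eta2 : eta <= d by rewrite !ge_min lexx orbT.
have eta3 : eta <= P / 2 by rewrite !ge_min lexx !orbT.
have hd : eta * (P + Q) <= P * Q - q ^+ 2 by rewrite -ler_pdivlMr.
have e2 : 0 <= eta ^+ 2 by exact: sqr_ge0.
exists (kappa0 + eta), q, (P - eta); split=> //; first by lra.
- by lra.
- by rewrite /P; lra.
- by move: hd; rewrite /P /Q; lra.
Qed.

End DecayClasses.

(** * The mean Laplacian of a connected union graph *)

Section Connectivity.
Context {R : realType} {N h : nat}.
Variables (E : 'I_h -> rel 'I_N) (pi : 'I_h -> R).
Hypothesis N_ge2 : (2 <= N)%N.
Hypothesis Esym : forall u, symmetric (E u).
Hypothesis Eirr : forall u, irreflexive (E u).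
Hypothesis Hconn : forall i j : 'I_N, connect (adjU E) i j.
Hypothesis pi_gt0 : forall u, 0 < pi u.

Local Notation Lm := (\sum_(u : 'I_h) pi u *: laplacian R (E u)).

Lemma mean_laplacian_tr : Lm^T = Lm.
Proof.
by rewrite raddf_sum; apply: eq_bigr => u _; rewrite /= linearZ /= laplacian_tr.
Qed.

Lemma mean_laplacian_mul1 : Lm *m const_mx 1 = 0 :> 'cV[R]_N.
Proof.
by rewrite mulmx_suml big1 // => u _; rewrite -scalemxAl laplacian_mul1 // scaler0.
Qed.

Lemma dot_mean_laplacian (v : 'cV[R]_N) :
  dot v (Lm *m v) = \sum_u pi u * dot v (laplacian R (E u) *m v).
Proof.
rewrite mulmx_suml (big_morph (dot v) (@dotDr _ _ _) (dot0r _)).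
by apply: eq_bigr => u _; rewrite -scalemxAl dotZr.
Qed.

Lemma dot_mean_laplacian_ge0 (v : 'cV[R]_N) : 0 <= dot v (Lm *m v).
Proof.
rewrite dot_mean_laplacian; apply: sumr_ge0 => u _.
by rewrite mulr_ge0 ?dot_laplacian_ge0 // ltW.
Qed.

(** Every topology has positive weight, so each of its forms vanishes and v agrees across each of
    its edges; connectivity of the union makes v constant. *)
Lemma dot_mean_laplacian_eq0 (v : 'cV[R]_N) :
  dot v (Lm *m v) = 0 -> \sum_i v i 0 = 0 -> v = 0.
Proof.
rewrite dot_mean_laplacian => /eqP; rewrite psumr_eq0; last first.
  by move=> u _; rewrite mulr_ge0 ?dot_laplacian_ge0 // ltW.
move=> /allP H vs.
have edge u i j : E u i j -> v i 0 = v j 0.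
  move=> uij; have := H u (mem_index_enum _).
  rewrite /= mulf_eq0 gt_eqF //= => /eqP d0.
  have := dot_laplacian v (Esym u) (Eirr u); rewrite d0 mulr0 => /esym/eqP.
  rewrite psumr_eq0 => [/allP|k _]; last by apply: sumr_ge0 => ? _; exact: sqr_ge0.
  move=> /(_ i (mem_index_enum _)) /=; rewrite psumr_eq0 => [/allP|k _]; last exact: sqr_ge0.
  by move=> /(_ j (mem_index_enum _)) /=; rewrite uij /= sqrf_eq0 subr_eq0 => /eqP.
have cst i j : v i 0 = v j 0.
  have /connectP[p] := Hconn i j; elim: p i => [|k p IH] i /= => [_ ->//|/andP[ik kp] jE].
  by rewrite -(IH k) //; have /existsP[u] := ik; exact: edge.
apply/matrixP => i k; rewrite ord1 mxE.
have : N%:R * v i 0 = 0.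
  rewrite -[RHS]vs mulr_natl -[X in _ *+ X](card_ord N) -sumr_const.
  by apply: eq_bigr => j _; exact: cst.
by move=> /eqP; rewrite mulf_eq0 pnatr_eq0 gtn_eqF ?(ltnW N_ge2) //= => /eqP.
Qed.

(** For an active pair with first component i, the corresponding column of J W_u is J e_i, whose
    entry i is 1 - 1/N. Positivity is needed because [alphaC] divides by this constant. *)
Lemma lambdaG_gt0 : 0 < lambdaG R E.
Proof.
pose i0 : 'I_N := Ordinal (ltnW N_ge2); pose i1 : 'I_N := Ordinal N_ge2.
have [i [j [u uij]]] : exists i j u, E u i j.
  have /connectP[[|k p] /=] := Hconn i0 i1; first by move=> _ /(congr1 val).
  by move=> /andP[/existsP[u uE] _] _; exists i0, k, u.
have ij : adjU E i j by apply/existsP; exists u.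
have [p pE] := pairOf_surj ij.
apply: lt_le_trans (le_bigmax _ (fun u => opnorm (Jmat R N *m Wmat R E u) ^+ 2) u).
rewrite lt_neqAle sqr_ge0 andbT eq_sym; apply/negP => /eqP o0.
have := sqnorm_mulmx_le (Jmat R N *m Wmat R E u) (delta_mx p 0); rewrite o0 mul0r => s0.
have /sqnorm_eq0 /matrixP /(_ i 0) :
    sqnorm (Jmat R N *m Wmat R E u *m delta_mx p (0 : 'I_1)) = 0.
  by apply/eqP; rewrite eq_le s0 sqnorm_ge0.
have We k : (Wmat R E u *m delta_mx p (0 : 'I_1)) k 0 = (k == i)%:R.
  rewrite mxE (bigD1 p) //= !mxE !eqxx mulr1 big1 ?addr0.
    by rewrite pE /= uij andbT eq_sym.
  by move=> l /negbTE lp; rewrite !mxE lp mulr0.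
rewrite -mulmxA Jmat_mulE We eqxx mxE.
have -> : \sum_k (Wmat R E u *m delta_mx p (0 : 'I_1)) k 0 = 1.
  rewrite (bigD1 i) //= We eqxx big1 ?addr0 // => k /negbTE ki.
  by rewrite We ki.
rewrite mulr1 => /eqP; rewrite subr_eq0 => /eqP /(congr1 (fun x => x^-1)).
by rewrite invr1 invrK => /eqP; rewrite eq_sym pnatr_eq1 gtn_eqF.
Qed.

End Connectivity.

(** * Mean square consensus and its rate *)

Theorem theorem4
  (R : realType) (dsp : measure_display) (T : measurableType dsp)
  (P : probability T R)
  (n N h : nat) (Hn : (2 <= n)%N) (HN : (2 <= N)%N)
  (a b : nat -> R)
  (Hschur : forall z : R[i], root (bpoly n b) z -> `|z| < 1)
  (E : 'I_h -> rel 'I_N)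
  (Esym : forall u, symmetric (E u)) (Eirr : forall u, irreflexive (E u))
  (Hconn : forall i j : 'I_N, connect (adjU E) i j)
  (Pm : 'M[R]_h) (HPst : stochastic Pm) (HPirr : irreducible Pm)
  (HPap : aperiodic Pm)
  (pi : 'I_h -> R) (Hpi : stationary Pm pi)
  (m : nat -> T -> 'I_h)
  (Hmmeas : forall (t : nat) (u : 'I_h), measurable [set w | m t w = u])
  (Hmarkov : forall (k : nat) (u : nat -> 'I_h),
      P (chain_ev m k.+1 u) = (P (chain_ev m k u) * (Pm (u k) (u k.+1))%:E)%E)
  (sigma : R) (Hsigma : 0 < sigma)
  (c : 'I_N -> 'I_N -> R)
  (dn : nat -> 'I_N -> 'I_N -> {RV P >-> R})
  (Hnoise : forall (k : nat) (u : nat -> 'I_h) (s : seq (nat * 'I_N * 'I_N))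
                   (B : nat * 'I_N * 'I_N -> set R),
      uniq s -> (forall q, q \in s -> adjU E q.1.2 q.2) ->
      (forall q, measurable (B q)) ->
      P (chain_ev m k u `&` [set w | forall q, q \in s -> B q (dn q.1.1 q.1.2 q.2 w)])
      = (P (chain_ev m k u)
         * (\prod_(q <- s) fine (normal_prob 0 sigma (B q)))%:E)%E)
  (lam : nat -> R)
  (Hlam : char_poly (\sum_(u : 'I_h) pi u *: laplacian R (E u))
          = \prod_(i < N) ('X - (lam i)%:P))
  (Hlamsort : forall i j : nat, (i <= j < N)%N -> lam i <= lam j)
  (beta gamma M : R) (Hbeta : 0 < beta) (Hgamma : 0 < gamma)
  (t0 : nat) (Ht0 : gamma * (dmaxU E)%:R - 1 < t0%:R)
  (x0 : 'I_N -> 'cV[R]_n) (z0 : 'I_N -> 'I_N -> R) (HM : 0 < M)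
  (Hx0 : forall i, `|rdot (K2 n b) (x0 i)| <= M)
  (Hz0 : forall i j, adjU E i j -> `|z0 i j| <= M) :
  let X (t : nat) (w : T) : 'I_N -> 'cV[R]_n :=
    xstate a b E c sigma beta gamma M t0 x0 z0
      (fun s => m s w) (fun s i j => dn s i j w) t in
  let Ex (i : 'I_N) (t : nat) : \bar R :=
    (\int[P]_w (sqnorm (X t w i - xbar (X t w)))%:E)%E in
  let lam2 := lam 1%N in
  let lG := lambdaG R E in
  let alpha := alphaC E lam2 in
  let fMv := fM E c sigma M in
  let pmin := pimin pi in
  (beta > (2 * fMv * pmin)^-1 * (gamma * lG ^+ 2 / lam2 ^+ 3 + gamma * alpha) ->
     forall i : 'I_N, (fun t => Ex i t) @ \oo --> 0%E)
  /\
  (gamma > lam2^-1 ->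
   beta > (2 * fMv * pmin)^-1 *
            (gamma ^+ 2 * lG ^+ 2 / (lam2 ^+ 2 * (gamma * lam2 - 1)) + gamma * alpha + 1) ->
     forall i : 'I_N, exists C : R, forall t : nat, (t0.+1 <= t)%N ->
       (Ex i t <= (C / t%:R)%:E)%E).
Proof.
move=> X Ex lam2 lG alpha fMv pmin.
have n_gt0 : (0 < n)%N by exact: ltn_trans Hn.
have N_gt0 : (0 < N)%N by exact: ltn_trans HN.
have pi_gt0 := stationary_gt0 HPst HPirr Hpi.
have pmin_gt0 : 0 < pmin := pimin_gt0 HPst HPirr Hpi.
have fMv_gt0 : 0 < fMv := fM_gt0 Hsigma E c M.
have lG_gt0 : 0 < lG := lambdaG_gt0 HN Hconn.
have Ltr := mean_laplacian_tr pi Esym.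
have L1 := mean_laplacian_mul1 pi Eirr.
have Lpsd := dot_mean_laplacian_ge0 Esym Eirr pi_gt0.
have Lker := dot_mean_laplacian_eq0 HN Esym Eirr Hconn pi_gt0.
have lam2_gt0 : 0 < lam2 := lam1_gt0 HN Ltr L1 Lpsd Lker Hlam Hlamsort.
have Hl2 := lam1_le_dot HN Ltr L1 Lpsd Lker Hlam Hlamsort.
have [Z HZ] := Poisson_equation HPst HPirr Hpi.
have [I [wt [u0 [wt_ge0 HEx]]]] :=
  integral_trj_TT a b c beta gamma M t0 x0 z0 Hmmeas Hmarkov Hnoise.
have InvS0 : Inv b E M (x0, z0) by [].
pose D i j k := TT a b E Pm c sigma beta gamma M t0 0 k
  (fun S _ => sqnorm (S.1 i - xbar S.1)) (x0, z0) (u0 j).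
pose v i k := \sum_j wt j * D i j k.
have ExE i t : Ex i t = (v i (t - t0 - 1)%N)%:E.
  rewrite /Ex /X /xstate -(HEx (fun S => sqnorm (S.1 i - xbar S.1))) //.
  by move=> S; exact: sqnorm_ge0.
have v_ge0 i k : 0 <= v i k.
  rewrite -lee_fin /v -(HEx (fun S => sqnorm (S.1 i - xbar S.1))) => [|S].
    by apply: integral_ge0 => w _; rewrite lee_fin sqnorm_ge0.
  exact: sqnorm_ge0.
pose r := 2 * beta * fMv * pmin - gamma * alpha.
have q_gt0 : 0 < gamma * (lG / lam2) by rewrite mulr_gt0 // divr_gt0.
have rate kappa0 : 0 <= kappa0 -> kappa0 < gamma * lam2 ->
    (gamma * (lG / lam2)) ^+ 2 < (gamma * lam2 - kappa0) * (r - kappa0) ->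
    exists kappa w1 w2 : R, [/\ kappa0 < kappa <= kappa0 + 1, 0 < w1, 0 < w2,
      kappa * w1 <= gamma * (w1 * lam2 - w2 * (lG / lam2)) &
      kappa * w2 <= w2 * r - gamma * (w1 * (lG / lam2))].
  move=> k0 kp hq; have [kappa [w1 [w2 [h1 h2 h3 h4 h5]]]] := contraction_weights q_gt0 kp hq.
  exists kappa, w1, w2; split=> //.
    by apply: le_trans h4 _; rewrite le_eqVlt; apply/orP; left; apply/eqP; ring.
  by apply: le_trans h5 _; rewrite le_eqVlt; apply/orP; left; apply/eqP; ring.
have fp_gt0 : 0 < 2 * fMv * pmin by rewrite !mulr_gt0.
split.
- move=> Hb i.
  have p_gt0 : 0 < gamma * lam2 by exact: mulr_gt0.
  have hr : gamma * lG ^+ 2 / lam2 ^+ 3 < r.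
    rewrite mulrC ltr_pdivrMr // in Hb; rewrite /r ltrBrDr.
    by apply: lt_le_trans Hb _; rewrite le_eqVlt; apply/orP; left; apply/eqP; ring.
  have hq : (gamma * (lG / lam2)) ^+ 2 < (gamma * lam2 - 0) * (r - 0).
    rewrite !subr0 -(ltr_pM2l p_gt0) in hr *; apply: le_lt_trans hr.
    by rewrite le_eqVlt; apply/orP; left; apply/eqP; field; rewrite gt_eqF.
  have [kappa [w1 [w2 [hk w1_gt0 w2_gt0 hk1 hk2]]]] := rate 0 (lexx 0) p_gt0 hq.
  rewrite add0r in hk; have kappa_ge0 : 0 <= kappa by case/andP: hk => /ltW.
  have hv : tends_le0 (v i).
    apply: tends_le0_sum => j; apply: tends_le0_scale => //.
    have hd := sqnorm_dl_tends_le0 a n_gt0 N_gt0 Esym Eirr HPst Hpi Hsigma Hbeta Hgamma HM Ht0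
      lam2_gt0 lG_gt0 Hl2 w1_gt0 w2_gt0 kappa_ge0 hk1 hk2 HZ InvS0 (u0 j) hk.
    apply: (deviation_from_dl n_gt0 HPst Hgamma HM Ht0 Hschur i InvS0
      _ _ _ _ hd).
    + exact: contraction_tends_le0.
    + exact: tends_le0_shift.
    + exact: tends_le0_sum.
    + exact: tends_le0_le.
  rewrite (_ : (fun t => Ex i t) = EFin \o (fun t => v i (t - t0 - 1)%N)); last first.
    by apply/funext => t; rewrite ExE.
  apply: cvg_EFin; first by apply: nearW.
  apply/cvgrPdist_le => e e0; have [K HK] := hv e e0.
  exists (K + t0 + 1)%N => // t /= Kt.
  rewrite sub0r normrN ger0_norm //; apply: HK.
  by rewrite -subnDA -(addnK (t0 + 1)%N K) addnA leq_sub2r.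
- move=> Hg Hb i.
  have p_gt1 : 1 < gamma * lam2 by rewrite -ltr_pdivrMr // mul1r.
  have p1 : 0 < gamma * lam2 - 1 by rewrite subr_gt0.
  have hr : gamma ^+ 2 * lG ^+ 2 / (lam2 ^+ 2 * (gamma * lam2 - 1)) < r - 1.
    rewrite mulrC ltr_pdivrMr // in Hb; rewrite /r ltrBrDr ltrBrDr.
    by apply: le_lt_trans (lt_le_trans Hb _); rewrite le_eqVlt; apply/orP; left; apply/eqP; ring.
  have hq : (gamma * (lG / lam2)) ^+ 2 < (gamma * lam2 - 1) * (r - 1).
    rewrite -(ltr_pM2l p1) in hr; apply: le_lt_trans hr.
    by rewrite le_eqVlt; apply/orP; left; apply/eqP; field; rewrite !gt_eqF.
  have [kappa [w1 [w2 [hk w1_gt0 w2_gt0 hk1 hk2]]]] := rate 1 ler01 p_gt1 hq.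
  rewrite -[1 + 1]/(2 : R) in hk.
  have kappa_ge0 : 0 <= kappa by case/andP: hk => /ltW /(le_trans ler01).
  have hv : O_inv (v i).
    apply: O_inv_sum => j; apply: O_inv_scale => //.
    have hd := sqnorm_dl_O_inv a n_gt0 N_gt0 Esym Eirr HPst Hpi Hsigma Hbeta Hgamma HM Ht0
      lam2_gt0 lG_gt0 Hl2 w1_gt0 w2_gt0 kappa_ge0 hk1 hk2 HZ InvS0 (u0 j) hk.
    apply: (deviation_from_dl n_gt0 HPst Hgamma HM Ht0 Hschur i InvS0
      _ _ _ _ hd).
    + exact: contraction_O_inv.
    + exact: O_inv_shift.
    + exact: O_inv_sum.
    + exact: O_inv_le.
  (* With k = t - t0 - 1 the bound is C / (t - t0), and t <= (t0 + 1)(t - t0) for t > t0. *)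
  have [C C0 HC] := O_inv_ge0 hv; exists (C * t0.+1%:R) => t ht.
  rewrite ExE lee_fin; apply: le_trans (HC _) _.
  have t_gt0 : (0 < t)%N by exact: leq_trans ht.
  rewrite -mulrA; apply: ler_wpM2l => //.
  rewrite ler_pdivlMr ?ltr0n // mulrC ler_pdivrMr ?ltr0n // -natrM ler_nat.
  by rewrite -{1}(subnKC ht) -subnDA addn1 mulnS leq_add2l leq_pmull.
Qed.
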